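(* Let $C\subset\mathbb{R}^{n+1}$ be a convex body of uniform geometry, let $b(r)=\inf_{x\in C}|B_C(x,r)|$ for $r>0$, and let $\phi(v)=\inf\{r>0:b(r)\ge v\}$ be the reciprocal function of $b$. Then, for all $v>0$, $$(n+1)\frac{v}{\phi(v)}\ \ge\ I_C(v)\ \ge\ 3^{-1}8^{-(n+1)}\frac{v}{\phi(v)}.$$
   Context: Here $n\ge 1$. A convex body is a closed convex subset of $\mathbb{R}^{n+1}$ with non-empty interior. $|E|$ is Lebesgue measure and $B_C(x,r)=C\cap B(x,r)$. For measurable $E\subset C$ the relative perimeter is $P_C(E)=\sup\{\int_E \mathrm{div}\,\xi\,dx:\ \xi$ a smooth vector field with compact support in $\mathrm{int}(C)$, $|\xi|\le 1\}$; the isoperimetric profile is $I_C(v)=\inf\{P_C(E): E\subset C\text{ measurable},|E|=v\}$. $C$ is of uniform geometry if it is unbounded and there is $r_0>0$ with $\inf_{x\in C}|C\cap\overline{B}(x,r_0)|>0$. *)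

(* Defs.v *)
From HB Require Import structures.
From mathcomp Require Import all_boot all_order all_algebra.
From mathcomp Require Import all_classical all_reals all_analysis.

Set Implicit Arguments.
Unset Strict Implicit.
Unset Printing Implicit Defensive.

Import Order.TTheory GRing.Theory Num.Theory.
Import numFieldNormedType.Exports.

Local Open Scope classical_set_scope.
Local Open Scope ring_scope.

(* R^(n+1) is represented by 'rV[R]_n.+1. Its library norm is the sup norm,
   which is used only through the topology and the bornology it induces;
   lengths and balls are Euclidean and are defined below. *)
Section euclidean.
Context {R : realType} {n : nat}.
Implicit Types (x : 'rV[R]_n) (r : R).

Definition enorm x : R := Num.sqrt (\sum_(i < n) x 0 i ^+ 2).

Definition eball x r : set 'rV[R]_n := [set y | enorm (y - x) < r].

Definition eclosed_ball x r : set 'rV[R]_n := [set y | enorm (y - x) <= r].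

End euclidean.

(* Lebesgue outer measure: infimum of the total volume of the countable covers
   by half-open boxes. A box with a 0 i >= b 0 i for some i is empty, and its
   volume is 0 because of the truncation. The measurable sets are those
   satisfying Caratheodory's criterion, i.e., the Lebesgue measurable sets (not
   only the Borel sets). *)
Section lebesgue_outer_measure.
Context {R : realType} {n : nat}.
Local Notation V := 'rV[R]_n.+1.

Definition box (c : V * V) : set V :=
  [set x | forall i, c.1 0 i < x 0 i <= c.2 0 i].

Definition box_volume (c : V * V) : R :=
  \prod_(i < n.+1) Num.max 0 (c.2 0 i - c.1 0 i).

Definition box_cover (A : set V) : set (V * V)^nat :=
  [set c | A `<=` \bigcup_k box (c k)].

Definition lebesgue_outer (A : set V) : \bar R :=
  ereal_inf [set (\sum_(k <oo) (box_volume (c k))%:E)%E | c in box_cover A].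

Local Open Scope ereal_scope.

Lemma box_volume_ge0 c : (0 <= box_volume c)%R.
Proof. by apply: prodr_ge0 => i _; rewrite le_max lexx. Qed.

Lemma box_volumeE_ge0 c : 0 <= (box_volume c)%:E.
Proof. by rewrite lee_fin box_volume_ge0. Qed.

Lemma lebesgue_outer_ge0 A : 0 <= lebesgue_outer A.
Proof.
apply: le_ereal_inf_tmp => _ [c _ <-].
by apply: nneseries_ge0 => k _ _; exact: box_volumeE_ge0.
Qed.

Lemma lebesgue_outer0 : lebesgue_outer set0 = 0.
Proof.
apply/eqP; rewrite eq_le lebesgue_outer_ge0 andbT.
apply: ereal_inf_lbound; exists (fun=> (0%R, 0%R)); first exact: sub0set.
apply: eseries0 => k _ _; congr EFin.
by rewrite /box_volume big_ord_recl /= mxE subrr maxxx mul0r.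
Qed.

Lemma le_lebesgue_outer :
  {homo lebesgue_outer : A B / A `<=` B >-> A <= B}.
Proof.
move=> A B AB; apply/ereal_inf_le_tmp => _ [c Bc <-].
by exists c => //; exact: subset_trans AB Bc.
Qed.

Lemma lebesgue_outer_sigma_subadditive : sigma_subadditive lebesgue_outer.
Proof.
move=> A; have [[i ioo]|] := pselect (exists i, lebesgue_outer (A i) = +oo).
  rewrite (eseries_pinfty _ _ ioo) ?leey// => k _.
  by rewrite -ltNye (lt_le_trans _ (lebesgue_outer_ge0 _)).
rewrite -forallNE => Aoo.
suff add2e (e : {posnum R}) : lebesgue_outer (\bigcup_k A k) <=
    \sum_(i <oo) lebesgue_outer (A i) + e%:num%:E.
  by apply/lee_addgt0Pr => _/posnumP[].
rewrite (le_trans _ (epsilon_trick _ _ _))//; last first.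
  by move=> k; exact: lebesgue_outer_ge0.
pose P k c := box_cover (A k) c /\ \sum_(j <oo) (box_volume (c j))%:E <=
  lebesgue_outer (A k) + (e%:num / (2 ^ k.+1)%:R)%:E.
have [G PG] : {G : ((V * V)^nat)^nat & forall k, P k (G k)}.
  apply: (@choice _ _ P) => k; rewrite /P /lebesgue_outer.
  set S := (X in ereal_inf X).
  have Sfin : ereal_inf S \is a fin_num.
    rewrite ge0_fin_numE; last exact: lebesgue_outer_ge0.
    by rewrite ltey; apply/eqP; exact: Aoo.
  have en1 : (0 < e%:num / (2 ^ k.+1)%:R)%R by [].
  have [_ [c Ac <-] xS] := lb_ereal_inf_adherent en1 Sfin.
  by exists c; split => //; exact/ltW.
pose vol (p : nat * nat) := (box_volume (G p.1 p.2))%:E.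
have vol_ge0 p : 0 <= vol p by exact: box_volumeE_ge0.
apply: (@le_trans _ _ (\esum_(p in setT) vol p)).
  apply: ereal_inf_lbound => /=.
  have /card_esym/ppcard_eqP[f] := card_nat2.
  exists (fun k => G (f k).1 (f k).2).
    move=> t [i _] /((PG i).1)[j _ tij]; exists (f^-1%FUN (i, j)) => //=.
    by rewrite invK ?inE.
  rewrite -(esum_pred_image vol f xpredT) ?[fun=> _]set_true//.
  by rewrite image_eq.
rewrite (_ : esum _ _ =
    \sum_(i <oo) \sum_(j <oo) (box_volume (G i j))%:E); last first.
  pose J : nat -> set (nat * nat) := fun i => [set (i, j) | j in setT].
  rewrite (_ : setT = \bigcup_k J k); last first.
    by rewrite predeqE => -[a b]; split => // _; exists a => //; exists b.
  rewrite esum_bigcupT /=; last 2 first.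
    - apply/trivIsetP => i j _ _ ij.
      rewrite predeqE => -[k m] /=; split => //= -[] [_] _ [<-{k} _].
      by move=> [m' _] [] /esym/eqP; rewrite (negbTE ij).
    - by move=> p; exact: vol_ge0.
  rewrite -(image_id [set: nat]) -fun_true esum_pred_image//; last first.
    by move=> k _; exact: esum_ge0.
  apply: eq_eseriesr => /= j _.
  rewrite -(esum_pred_image vol (pair j) predT)//=; last first.
    by move=> ? ? _ _; exact: (@can_inj _ _ _ snd).
  by congr esum; rewrite predeqE => -[a b]; split; move=> [i _ <-]; exists i.
apply: lee_lim.
- apply: is_cvg_nneseries => k _ _.
  by apply: nneseries_ge0 => j _ _; exact: box_volumeE_ge0.
- by apply: is_cvg_nneseries => k _ _; rewrite adde_ge0 ?lebesgue_outer_ge0.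
- by near=> k; apply: lee_sum => j _; exact: (PG j).2.
Unshelve. all: by end_near. Qed.

HB.instance Definition _ := isOuterMeasure.Build R V lebesgue_outer
  lebesgue_outer0 lebesgue_outer_ge0 le_lebesgue_outer
  lebesgue_outer_sigma_subadditive.

End lebesgue_outer_measure.

Definition lebesgueV {R : realType} (n : nat) :
  set (caratheodory_type (@lebesgue_outer R n)) -> \bar R :=
  @lebesgue_outer R n.

HB.instance Definition _ (R : realType) (n : nat) :=
  isMeasure.Build _ _ _ (@lebesgueV R n)
    (@caratheodory_measure0 R _ (@lebesgue_outer R n))
    (@caratheodory_measure_ge0 R _ (@lebesgue_outer R n))
    (@caratheodory_measure_sigma_additive R _ (@lebesgue_outer R n)).

Definition lebesgue_measurable {R : realType} {n : nat}
    (E : set 'rV[R]_n.+1) : Prop :=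
  (@lebesgue_outer R n).-cara.-measurable E.

Section vector_fields.
Context {R : realType} {n : nat}.
Local Notation V := 'rV[R]_n.+1.
Implicit Types (f : V -> R) (xi : V -> V).

Definition partial (i : 'I_n.+1) f : V -> R :=
  fun x => 'D_(delta_mx 0 i) f x.

Fixpoint Ck (k : nat) f : Prop :=
  continuous f /\
  if k is k'.+1 then
    forall i, (forall x, derivable f x (delta_mx 0 i)) /\ Ck k' (partial i f)
  else True.

Definition smooth_field xi : Prop :=
  forall (i : 'I_n.+1) (k : nat), Ck k (fun x => xi x 0 i).

Definition divergence xi : V -> R :=
  fun x => \sum_(i < n.+1) partial i (fun y => xi y 0 i) x.

Definition field_support xi : set V := closure [set x | xi x != 0].

(* A field with compact support in the interior of C is identified with its
   extension by 0 to the whole space. *)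
Definition perimeter_test_field (C : set V) : set (V -> V) :=
  [set xi | [/\ smooth_field xi,
                compact (field_support xi),
                field_support xi `<=` C° &
                forall x, enorm (xi x) <= 1]].

End vector_fields.

Section isoperimetry.
Context {R : realType} {n : nat}.
Local Notation V := 'rV[R]_n.+1.
Local Notation vol := (@lebesgueV R n).
Implicit Types (C E : set V) (v r : R).

Definition convex_body C : Prop :=
  [/\ closed C, @convex_set R V C & C° !=set0].

Local Open Scope ereal_scope.

Definition uniform_geometry C : Prop :=
  ~ bounded_set C /\
  exists2 r0 : R, (0 < r0)%R &
    0 < ereal_inf [set vol (C `&` eclosed_ball x r0) | x in C].

Definition relative_perimeter C E : \bar R :=
  ereal_sup [set \int[vol]_(x in E) (divergence xi x)%:E |
    xi in perimeter_test_field C].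

Definition isoperimetric_profile C v : \bar R :=
  ereal_inf [set relative_perimeter C E |
    E in [set E | [/\ lebesgue_measurable E, E `<=` C & vol E = v%:E]]].

Definition min_ball_volume C r : \bar R :=
  ereal_inf [set vol (C `&` eball x r) | x in C].

Definition reciprocal_ball_volume C v : \bar R :=
  ereal_inf [set r%:E | r in [set r | (0 < r)%R /\ v%:E <= min_ball_volume C r]].

End isoperimetry.

(* Main.v *)
(* Upper bound: if r < phi(v), some ball C `&` B(x, r) has volume less than v, so
   by continuity a larger concentric ball E = C `&` B(x, s) has volume exactly v.
   Convexity gives |C `&` B(x, t)| <= (t / s)^(n+1) |E| for t >= s, which bounds
   the volume of thin shells around E; testing with Lipschitz radial cutoffs and
   difference quotients then gives P_C(E) <= (n+1) v / s.

   Lower bound: let r be such that every C `&` B(x, r) has volume at least v. Two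
   disjoint balls fit in a ball of three times the radius because C is unbounded,
   so with L = 3 r every C `&` B(x, L) has volume at least 2 v and E fills at most
   half of it. Move the mass of E at x along segments to the points y outside E
   with |y - x| < L, spread proportionally to 1 / |C `&` B(x, L)|. After
   mollification the momentum of this motion is a smooth field supported in the
   interior of C, whose length is at most 4^(n+1) L: at each time substitute the
   intermediate point for the endpoint closer to it, and use
   |C `&` B(x, L)| >= 2^-(n+1) |C `&` B(z, L)|. The mass inside E drops by at
   least v / 4 in total, and its rate of change is minus the integral over E of
   the divergence of the field, so some instant provides a test field showing
   P_C(E) >= v / (4 * 4^(n+1) * L) >= 3^-1 * 8^-(n+1) * v / r. The last step uses
   n >= 1. *)
From HB Require Import structures.
Require Import Defs.
From mathcomp Require Import all_boot all_order all_algebra.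
From mathcomp Require Import all_classical all_reals all_analysis.
From mathcomp Require Import measurable_realfun ring lra.

Set Implicit Arguments.
Unset Strict Implicit.
Unset Printing Implicit Defensive.

Import Order.TTheory GRing.Theory Num.Theory.
Import numFieldNormedType.Exports.

Local Open Scope classical_set_scope.
Local Open Scope ring_scope.

(** Neither bound goes through a Gauss-Green or coarea formula: in the upper bound the derivative is
    moved onto a Lipschitz cutoff by translating the integral, and in the lower bound the mean value
    theorem in time selects the test field. The obstacle in the lower bound is mollification. It
    would push the field out of the interior of [C], so the transport takes place in a contraction
    [D] of a bounded part of [C]. It also smears mass across the boundary of [E]; this [leak] is
    negligible relative to the mass of the mollifier, by approximating [E] by finitely many boxes.
    The factor 4^(n+1) is a product: 2^(n+1) bounds the Jacobian of the substitution, whose ratio is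
    at least 1/2, and 2^(n+1) comes from doubling the balls. Without losses the mass in [E] would
    drop by v / 2; the value v / 4 leaves room for the truncation and the leaks. The infimum
    defining phi is never assumed to be attained: both bounds are proved for radii on one side of
    phi, and the degenerate values of phi are treated separately. *)

Section euclidean_norm.
Context {R : realType} {n : nat}.
Implicit Types (x y z : 'rV[R]_n) (r s : R).

Definition dotp x y : R := \sum_i x 0 i * y 0 i.

Lemma dotpp_ge0 x : 0 <= dotp x x.
Proof. by apply: sumr_ge0 => i _; rewrite -expr2 sqr_ge0. Qed.

Lemma enorm_ge0 x : 0 <= enorm x.
Proof. exact: sqrtr_ge0. Qed.

Lemma enorm_sqr x : enorm x ^+ 2 = dotp x x.
Proof.
rewrite /enorm sqr_sqrtr; last by apply: sumr_ge0 => i _; rewrite sqr_ge0.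
by apply: eq_bigr => i _; rewrite expr2.
Qed.

Lemma dotpC x y : dotp x y = dotp y x.
Proof. by apply: eq_bigr => i _; rewrite mulrC. Qed.

Lemma dotpDr x y z : dotp x (y + z) = dotp x y + dotp x z.
Proof. by rewrite -big_split; apply: eq_bigr => i _; rewrite mxE mulrDr. Qed.

Lemma dotpZr r x y : dotp x (r *: y) = r * dotp x y.
Proof. by rewrite mulr_sumr; apply: eq_bigr => i _; rewrite mxE mulrCA. Qed.

Lemma dotpDl x y z : dotp (x + y) z = dotp x z + dotp y z.
Proof. by rewrite dotpC dotpDr !(dotpC z). Qed.

Lemma dotpZl r x y : dotp (r *: x) y = r * dotp x y.
Proof. by rewrite dotpC dotpZr dotpC. Qed.

Lemma coord_le_enorm x i : `|x 0 i| <= enorm x.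
Proof.
rewrite -(@ler_pXn2r _ 2) ?nnegrE ?enorm_ge0 // real_normK ?num_real //.
rewrite enorm_sqr /dotp (bigD1 i) //= -expr2 lerDl.
by apply: sumr_ge0 => j _; rewrite -expr2 sqr_ge0.
Qed.

Lemma enorm_eq0 x : (enorm x == 0) = (x == 0).
Proof.
apply/eqP/eqP => [x0|->].
  apply/rowP => i; rewrite mxE; apply/eqP; rewrite -normr_le0 -x0.
  exact: coord_le_enorm.
by rewrite /enorm big1 ?sqrtr0 // => i _; rewrite mxE expr0n.
Qed.

Lemma enorm0 : enorm (0 : 'rV[R]_n) = 0.
Proof. by apply/eqP; rewrite enorm_eq0. Qed.

Lemma enormZ r x : enorm (r *: x) = `|r| * enorm x.
Proof.
apply/eqP; rewrite -(@eqrXn2 _ 2) ?mulr_ge0 ?enorm_ge0 //.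
by rewrite exprMn !enorm_sqr dotpZl dotpZr real_normK ?num_real // mulrA -expr2.
Qed.

Lemma enormN x : enorm (- x) = enorm x.
Proof. by rewrite -scaleN1r enormZ normrN1 mul1r. Qed.

Lemma enormB x y : enorm (x - y) = enorm (y - x).
Proof. by rewrite -enormN opprB. Qed.

(** Cauchy-Schwarz: the square of the length of [enorm y *: x - enorm x *: y] expands to 2 |x| |y|
    (|x| |y| - x.y). *)
Lemma dotp_le_enorm x y : dotp x y <= enorm x * enorm y.
Proof.
have [x0|x0] := eqVneq (enorm x) 0.
  rewrite x0 mul0r; move/eqP: x0; rewrite enorm_eq0 => /eqP ->.
  by rewrite /dotp big1 // => i _; rewrite mxE mul0r.
have [y0|y0] := eqVneq (enorm y) 0.
  rewrite y0 mulr0; move/eqP: y0; rewrite enorm_eq0 => /eqP ->.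
  by rewrite /dotp big1 // => i _; rewrite mxE mulr0.
have xy0 : 0 < enorm x * enorm y.
  by rewrite mulr_gt0 // lt_neqAle enorm_ge0 eq_sym ?x0 ?y0.
have := dotpp_ge0 (enorm y *: x + (- enorm x) *: y).
rewrite !(dotpDl, dotpDr, dotpZl, dotpZr) -!enorm_sqr (dotpC y x) => H.
rewrite -(ler_pM2l xy0); move: H; lra.
Qed.

Lemma normr_dotp x y : `|dotp x y| <= enorm x * enorm y.
Proof.
rewrite ler_norml dotp_le_enorm andbT lerNl -mulN1r -dotpZr scaleN1r.
by rewrite -(enormN y) dotp_le_enorm.
Qed.

Lemma enormD x y : enorm (x + y) <= enorm x + enorm y.
Proof.
rewrite -(@ler_pXn2r _ 2) ?nnegrE ?addr_ge0 ?enorm_ge0 //.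
rewrite sqrrD !enorm_sqr !(dotpDl, dotpDr) (dotpC y x).
have := dotp_le_enorm x y; lra.
Qed.

Lemma enorm_triangle y x z : enorm (x - z) <= enorm (x - y) + enorm (y - z).
Proof. by rewrite (le_trans _ (enormD _ _)) // addrA subrK. Qed.

(** Allows Cauchy-Schwarz to bound a sum of products of absolute values of coordinates. *)
Definition absv x : 'rV[R]_n := \row_i `|x 0 i|.

Lemma enorm_absv x : enorm (absv x) = enorm x.
Proof.
by congr Num.sqrt; apply: eq_bigr => i _; rewrite mxE real_normK ?num_real.
Qed.

Lemma enorm_le_sum x : enorm x <= \sum_i `|x 0 i|.
Proof.
rewrite -(@ler_pXn2r _ 2) ?nnegrE ?enorm_ge0 ?sumr_ge0 //.
rewrite enorm_sqr expr2 mulr_suml; apply: ler_sum => i _.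
rewrite (le_trans (ler_norm _)) // normrM ler_wpM2l //.
by rewrite (bigD1 i) //= lerDl sumr_ge0.
Qed.

End euclidean_norm.

(** * Euclidean balls as a basis of the topology *)

Section euclidean_ball_topology.
Context {R : realType} {n : nat}.
Local Notation V := 'rV[R]_n.+1.
Implicit Types (x y : V) (A : set V).

Lemma ball_eball x (r : R) : eball x r `<=` ball x r.
Proof.
move=> y xy; split=> [|i j]; first exact: le_lt_trans (enorm_ge0 _) xy.
rewrite (ord1 i) /ball /= (le_lt_trans _ xy) //.
by rewrite distrC (le_trans _ (coord_le_enorm _ j)) // !mxE.
Qed.

Lemma eball_ball x (r : R) : ball x (r / n.+1%:R) `<=` eball x r.
Proof.
move=> y [_ xy]; rewrite /eball /= (le_lt_trans (enorm_le_sum _)) //.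
rewrite (_ : r = \sum_(i < n.+1) (r / n.+1%:R)); last first.
  by rewrite sumr_const card_ord -[RHS]mulr_natr divfK // pnatr_eq0.
apply: ltr_sum; first by apply/hasP; exists ord0; rewrite ?mem_index_enum.
by move=> i _; have := xy 0 i; rewrite /ball /= distrC !mxE.
Qed.

Lemma nbhs_eballP x A : nbhs x A <-> exists2 r : R, 0 < r & eball x r `<=` A.
Proof.
rewrite -filter_from_ballE; split => -[r /= r0 rA].
  by exists r => //; exact: subset_trans (@ball_eball _ _) rA.
exists (r / n.+1%:R) => /=; first by rewrite divr_gt0.
exact: subset_trans (@eball_ball _ _) rA.
Qed.

End euclidean_ball_topology.

(** * Lebesgue measure: homotheties, measurability of open sets, change of variables *)

Section lebesgue.
Context {R : realType} {n : nat}.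
Local Notation V := 'rV[R]_n.+1.
Local Notation leb := (@lebesgue_outer R n).
Local Notation vol := (@lebesgueV R n).
Local Notation VM := (caratheodory_type leb).
Implicit Types (a x y : V) (A B : set V) (l r : R).

(** Here [a] is the image of the origin, not the centre; the homothety of ratio [l] centred at [x]
    is [homoth (x - l *: x) l]. *)
Definition homoth a l : V -> V := fun x => a + l *: x.

Lemma homothK a l : l != 0 -> cancel (homoth a l) (homoth (- l^-1 *: a) l^-1).
Proof.
move=> l0 x; rewrite /homoth scalerDr addrA scalerA mulVf // scale1r.
by rewrite scaleNr addNr add0r.
Qed.

Lemma homothVK a l : l != 0 -> cancel (homoth (- l^-1 *: a) l^-1) (homoth a l).
Proof.
move=> l0 x; rewrite /homoth scalerDr addrA !scalerA mulrN divff //.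
by rewrite scaleN1r subrr add0r scale1r.
Qed.

Definition homoth_box a l (c : V * V) : V * V := (homoth a l c.1, homoth a l c.2).

Lemma box_volume_homoth a l c : 0 < l ->
  box_volume (homoth_box a l c) = l ^+ n.+1 * box_volume c.
Proof.
move=> l0; rewrite /box_volume -[in l ^+ _](card_ord n.+1) -prodr_const.
rewrite -big_split /=; apply: eq_bigr => i _; rewrite !mxE.
rewrite opprD addrACA subrr add0r -mulrBr -[X in Num.max X _](mulr0 l).
by rewrite -maxr_pMr // ltW.
Qed.

Lemma box_homoth a l c : 0 < l ->
  homoth a l @` box c `<=` box (homoth_box a l c).
Proof.
move=> l0 _ [x cx <-] i; have /andP[? ?] := cx i.
by rewrite !mxE ltrD2l lerD2l ltr_pM2l // ler_pM2l //; apply/andP.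
Qed.

Lemma leb_homoth_le a l A : 0 < l ->
  (leb (homoth a l @` A) <= (l ^+ n.+1)%:E * leb A)%E.
Proof.
move=> l0; rewrite muleC -lee_pdivrMr ?exprn_gt0 //.
apply: le_ereal_inf_tmp => _ [c Ac <-].
rewrite lee_pdivrMr ?exprn_gt0 // muleC -nneseriesZl; last first.
  by move=> *; exact: box_volumeE_ge0.
apply: ereal_inf_lbound; exists (fun k => homoth_box a l (c k)).
  move=> _ [x /Ac[k _ ckx] <-]; exists k => //.
  by apply: box_homoth => //; exists x.
by apply: eq_eseriesr => k _; rewrite box_volume_homoth // EFinM.
Qed.

Lemma image_homoth a l A : l != 0 ->
  homoth a l @` A = homoth (- l^-1 *: a) l^-1 @^-1` A.
Proof.
move=> l0; apply/seteqP; split=> [_ [x Ax <-]|y Ay] /=; first by rewrite homothK.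
by eexists; [exact: Ay | rewrite homothVK].
Qed.

Lemma preimage_homoth a l A : l != 0 ->
  homoth a l @^-1` A = homoth (- l^-1 *: a) l^-1 @` A.
Proof.
move=> l0; apply/seteqP; split=> [x Ax|_ [x Ax <-]] /=; last by rewrite homothVK.
by exists (homoth a l x) => //; rewrite homothK.
Qed.

(** The converse inequality is the same covering argument applied to the inverse homothety. *)
Lemma leb_homoth a l A : 0 < l ->
  leb (homoth a l @` A) = ((l ^+ n.+1)%:E * leb A)%E.
Proof.
move=> l0; apply/eqP; rewrite eq_le leb_homoth_le //=.
have l0' : l != 0 by rewrite gt_eqF.
rewrite muleC -lee_pdivlMr ?exprn_gt0 //.
have := @leb_homoth_le (- l^-1 *: a) l^-1 (homoth a l @` A).
rewrite invr_gt0 => /(_ l0); rewrite exprVn muleC; apply: le_trans.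
rewrite (_ : _ @` _ = A) //; apply/seteqP; split.
  by move=> _ [_ [x Ax <-] <-]; rewrite homothK.
by move=> x Ax; exists (homoth a l x); [exists x|rewrite homothK].
Qed.

Lemma leb_preimage_homoth a l A : 0 < l ->
  leb (homoth a l @^-1` A) = ((l ^- n.+1)%:E * leb A)%E.
Proof.
by move=> l0; rewrite preimage_homoth ?gt_eqF // leb_homoth ?invr_gt0 // exprVn.
Qed.

(** A homothety scales the outer measure of every set by one factor, so Caratheodory's criterion
    against [X] is the criterion for [A] against the image of [X]. *)
Lemma measurable_preimage_homoth a l A : 0 < l ->
  lebesgue_measurable A -> lebesgue_measurable (homoth a l @^-1` A).
Proof.
move=> l0 mA; rewrite /lebesgue_measurable.
apply: le_caratheodory_measurable => X.
have := @leb_preimage_homoth a l (homoth a l @` X) l0.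
have -> : homoth a l @^-1` (homoth a l @` X) = X.
  apply/seteqP; split=> [x [y Xy]|x Xx]; last by exists x.
  by move/(can_inj (homothK _ (lt0r_neq0 l0))) => <-.
move=> XE; change (leb (X `&` homoth a l @^-1` A) +
  leb (X `&` ~` (homoth a l @^-1` A)) <= leb X)%E.
rewrite XE (mA (homoth a l @` X)) ge0_muleDr ?lebesgue_outer_ge0 //.
rewrite -!(leb_preimage_homoth a) //; apply: leeD; apply: le_lebesgue_outer.
  by move=> x [Xx Ax]; split => //; exists x.
by move=> x [Xx Ax]; split => //; exists x.
Qed.

(** Cutting each box of a cover along the hyperplane yields two half-open boxes whose volumes add up
    exactly, hence separate covers of the two parts of the test set. *)
Lemma measurable_halfspace (i : 'I_n.+1) (t : R) :
  lebesgue_measurable [set x : V | x 0 i <= t].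
Proof.
rewrite /lebesgue_measurable; apply: le_caratheodory_measurable => X.
apply: le_ereal_inf_tmp => _ [c Xc <-].
(* The [min] and [max] also cover the boxes that the hyperplane misses: one half then has a
   truncated side of length 0. *)
pose c1 k : V * V := ((c k).1, \row_j if j == i then Num.min ((c k).2 0 j) t else (c k).2 0 j).
pose c2 k : V * V := (\row_j if j == i then Num.max ((c k).1 0 j) t else (c k).1 0 j, (c k).2).
have -> : (\sum_(k <oo) (box_volume (c k))%:E =
    \sum_(k <oo) (box_volume (c1 k))%:E + \sum_(k <oo) (box_volume (c2 k))%:E)%E.
  rewrite -nneseriesD; try by move=> *; exact: box_volumeE_ge0.
  apply: eq_eseriesr => k _; rewrite -EFinD; congr EFin.
  pose p := \prod_(j < n.+1 | j != i) Num.max 0 ((c k).2 0 j - (c k).1 0 j).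
  have vE (d : V * V) : (forall j, j != i -> d.1 0 j = (c k).1 0 j /\ d.2 0 j = (c k).2 0 j) ->
      box_volume d = Num.max 0 (d.2 0 i - d.1 0 i) * p.
    move=> dc; rewrite /box_volume (bigD1 i) //=; congr (_ * _).
    by apply: eq_bigr => j /dc[-> ->].
  rewrite !vE //; try by move=> j ji; rewrite !mxE (negbTE ji).
  rewrite !mxE eqxx -mulrDl; congr (_ * _).
  rewrite /Order.min /Order.max; do !case: ifP; lra.
apply: leeD; apply: ereal_inf_lbound.
  exists c1 => // x [Xx xt]; have [k _ ckx] := Xc x Xx; exists k => // j.
  rewrite mxE /=; have /andP[-> /=] := ckx j; case: ifP => // /eqP ->.
  by rewrite le_min xt andbT.
exists c2 => // x [Xx /negP]; rewrite -ltNge => xt.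
have [k _ ckx] := Xc x Xx; exists k => // j.
rewrite mxE /=; have /andP[/= ? ->] := ckx j; rewrite andbT.
by case: ifP => // /eqP ji; rewrite gt_max ji xt andbT -ji.
Qed.

Lemma measurable_coord (i : 'I_n.+1) :
  measurable_fun setT (fun x : VM => (x : V) 0 i).
Proof.
move=> mD; apply: (measurability _ (RGenOInfty.measurableE R)) => //.
move=> _ [_ [r ->] <-]; rewrite setTI.
have -> : (fun x : VM => (x : V) 0 i) @^-1` `]r, +oo[%classic =
    ~` [set x : V | x 0 i <= r].
  by apply/seteqP; split=> x /=; rewrite in_itv /= andbT ltNge => /negP.
exact/measurableC/measurable_halfspace.
Qed.

Lemma measurable_box (c : V * V) : lebesgue_measurable (box c).
Proof.
have -> : box c = \bigcap_(i in [set: 'I_n.+1])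
    ([set x : V | x 0 i <= c.2 0 i] `\` [set x : V | x 0 i <= c.1 0 i]).
  apply/seteqP; split => x cx i => [_|]; first have /andP[? ?] := cx i.
    by split => //=; apply/negP; rewrite -ltNge.
  by have [//|/= ? /negP] := cx i; rewrite -ltNge => ->.
apply: fin_bigcap_measurable; first exact: finite_finset.
by move=> i _; apply: measurableD; exact: measurable_halfspace.
Qed.

Lemma measurable_open A : open A -> lebesgue_measurable A.
Proof.
move=> oA.
pose q (c : 'rV[rat]_n.+1 * 'rV[rat]_n.+1) : V * V :=
  (map_mx ratr c.1, map_mx ratr c.2).
(* The inclusion in [A] is part of the set, so that the union may range over the countable type of
   all rational boxes; the boxes not inside [A] contribute nothing. *)
pose F c := [set x | box (q c) `<=` A /\ box (q c) x].
have -> : A = \bigcup_(c in setT) F c.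
  apply/seteqP; split => [x Ax|x [c _ [cA cx]]]; last exact: cA.
  have /nbhs_ballP[e /= e0 eA] : nbhs x A by exact: open_nbhs_nbhs.
  have /choice[a Ha] : forall i, exists p : rat, x 0 i - e < ratr p < x 0 i.
    move=> i; have : x 0 i - e < x 0 i by lra.
    by move=> /rat_in_itvoo[p]; rewrite in_itv /=; exists p.
  have /choice[b Hb] : forall i, exists p : rat, x 0 i < ratr p < x 0 i + e.
    move=> i; have : x 0 i < x 0 i + e by lra.
    by move=> /rat_in_itvoo[p]; rewrite in_itv /=; exists p.
  exists (\row_i a i, \row_i b i) => //; split.
    move=> y cy; apply: eA; split => // j i; rewrite (ord1 j).
    have := cy i; rewrite !mxE /ball /= => /andP[y1 y2].
    by have := Ha i; have := Hb i; rewrite ltr_norml; lra.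
  by move=> i; rewrite !mxE; have := Ha i; have := Hb i; lra.
apply: (countable_bigcupT_measurable (T := VM)); first exact: countableP.
move=> c; have [cA|cA] := pselect (box (q c) `<=` A).
  rewrite (_ : F c = box (q c)); first exact: measurable_box.
  by apply/seteqP; split => [x []|].
by rewrite (_ : F c = set0) //; apply/seteqP; split => [x []|].
Qed.

Lemma measurable_closed A : closed A -> lebesgue_measurable A.
Proof.
by move=> cA; rewrite -(setCK A); apply/measurableC/measurable_open; exact: closed_openC.
Qed.

Lemma continuous_measurable_vec (f : V -> R) : continuous f ->
  measurable_fun setT (f : VM -> R).
Proof.
move=> /continuousP cf mD; apply: (measurability _ (RGenOpens.measurableE R)) => //.
move=> _ [_ [x [y ->]] <-]; rewrite setTI; apply: measurable_open.
by apply: cf; exact: interval_open.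
Qed.

Lemma box_volume00 : box_volume ((0, 0) : V * V) = 0.
Proof. by rewrite /box_volume big_ord_recl /= mxE subrr maxxx mul0r. Qed.

Lemma vol_box_le (c : V * V) : (vol (box c) <= (box_volume c)%:E)%E.
Proof.
pose d (k : nat) : V * V := if k == 0%N then c else (0, 0).
have cd : box_cover (box c) d by move=> x cx; exists 0%N.
have -> : ((box_volume c)%:E = \sum_(k <oo) (box_volume (d k))%:E)%E.
  rewrite (nneseries_split 0 1); last by move=> *; exact: box_volumeE_ge0.
  rewrite big_nat1 /= eseries0 ?adde0 // => k k0 _.
  by rewrite /d; case: k k0 => //= k _; rewrite box_volume00.
by apply: ereal_inf_lbound; exists d.
Qed.

Lemma vol_ge0 A : (0 <= vol A)%E.
Proof. exact: lebesgue_outer_ge0. Qed.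

Lemma le_vol A B : A `<=` B -> (vol A <= vol B)%E.
Proof. exact: le_lebesgue_outer. Qed.

Lemma vol_eball_lty x r : (vol (eball x r) < +oo)%E.
Proof.
pose c : V * V := (\row_i (x 0 i - r - 1), \row_i (x 0 i + r)).
apply: le_lt_trans (ltry (box_volume c)); apply: le_trans (vol_box_le c).
apply: le_vol => y xy i; rewrite !mxE.
have := le_lt_trans (coord_le_enorm _ i) xy; rewrite !mxE ltr_norml; lra.
Qed.

Lemma eball_bigcup x : \bigcup_k eball x k%:R = setT.
Proof.
apply/seteqP; split => // y _; exists (Num.bound (enorm (y - x))) => //; rewrite /eball /=.
by rewrite archi_boundP // enorm_ge0.
Qed.

Lemma open_eball x r : open (eball x r).
Proof.
rewrite openE => y xy; apply/nbhs_eballP; exists (r - enorm (y - x)).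
  by rewrite subr_gt0.
move=> z; rewrite /eball /= ltrBrDr => yz.
by rewrite (le_lt_trans (enorm_triangle y _ _)).
Qed.

Lemma measurable_eball x r : lebesgue_measurable (eball x r).
Proof. exact/measurable_open/open_eball. Qed.

(** Required for the product measure and Fubini-Tonelli, on which the whole lower bound relies. *)
Lemma vol_sigma_finite : sigma_finite setT vol.
Proof.
exists (fun k => eball 0 k%:R); first by rewrite eball_bigcup.
by move=> k; split; [exact: measurable_eball | exact: vol_eball_lty].
Qed.

HB.instance Definition _ := Measure_isSigmaFinite.Build _ _ _ vol vol_sigma_finite.

Lemma vol_preimage_homoth a l A : 0 < l ->
  vol (homoth a l @^-1` A) = ((l ^- n.+1)%:E * vol A)%E.
Proof. exact: leb_preimage_homoth. Qed.

Lemma vol_homoth a l A : 0 < l ->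
  vol (homoth a l @` A) = ((l ^+ n.+1)%:E * vol A)%E.
Proof. exact: leb_homoth. Qed.

Lemma measurable_homoth a l : 0 < l ->
  measurable_fun setT (homoth a l : VM -> VM).
Proof. by move=> l0 _ A mA; rewrite setTI; exact: measurable_preimage_homoth. Qed.

Local Open Scope ereal_scope.

(** The image of the volume under the homothety is the volume times l^-(n+1). *)
Lemma ge0_integral_homoth a l (f : VM -> \bar R) : (0 < l)%R ->
  measurable_fun setT f -> (forall x, 0 <= f x) ->
  \int[vol]_x f (homoth a l x) = (l ^- n.+1)%:E * \int[vol]_x f x.
Proof.
move=> l0 mf f0.
have mh := measurable_homoth a l0.
have ln0 : (0 <= l ^- n.+1)%R by rewrite invr_ge0 exprn_ge0 // ltW.
rewrite -[RHS](@ge0_integral_mscale _ _ _ vol setT measurableT (NngNum ln0)) //.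
have := @ge0_integral_pushforward _ _ _ _ _ _ mh vol setT f measurableT mf.
rewrite preimage_setT => <-; last by move=> x _; exact: f0.
apply: eq_measure_integral => A mA _; exact: vol_preimage_homoth.
Qed.

Lemma integral_shift a (f : VM -> \bar R) :
  measurable_fun setT f -> vol.-integrable setT f ->
  \int[vol]_x f ((x : V) + a)%R = \int[vol]_x f x.
Proof.
move=> mf intf.
have hE : (fun x : VM => ((x : V) + a)%R : VM) = homoth a 1.
  by apply/funext => x; rewrite /homoth scale1r addrC.
have mh : measurable_fun setT (fun x : VM => ((x : V) + a)%R : VM).
  by rewrite hE; exact: measurable_homoth.
have pE (A : set VM) : measurable A -> A `<=` setT -> pushforward vol (fun x : VM => ((x : V) + a)%R : VM) A = vol A.
  move=> mA _; rewrite hE; have := vol_preimage_homoth a A (@ltr01 R).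
  by rewrite expr1n invr1 mul1e.
have := @integral_pushforward _ _ _ _ _ _ mh vol setT f mf.
rewrite preimage_setT => /(_ _ measurableT) <-; first exact: eq_measure_integral.
(* Integrability of the translate is the case [l = 1] of the nonnegative change of variables,
   applied to the absolute value of [f]. *)
apply/integrableP; split; first exact: measurableT_comp mf mh.
have /integrableP[_] := intf; apply: le_lt_trans.
have mabs : measurable_fun setT (fun x : VM => `|f x|) by exact: measurableT_comp.
have := @ge0_integral_homoth a 1 _ ltr01 mabs (fun x => abse_ge0 _).
rewrite expr1n invr1 mul1e => <-; rewrite le_eqVlt; apply/orP; left; apply/eqP.
apply: eq_integral => x _; congr (`|f _|).
by have := congr1 (@^~ x) hE.
Qed.

End lebesgue.

(** * Volumes of balls relative to a convex set *)

Section convex_ball_volume.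
Context {R : realType} {n : nat}.
Local Notation V := 'rV[R]_n.+1.
Local Notation vol := (@lebesgueV R n).
Implicit Types (x y : V) (A C D : set V) (r s t v : R).

Definition segment_closed C : Prop :=
  forall x y t, C x -> C y -> 0 <= t <= 1 -> C (x + t *: (y - x)).

Lemma convex_segment_closed C : @convex_set R V C -> segment_closed C.
Proof.
move=> cC x y t Cx Cy /andP[t0 t1].
have := cC y x (Itv01 t0 t1); rewrite !inE => /(_ Cy Cx).
set z := (X in C X); suff -> : z = x + t *: (y - x) :> V by [].
rewrite /z /conv /= /unstable.onem scalerBl scale1r scalerBr addrCA.
by congr (_ + _); rewrite addrC.
Qed.

Lemma homoth_center x y l : homoth (x - l *: x) l y = x + l *: (y - x).
Proof. by rewrite /homoth scalerBr addrAC addrA. Qed.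

Definition ballv C x r : R := fine (vol (C `&` eball x r)).

Lemma fin_vol_ball C x r : vol (C `&` eball x r) \is a fin_num.
Proof.
rewrite ge0_fin_numE ?vol_ge0 // (le_lt_trans _ (vol_eball_lty x r)) //.
by apply: le_vol; exact: subIsetr.
Qed.

Lemma vol_ball_lty C x r : (vol (C `&` eball x r) < +oo)%E.
Proof. by have := fin_vol_ball C x r; rewrite ge0_fin_numE ?vol_ge0. Qed.

Lemma ballvE C x r : vol (C `&` eball x r) = (ballv C x r)%:E.
Proof. by rewrite fineK // fin_vol_ball. Qed.

Lemma ballv_ge0 C x r : 0 <= ballv C x r.
Proof. exact/fine_ge0/vol_ge0. Qed.

Lemma le_ballv C D x y r s : C `&` eball x r `<=` D `&` eball y s ->
  ballv C x r <= ballv D y s.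
Proof. by move=> CD; rewrite -lee_fin -!ballvE; exact: le_vol. Qed.

Lemma le_eball x r s : r <= s -> eball x r `<=` eball x s.
Proof. by move=> rs y /= /lt_le_trans; apply. Qed.

Lemma eball_subset x y r s : enorm (y - x) + r <= s -> eball y r `<=` eball x s.
Proof.
move=> rs z; rewrite /eball /= => zy.
by rewrite (le_lt_trans (enorm_triangle y _ _)) // (lt_le_trans _ rs) // addrC ltrD2l.
Qed.

(** Contracting the larger ball towards [x] by the ratio r / s keeps it in [C] by convexity and
    lands in the smaller ball. This is the source of every volume comparison below. *)
Lemma ballv_scale C x r s : segment_closed C -> C x -> 0 < r -> r <= s ->
  ballv C x s <= (s / r) ^+ n.+1 * ballv C x r.
Proof.
move=> cC Cx r0 rs; have s0 : 0 < s by exact: lt_le_trans rs.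
have l0 : 0 < r / s by rewrite divr_gt0.
have H : homoth (x - (r / s) *: x) (r / s) @` (C `&` eball x s) `<=` C `&` eball x r.
  move=> _ [y [Cy ys] <-]; rewrite homoth_center; split.
    by apply: cC => //; rewrite ltW //= ler_pdivrMr // mul1r.
  rewrite /eball /= addrC addKr enormZ gtr0_norm //.
  by rewrite mulrAC ltr_pdivrMr // ltr_pM2l.
have := le_vol H; rewrite vol_homoth // !ballvE -EFinM lee_fin.
rewrite -(ler_pM2l (_ : 0 < (s / r) ^+ n.+1)); last by rewrite exprn_gt0 // divr_gt0.
rewrite mulrA -exprMn (_ : s / r * (r / s) = 1) ?expr1n ?mul1r //.
by field; rewrite !gt_eqF.
Qed.

Lemma vol_eball x r : 0 < r ->
  vol (eball x r) = ((r ^+ n.+1)%:E * vol (eball (0 : V) 1))%E.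
Proof.
move=> r0; rewrite -(@vol_homoth _ _ x) //; congr (vol _).
apply/seteqP; split=> [y yx|_ [y y1 <-]].
  exists (r^-1 *: (y - x)).
    by rewrite /eball /= subr0 enormZ gtr0_norm ?invr_gt0 // ltr_pdivrMl // mulr1.
  by rewrite /homoth scalerA divff ?gt_eqF // scale1r addrC subrK.
move: y1; rewrite /eball /homoth /= subr0 addrC addKr enormZ gtr0_norm // => y1.
by rewrite -[ltRHS]mulr1 ltr_pM2l.
Qed.

Lemma unbounded_enorm C x r : ~ bounded_set C -> exists2 y, C y & r < enorm (y - x).
Proof.
move=> nbC; apply: contrapT => H; apply: nbC.
exists (r + enorm x); split; first exact: num_real.
move=> M /ltW rM y Cy.
have yr : enorm (y - x) <= r.
  by rewrite leNgt; apply/negP => ry; apply: H; exists y.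
have yM : enorm y <= M.
  by rewrite -(subrK x y) (le_trans (enormD _ _)) // (le_trans _ rM) // lerD2r.
suff H1 : mx_norm (y : V) <= M by exact: H1.
rewrite mx_normrE.
apply: bigmax_le; first exact: le_trans (enorm_ge0 _) yM.
by move=> [i j] _ /=; rewrite (ord1 i) (le_trans (coord_le_enorm _ _)).
Qed.

Section unbounded_convex.
Variable C : set V.
Hypotheses (mC : lebesgue_measurable C) (cC : segment_closed C) (ubC : ~ bounded_set C).

(** Cut the segment from [x] to a point of [C] farther than [r]. *)
Lemma exists_at_distance x r : C x -> 0 <= r -> exists2 y, C y & enorm (y - x) = r.
Proof.
move=> Cx r0; have [y Cy ry] := unbounded_enorm x r ubC.
have e0 : 0 < enorm (y - x) by exact: le_lt_trans ry.
exists (x + (r / enorm (y - x)) *: (y - x)).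
  by apply: cC => //; rewrite divr_ge0 ?enorm_ge0 //= ler_pdivrMr // mul1r ltW.
rewrite addrC addKr enormZ ger0_norm ?divr_ge0 ?enorm_ge0 //.
by rewrite divfK // gt_eqF.
Qed.

Lemma measurable_cap_eball x r : lebesgue_measurable (C `&` eball x r).
Proof. by apply: measurableI => //; exact: measurable_eball. Qed.

Lemma ballv_disjoint x y z r s t : enorm (y - x) + r <= t -> enorm (z - x) + s <= t ->
  r + s <= enorm (z - y) -> ballv C y r + ballv C z s <= ballv C x t.
Proof.
move=> yt zt rs.
rewrite -lee_fin EFinD -!ballvE -measureU; try exact: measurable_cap_eball.
  apply: le_vol => w [] [Cw wb]; split => //; exact: eball_subset wb.
rewrite -subset0 => w [[_ w1] [_ w2]]; move: w1 w2; rewrite /eball /= => w1 w2.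
have := enorm_triangle w z y; rewrite (enormB z w); lra.
Qed.

Lemma double_ballv v r : 0 <= r -> (forall x, C x -> v <= ballv C x r) ->
  forall x, C x -> v + v <= ballv C x (3 * r).
Proof.
move=> r0 vr x Cx; have [y Cy yx] := exists_at_distance Cx (mulr_ge0 (ler0n R 2) r0).
apply: (le_trans (lerD (vr x Cx) (vr y Cy))).
by apply: ballv_disjoint; rewrite ?subrr ?enorm0 ?yx; lra.
Qed.

(** Each enlargement of the radius by 2 [r0] makes room for a further disjoint ball of radius [r0],
    hence for additional volume [c]; iterate and use the Archimedean property. *)
Lemma ballv_unbounded c r0 x v : C x -> 0 < c -> 0 < r0 ->
  (forall y, C y -> c <= ballv C y r0) -> exists2 r, 0 < r & v <= ballv C x r.
Proof.
move=> Cx c0 r00 Hc.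
have H k : exists2 r, 0 < r & k%:R * c <= ballv C x r.
  elim: k => [|k [r r_gt0 IH]]; first by exists 1; rewrite // mul0r ballv_ge0.
  have [y Cy ry] := exists_at_distance Cx (addr_ge0 (ltW r_gt0) (ltW r00)).
  exists (r + r0 + r0); first by rewrite !addr_gt0.
  rewrite -natr1 mulrDl mul1r (le_trans (lerD IH (Hc y Cy))) //.
  by apply: ballv_disjoint; rewrite ?subrr ?enorm0 ?ry; lra.
have [r r1 Hr] := H (Num.bound `|v / c|); exists r => //; apply: le_trans Hr.
by rewrite -ler_pdivrMr // (le_trans (ler_norm _)) // ltW // archi_boundP.
Qed.

End unbounded_convex.
End convex_ball_volume.

(** * One-variable calculus and the flat function *)

Section one_variable.
Context {R : realType}.
Implicit Types (f g : R -> R) (x t : R).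

Lemma is_derive1_comp_fun f g x df dg : is_derive x 1 f df ->
  is_derive (f x) 1 g dg -> is_derive x 1 (g \o f) (dg * df).
Proof.
move=> [dfx dfE] [dgx dgE]; split.
  apply/derivable1_diffP; apply: differentiable_comp; first by move/derivable1_diffP: dfx.
  by move/derivable1_diffP: dgx.
by rewrite -derive1E derive1_comp // (derive1E g) (derive1E f) dgE dfE.
Qed.

Lemma lipschitz_of_derive f g (M : R) : (forall x, is_derive x 1 f (g x)) ->
  (forall x, `|g x| <= M) -> forall a b, `|f b - f a| <= M * `|b - a|.
Proof.
move=> fg gM a b.
wlog ab : a b / a < b => [H|].
  have [/H//|/H|->] := ltgtP a b; last by rewrite !subrr normr0 mulr0.
  by rewrite distrC (distrC b).
have cf : {within `[a, b], continuous f}.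
  by apply: derivable_within_continuous => x _; have [] := fg x.
have [c _ ->] := MVT ab (fun x _ => fg x) cf.
by rewrite normrM ler_wpM2r.
Qed.

(* [flat 0] is the classical smooth function exp(-1/t); the family [flat j] is
   closed under differentiation up to linear combinations. *)
Definition flat (j : nat) t : R := if 0 < t then t^-1 ^+ j * expR (- t^-1) else 0.

Lemma flat_ge0 j t : 0 <= flat j t.
Proof.
rewrite /flat; case: ifP => // t0.
by rewrite mulr_ge0 ?expR_ge0 // exprn_ge0 // invr_ge0 ltW.
Qed.

Lemma flat0 j t : t <= 0 -> flat j t = 0.
Proof. by rewrite /flat ltNge => ->. Qed.

(** A single term of the exponential series is at most its sum. *)
Lemma expr_mul_expRN_le (u : R) j : 0 <= u -> u ^+ j * expR (- u) <= j`!%:R.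
Proof.
move=> u0; rewrite expRN ler_pdivrMr ?expR_gt0 //.
case: j => [|j]; first by rewrite expr0 mul1r (le_trans _ (expR_ge1Dx u)) // lerDl.
rewrite -ler_pdivrMl ?ltr0n ?fact_gt0 // mulrC.
by rewrite (le_trans _ (expR_ge1Dxn j u0)) // lerDr.
Qed.

Lemma flat_le_fact j t : flat j t <= j`!%:R.
Proof.
rewrite /flat; case: ifP => // t0.
by apply: expr_mul_expRN_le; rewrite invr_ge0 ltW.
Qed.

(** For t > 0, [flat j t] is t^2 times the bounded function [flat j.+2 t]. The quadratic decay gives
    the derivative 0 at the origin. *)
Lemma flat_le_sqr j t : flat j t <= (j.+2)`!%:R * t ^+ 2.
Proof.
rewrite {1}/flat; case: ifP => [t0|_]; last by rewrite mulr_ge0 // sqr_ge0.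
have := flat_le_fact j.+2 t; rewrite /flat t0 => H.
rewrite -ler_pdivrMr ?exprn_gt0 //; apply: le_trans H.
by rewrite mulrAC -[j.+2]addn2 exprD [t^-1 ^+ 2]exprVn.
Qed.

Lemma is_derive_flat j t : is_derive t 1 (flat j) (flat j.+2 t - j%:R * flat j.+1 t).
Proof.
have [t0|t0|->] := ltgtP t 0.
- rewrite !flat0 ?ltW // mulr0 subrr.
  apply: (@near_eq_is_derive _ _ _ (cst 0)).
  near=> s; rewrite /= flat0 // ltW //; near: s; exact: lt_nbhsl.
(* For t > 0 the function is s^j exp(-s) composed with the inverse. *)
- pose u (s : R) := s^-1.
  have du : is_derive t 1 u (- t ^- 2).
    have := @is_deriveV R id t 1 1; rewrite /= gt_eqF // => /(_ isT _).
    by rewrite [_ *: _]mulr1; apply.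
  have dG : is_derive (u t) 1 (fun s : R => s ^+ j * expR (- s))
      ((j%:R * u t ^+ j.-1 - u t ^+ j) * expR (- u t)).
    have d1 : is_derive (u t) 1 (fun s : R => s ^+ j) (j%:R * u t ^+ j.-1).
      have := @is_deriveX _ _ id j (u t) 1 1 (is_derive_id _ _).
      by rewrite [_ *: _]mulr1 exprfctE.
    have d2 : is_derive (u t) 1 (fun s : R => expR (- s)) (- expR (- u t)).
      have := @is_derive1_comp_fun (fun s : R => - s) expR (u t) (-1) _ _ (is_derive_expR _).
      by rewrite mulrN1; apply; exact: is_deriveN.
    have := is_deriveM d1 d2; rewrite mulrBl => H.
    by apply: is_derive_eq H _; rewrite /GRing.scale /=; ring.
  have := is_derive1_comp_fun du dG.
  rewrite /flat t0 => H.
  apply: (@near_eq_is_derive _ _ _ ((fun s : R => s ^+ j * expR (- s)) \o u)).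
    near=> s; rewrite /= ifT //; near: s; exact: lt_nbhsr.
  apply: is_derive_eq H _; rewrite /u; clear dG.
  case: j => [|j] /=; rewrite ?mul0r ?subr0 ?expr0.
    by rewrite sub0r mulNr mulrNN exprVn mulrC mul1r.
  by rewrite -!exprVn !exprS; ring.
- rewrite !flat0 // mulr0 subrr.
  (* At the origin the difference quotient is at most a constant times |h|, by the quadratic
     bound. *)
  suff H : (fun h : R => h^-1 *: (flat j (h *: 1 + 0) - flat j 0)) @ 0^' --> (0 : R).
    split; first by apply/cvg_ex; exists 0.
    by rewrite /derive; apply: cvg_lim.
  apply/cvgr0Pnorm_le => e e0; near=> h.
  have h0 : h != 0 by near: h; exact: nbhs_dnbhs_neq.
  rewrite (flat0 j (lexx 0)) subr0 addr0 [h *: 1]mulr1 /GRing.scale /= normrM normfV.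
  rewrite ler_pdivrMl ?normr_gt0 // ger0_norm ?flat_ge0 //.
  apply: (le_trans (flat_le_sqr j h)); rewrite -real_normK ?num_real // expr2 mulrCA.
  rewrite ler_pM2l ?normr_gt0 // mulrC -ler_pdivlMr ?ltr0n ?fact_gt0 //.
  near: h; apply: dnbhs0_le; by rewrite divr_gt0 // ltr0n fact_gt0.
Unshelve. all: by end_near. Qed.

Lemma flat_continuous j : continuous (flat j).
Proof.
move=> t; apply/differentiable_continuous/derivable1_diffP.
by have [] := is_derive_flat j t.
Qed.

End one_variable.

(** * Directional derivatives; regularity from bounded partial derivatives *)

Section directional.
Context {R : realType} {n : nat}.
Local Notation V := 'rV[R]_n.+1.
Implicit Types (x y z v : V) (f g : V -> R).

Lemma is_derive_line f x v df :
  is_derive x v f df <-> is_derive (0 : R) 1 (fun h : R => f (h *: v + x)) df.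
Proof.
have E : 'D_v f x = 'D_1 (fun h : R => f (h *: v + x)) 0.
  rewrite /derive; set g1 := fun h => h^-1 *: _; set g2 := fun h => h^-1 *: _.
  suff -> : g1 = g2 by [].
  by rewrite funeqE /g1 /g2 => h /=; rewrite addr0 scale0r add0r [_%:A]mulr1.
split=> -[d1 d2]; split.
- exact: (derivable1P f x v).1 d1.
- by rewrite -E.
- exact: (derivable1P f x v).2 d1.
- by rewrite E.
Qed.

Lemma is_derive_along_line f x v df (h : R) : is_derive (h *: v + x) v f df ->
  is_derive h 1 (fun s : R => f (s *: v + x)) df.
Proof.
move=> /is_derive_line H.
have ds : is_derive h 1 (shift (- h)) (1 : R) by exact: is_derive_shift.
have := @is_derive1_comp_fun _ (shift (- h)) (fun s : R => f (s *: v + (h *: v + x))) h 1 df ds.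
rewrite /= subrr mulr1 => /(_ H); congr (is_derive _ _ _ _).
by apply/funext => s /=; rewrite addrA -scalerDl subrK.
Qed.

Lemma is_derive_comp_real f (g : R -> R) x v df dg : is_derive x v f df ->
  is_derive (f x) 1 g dg -> is_derive x v (g \o f) (dg * df).
Proof.
move=> /is_derive_line fx gx; apply/is_derive_line.
apply: (is_derive1_comp_fun fx).
by rewrite scale0r add0r.
Qed.

Lemma is_derive_coord (i : 'I_n.+1) x v :
  is_derive x v (fun y : V => y 0 i) (v 0 i).
Proof.
apply/is_derive_line.
have -> : (fun h : R => (h *: v + x) 0 i) = (v 0 i) \*: id + cst (x 0 i).
  by apply/funext => h; rewrite !mxE /= mulrC.
have := is_deriveD (is_deriveZ (v 0 i) (is_derive_id (0 : R) (1 : R))) (is_derive_cst (x 0 i) (0 : R) (1 : R)).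
by rewrite addr0 [_ *: _]mulr1.
Qed.

Lemma is_derive_dotpp x v : is_derive x v (fun y : V => dotp y y) (2 * dotp x v).
Proof.
have -> : (fun y : V => dotp y y) = \sum_(i < n.+1) ((fun y : V => y 0 i) * (fun y : V => y 0 i)).
  by apply/funext => y; rewrite fct_sumE.
have := @is_derive_sum _ _ _ n.+1 (fun i => (fun y : V => y 0 i) * (fun y : V => y 0 i)) x v
  (fun i => x 0 i *: v 0 i + x 0 i *: v 0 i).
move=> H; apply: is_derive_eq (H _) _ => [i|].
  by apply: is_deriveM; exact: is_derive_coord.
by rewrite mulr_sumr; apply: eq_bigr => i _; rewrite /GRing.scale /=; ring.
Qed.

Definition basis_vec (i : 'I_n.+1) : V := delta_mx 0 i.

Lemma dotp_basis_vec i x : dotp (basis_vec i) x = x 0 i.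
Proof.
rewrite /dotp (bigD1 i) //= big1 ?addr0 => [|k ki].
  by rewrite [basis_vec _ _ _]mxE !eqxx mul1r.
by rewrite [basis_vec _ _ _]mxE (negbTE ki) andbF mul0r.
Qed.

Lemma enorm_basis_vec i : enorm (basis_vec i) = 1.
Proof.
rewrite -[LHS]ger0_norm ?enorm_ge0 // -sqrtr_sqr enorm_sqr dotp_basis_vec.
by rewrite mxE !eqxx sqrtr1.
Qed.

(** Go from [x] to [y] by changing one coordinate at a time (the points [z k]), and apply the mean
    value theorem to each step. *)
Lemma bounded_partials_lipschitz f (g : 'I_n.+1 -> V -> R) (M : R) :
  (forall i x, is_derive x (basis_vec i) f (g i x)) ->
  (forall i x, `|g i x| <= M) ->
  forall x y, `|f y - f x| <= M * \sum_i `|(y - x) 0 i|.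
Proof.
move=> fg gM x y.
pose z k : V := \row_i (if (i < k)%N then y 0 i else x 0 i).
have -> : y = z n.+1 by apply/rowP => i; rewrite mxE ltn_ord.
have {1 2}-> : x = z 0%N by apply/rowP => i; rewrite mxE.
have -> : \sum_i `|(z n.+1 - z 0%N) 0 i| = \sum_(i < n.+1) `|y 0 i - x 0 i|.
  by apply: eq_bigr => i _; rewrite !mxE ltn_ord.
rewrite -(telescope_sumr (fun k => f (z k))) // big_mkord mulr_sumr.
apply: (le_trans (ler_norm_sum _ _ _)); apply: ler_sum => i _.
have zE : z i.+1 = (y 0 i - x 0 i) *: basis_vec i + z i.
  apply/rowP => j; rewrite !mxE eqxx /= ltnS leq_eqVlt.
  have [ij|ij] := eqVneq j i; first by rewrite ij eqxx ltnn /= mulr1 subrK.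
  by rewrite (negbTE (ij : nat_of_ord j != i)) /= mulr0 add0r.
have z0 : z i = 0 *: basis_vec i + z i by rewrite scale0r add0r.
rewrite zE {2}z0.
have := @lipschitz_of_derive _ (fun s : R => f (s *: basis_vec i + z i))
  (fun s => g i (s *: basis_vec i + z i)) M _ _ 0 (y 0 i - x 0 i).
rewrite subr0; apply => s; last exact: gM.
exact: is_derive_along_line.
Qed.

(** Partial derivatives alone do not give continuity; their boundedness does, which keeps the proofs
    of smoothness at the level of partial derivatives. *)
Lemma bounded_partials_continuous f (g : 'I_n.+1 -> V -> R) (M : R) :
  (forall i x, is_derive x (basis_vec i) f (g i x)) ->
  (forall i x, `|g i x| <= M) -> continuous f.
Proof.
move=> fg gM x; apply/(@cvgrPdist_lt _ _ _ _ (@nbhs_filter V x)) => e e0.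
have M0 : 0 <= M by apply: le_trans (gM 0 x).
(* Dividing by M + 1 rather than M covers the case M = 0. *)
pose d := e / ((M + 1) * n.+1%:R).
have d0 : 0 < d by rewrite divr_gt0 // mulr_gt0 // ltr_wpDl.
apply/nbhs_ballP; exists d => //=.
move=> y [_ xy]; rewrite /=.
rewrite distrC (le_lt_trans (bounded_partials_lipschitz fg gM x y)) //.
rewrite (@le_lt_trans _ _ (M * (n.+1%:R * d))) //.
  rewrite ler_wpM2l // (_ : _ * d = \sum_(i < n.+1) d); last first.
    by rewrite sumr_const card_ord mulr_natl.
  by apply: ler_sum => i _; rewrite ltW // !mxE; have := xy 0 i; rewrite /ball /= distrC.
have -> : M * (n.+1%:R * d) = e * (M / (M + 1)).
  have : (n.+1%:R : R) != 0 by rewrite pnatr_eq0.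
  have : M + 1 != 0 by rewrite gt_eqF // ltr_wpDl.
  by rewrite /d; move: (n.+1%:R : R) => N M10 N0; field; rewrite M10 N0.
by rewrite gtr_pMr // ltr_pdivrMr ?ltr_wpDl // mul1r ltrDl.
Qed.

End directional.

(** * A class of bump functions stable under differentiation *)

Section bump_functions.
Context {R : realType} {n : nat}.
Local Notation V := 'rV[R]_n.+1.
Implicit Types (x y z w : V) (q : V -> R).

(* Polynomial combinations of [flat j (s - |z|^2)]: a class of functions supported
   in a ball that is closed under partial derivatives, so that smoothness follows
   from bounded first derivatives. *)
Inductive bump (s : R) : (V -> R) -> Prop :=
| bump_flat j : bump s (fun z => flat j (s - dotp z z))
| bump_coord i q : bump s q -> bump s (fun z => z 0 i * q z)
| bump_lin (a b : R) q1 q2 : bump s q1 -> bump s q2 ->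
    bump s (fun z => a * q1 z + b * q2 z).

Lemma bump_eq0 s q : bump s q -> forall z, s <= dotp z z -> q z = 0.
Proof.
elim=> [j z sz|i q' _ IH z sz|a b q1 q2 _ IH1 _ IH2 z sz].
- by rewrite flat0 // subr_le0.
- by rewrite IH // mulr0.
- by rewrite IH1 // IH2 // !mulr0 addr0.
Qed.

Lemma bump_bounded s q : bump s q -> exists M, forall z, `|q z| <= M.
Proof.
elim=> [j|i q' bq' [M HM]|a b q1 q2 _ [M1 H1] _ [M2 H2]].
- by exists j`!%:R => z; rewrite ger0_norm ?flat_ge0 // flat_le_fact.
(* Where the bump is nonzero, z.z < s, so each coordinate is at most 1 + |s| in absolute value;
   elsewhere the product vanishes. *)
- exists ((1 + `|s|) * M) => z; have M0 : 0 <= M by exact: le_trans (HM 0).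
  have [sz|zs] := leP s (dotp z z).
    by rewrite (bump_eq0 bq' sz) mulr0 normr0 mulr_ge0 // addr_ge0.
  rewrite normrM ler_pM //.
  rewrite -(@ler_pXn2r _ 2) ?nnegrE ?addr_ge0 // (le_trans (_ : _ <= dotp z z)) //.
    rewrite -enorm_sqr ler_pXn2r ?nnegrE ?enorm_ge0 //; exact: coord_le_enorm.
  rewrite (le_trans (ltW zs)) // (le_trans (ler_norm s)) //.
  have := normr_ge0 s; nra.
- exists (`|a| * M1 + `|b| * M2) => z; rewrite (le_trans (ler_normD _ _)) //.
  by rewrite !normrM lerD // ler_wpM2l.
Qed.

Lemma bump_derive s q i : bump s q ->
  exists2 q', bump s q' & forall z, is_derive z (basis_vec i) q (q' z).
Proof.
elim=> [j|k r br [r' br' rr']|a b q1 q2 _ [q1' b1 d1] _ [q2' b2 d2]].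
- pose G z : R := 1 * flat j.+2 (s - dotp z z) + (- j%:R) * flat j.+1 (s - dotp z z).
  have bG : bump s (fun z => z 0 i * G z).
    by apply: bump_coord; apply: bump_lin; exact: bump_flat.
  (* The summand with coefficient 0 brings a scalar multiple into the form of the constructor
     [bump_lin]. *)
  exists (fun z => (-2) * (z 0 i * G z) + 0 * (z 0 i * G z)).
    exact: (bump_lin _ _ bG bG).
  move=> z; have df : is_derive z (basis_vec i) (fun y : V => s - dotp y y) (- (2 * dotp z (basis_vec i))).
    have := is_deriveB (is_derive_cst s z (basis_vec i)) (is_derive_dotpp z (basis_vec i)).
    by rewrite sub0r.
  apply: (is_derive_eq (is_derive_comp_real df (is_derive_flat j _))).
  by rewrite dotpC dotp_basis_vec /G; ring.
- exists (fun z => 1 * (z 0 k * r' z) + basis_vec i 0 k * r z).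
    by apply: bump_lin => //; exact: bump_coord.
  move=> z; apply: (is_derive_eq (is_deriveM (is_derive_coord k z (basis_vec i)) (rr' z))).
  by rewrite /GRing.scale /=; ring.
- exists (fun z => a * q1' z + b * q2' z); first exact: bump_lin.
  move=> z; exact: (is_deriveD (is_deriveZ a (d1 z)) (is_deriveZ b (d2 z))).
Qed.

Lemma measurable_bump d (T : measurableType d) s q (p : T -> V) : bump s q ->
  (forall i, measurable_fun setT (fun t => p t 0 i)) ->
  measurable_fun setT (fun t => q (p t)).
Proof.
move=> bq mp; elim: bq => [j|i r _ IH|a b q1 q2 _ IH1 _ IH2].
- apply: measurableT_comp.
    by apply: continuous_measurable_fun; exact: flat_continuous.
  apply: measurable_funB => //; apply: measurable_sum => i.
  exact: measurable_funM.
- exact: measurable_funM.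
- by apply: measurable_funD; apply: measurable_funM.
Qed.

End bump_functions.

(** * Differentiation under the integral sign and smoothness of mollified densities *)

Section parametric_integral.
Context {R : realType} {n : nat} d (T : measurableType d)
  (mu : {measure set T -> \bar R}).
Local Notation V := 'rV[R]_n.+1.
Implicit Types (w : V) (q : V -> R).

Lemma is_derive_integral (B : set T) (f f' : R -> T -> R) (G : T -> R) (a : R) : measurable B ->
  (forall x : R, mu.-integrable B (EFin \o f x)) ->
  (forall (x : R) t, B t -> is_derive x 1 (f ^~ t) (f' x t)) ->
  (forall (x : R) t, B t -> `|f' x t| <= G t) -> (forall t, 0 <= G t) ->
  mu.-integrable B (EFin \o G) ->
  is_derive a 1 (fun x => \int[mu]_(t in B) f x t) (\int[mu]_(t in B) f' a t).
Proof.
move=> mB intf df fG G0 intG.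
(* The domination holds for every parameter, so any open interval around [a] serves. *)
have Ia : `]a - 1, a + 1[%classic a by rewrite /= in_itv /=; apply/andP; split; lra.
have d1 (x : R) t : `]a - 1, a + 1[%classic x -> B t -> derivable (f ^~ t) x 1.
  by move=> _ Bt; have [] := df x t Bt.
have ub (x : R) t : `]a - 1, a + 1[%classic x -> B t -> `|partial1of2 f x t| <= G t.
  move=> _ Bt; rewrite partial1of2E; have [_ ->] := df x t Bt; exact: fG.
have -> : \int[mu]_(t in B) f' a t = \int[mu]_(t in B) partial1of2 f a t.
  apply: eq_Rintegral => t /set_mem Bt; rewrite partial1of2E.
  by have [_ ->] := df a t Bt.
split.
  exact: (derivable_under_integral mB Ia (fun x _ => intf x) d1 G0 intG ub).
rewrite -derive1E.
exact: (differentiation_under_integral mB Ia (fun x _ => intf x) d1 G0 intG ub).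
Qed.

Variables (H : T -> R) (p : T -> V).
Hypothesis intH : mu.-integrable setT (EFin \o H).
Hypothesis mp : forall i, measurable_fun setT (fun t => p t 0 i).

(** The signed measure with density [H] is pushed forward by [p] and mollified by [q]; densities and
    momenta of the moving mass are both of this form. *)
Definition pint q w : R := \int[mu]_t (H t * q (p t - w)).

Let mpw w i : measurable_fun setT (fun t => (p t - w) 0 i).
Proof.
under eq_fun do rewrite !mxE.
exact: measurable_funB.
Qed.

Lemma integrable_bump_mul (K : T -> R) s q w : mu.-integrable setT (EFin \o K) ->
  bump s q -> mu.-integrable setT (EFin \o (fun t => K t * q (p t - w))).
Proof.
move=> intK bq; have [M HM] := bump_bounded bq.
have mK : measurable_fun setT K by apply/measurable_EFinP; exact: measurable_int intK.
apply: (@le_integrable _ _ _ _ _ _ _ (fun t => (M * K t)%:E)) => //.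
- apply/measurable_EFinP; apply: measurable_funM => //.
  exact: measurable_bump bq (mpw w).
- move=> t _; rewrite /= lee_fin !normrM mulrC ler_wpM2r //.
  by rewrite (le_trans (HM _)) // ler_norm.
- exact: (integrableZl measurableT M intK).
Qed.

Lemma pint_bounded s q : bump s q -> exists M, forall w, `|pint q w| <= M.
Proof.
move=> bq; have [M HM] := bump_bounded bq.
have M0 : 0 <= M by exact: le_trans (HM 0).
exists (M * \int[mu]_t `|H t|) => w; rewrite /pint.
have intHq := integrable_bump_mul w intH bq.
apply: (le_trans (le_normr_Rintegral _ intHq)) => //.
have intaH : mu.-integrable setT (EFin \o (fun t => `|H t|)) by exact: integrable_norm.
rewrite -RintegralZl //; apply: le_Rintegral => //.
- exact: integrable_norm.
- exact: (integrableZl measurableT M intaH).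
- by move=> t _; rewrite normrM mulrC ler_wpM2r.
Qed.

(** The sign comes from [w] entering through [p t - w]. *)
Lemma is_derive_pint s q q' i : bump s q -> bump s q' ->
  (forall z, is_derive z (basis_vec i) q (q' z)) ->
  forall w, is_derive w (basis_vec i) (pint q) (- pint q' w).
Proof.
move=> bq bq' dq w; apply/is_derive_line.
have [M HM] := bump_bounded bq'.
have M0 : 0 <= M by exact: le_trans (HM 0).
have -> : - pint q' w = \int[mu]_t (- (H t * q' (p t - (0 *: basis_vec i + w)))).
  rewrite scale0r add0r /pint -[LHS]mulN1r -RintegralZl //; last exact: integrable_bump_mul bq'.
  by apply: eq_Rintegral => t _; rewrite mulN1r.
apply: (@is_derive_integral setT (fun h t => H t * q (p t - (h *: basis_vec i + w)))
  (fun h t => - (H t * q' (p t - (h *: basis_vec i + w)))) (fun t => M * `|H t|)) => //.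
- by move=> h; exact: integrable_bump_mul bq.
- move=> h t _.
  have dl : is_derive ((- h) *: basis_vec i + (p t - w)) (basis_vec i) q (q' ((- h) *: basis_vec i + (p t - w))) by exact: dq.
  have := is_derive_along_line dl => dl2.
  have dN : is_derive h 1 (fun s : R => - s) (-1 : R) by exact: is_deriveNid.
  have := is_deriveZ (H t) (is_derive1_comp_fun dN dl2).
  have E (k : R) : (- k) *: basis_vec i + (p t - w) = p t - (k *: basis_vec i + w).
    by rewrite scaleNr opprD addrCA.
  rewrite E mulrN1 /GRing.scale /= mulrN; congr (is_derive _ _ _ _).
  by apply/funext => k /=; rewrite E.
- by move=> h t _; rewrite normrN normrM mulrC ler_wpM2r.
- by move=> t; rewrite mulr_ge0.
- have i1 : mu.-integrable setT (EFin \o (fun t => `|H t|)) by exact: integrable_norm.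
  exact: (integrableZl measurableT M i1).
Qed.

Lemma pint_continuous s q : bump s q -> continuous (pint q).
Proof.
move=> bq.
have /choice[q' Hq'] : forall i, exists q', bump s q' /\ forall z, is_derive z (basis_vec i) q (q' z).
  by move=> i; have [q' ? ?] := bump_derive i bq; exists q'.
have /choice[M HM] : forall i, exists M, forall w, `|- pint (q' i) w| <= M.
  move=> i; have [M HM] := pint_bounded (Hq' i).1.
  by exists M => w; rewrite normrN.
apply: (@bounded_partials_continuous _ _ _ (fun i w => - pint (q' i) w) (\sum_i `|M i|)).
  by move=> i w; apply: is_derive_pint bq (Hq' i).1 (Hq' i).2 w.
move=> i w; rewrite (le_trans (HM i w)) // (le_trans (ler_norm _)) //.
by rewrite (bigD1 i) //= lerDl sumr_ge0.
Qed.

(** Induction for all bumps simultaneously: each partial derivative of a [pint] is the [pint] of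
    another bump, and every such function is continuous. *)
Lemma pint_Ck s q k : bump s q -> Ck k (pint q).
Proof.
elim: k q => [|k IH] q bq /=; split; try exact: pint_continuous bq.
  by [].
move=> i; have [q' bq' dq] := bump_derive i bq.
have dI w := is_derive_pint bq bq' dq w.
split; first by move=> w; have [] := dI w.
have -> : partial i (pint q) = pint (fun z => (-1) * q' z + 0 * q' z).
  apply/funext => w; rewrite /partial; have [_ ->] := dI w.
  rewrite /pint -[LHS]mulN1r -RintegralZl //; last exact: integrable_bump_mul bq'.
  by apply: eq_Rintegral => t _; rewrite mul0r addr0 mulrCA.
apply: IH; exact: bump_lin.
Qed.

End parametric_integral.

(** * Integrability of dominated functions and finite sums *)

Section integration.
Context {R : realType} d (T : measurableType d) (mu : {measure set T -> \bar R}).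
Implicit Types (f g : T -> R) (A : set T).

Lemma Rintegral_indic A : measurable A -> \int[mu]_x \1_A x = fine (mu A).
Proof. by move=> mA; rewrite /Rintegral integral_indic // setIT. Qed.

Lemma integrable_le_indic f A (M : R) : measurable_fun setT f -> measurable A ->
  (mu A < +oo)%E -> (forall x, `|f x| <= M * \1_A x) ->
  mu.-integrable setT (EFin \o f).
Proof.
move=> mf mA Afin fM; have mEf : measurable_fun setT (EFin \o f) by exact/measurable_EFinP.
have mE1 : measurable_fun setT (EFin \o (\1_A : T -> R)) by exact/measurable_EFinP.
apply/integrableP; split => //.
apply: (@le_lt_trans _ _ (\int[mu]_x (`|M|%:E * (EFin \o (\1_A : T -> R)) x))%E).
  apply: ge0_le_integral => //.
  - exact: measurableT_comp.
  - exact: measurable_funeM.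
  - by move=> x _; rewrite /= lee_fin (le_trans (fM x)) // ler_wpM2r // ler_norm.
rewrite ge0_integralZl //; last by move=> x _; rewrite lee_fin.
by rewrite integral_indic // setIT lte_mul_pinfty // lee_fin.
Qed.

Lemma integrable_indic_fin A : measurable A -> (mu A < +oo)%E ->
  mu.-integrable setT (EFin \o \1_A).
Proof.
move=> mA Afin; apply: (@integrable_le_indic _ A 1) => // x.
by rewrite mul1r ger0_norm.
Qed.

Lemma Rintegral_sum k (f : 'I_k -> T -> R) :
  (forall i, mu.-integrable setT (EFin \o f i)) ->
  \int[mu]_x (\sum_(i < k) f i x) = \sum_(i < k) \int[mu]_x f i x.
Proof.
move=> intf; rewrite /Rintegral; under eq_integral do rewrite -sumEFin.
rewrite (integral_sum measurableT intf).
rewrite (eq_bigr (fun i => (\int[mu]_x f i x)%:E)) ?sumEFin // => i _.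
by rewrite /Rintegral fineK //; exact: (integrable_fin_num measurableT (intf i)).
Qed.

Lemma integrable_sum_EFin k (f : 'I_k -> T -> R) :
  (forall i, mu.-integrable setT (EFin \o f i)) ->
  mu.-integrable setT (EFin \o (fun x => \sum_(i < k) f i x)).
Proof.
move=> intf; have -> : EFin \o (fun x => \sum_(i < k) f i x) =
    (fun x => \sum_(i < k) (EFin \o f i) x)%E.
  by apply/funext => x; rewrite /= sumEFin.
by apply: integrable_sum => // i _; exact: intf.
Qed.

Lemma Rintegral_in_indic A f : measurable A ->
  \int[mu]_(x in A) f x = \int[mu]_x (\1_A x * f x).
Proof.
move=> mA; rewrite Rintegral_mkcond; apply: eq_Rintegral => x _.
by rewrite patchE indicE; case: ifP => _; rewrite ?mul1r ?mul0r.
Qed.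

Lemma integrable_in_indic A f : measurable A ->
  mu.-integrable setT (EFin \o (fun x => \1_A x * f x)) -> mu.-integrable A (EFin \o f).
Proof.
move=> mA; have -> : EFin \o (fun x => \1_A x * f x) = (EFin \o f) \_ A.
  by apply/funext => x; rewrite /= patchE indicE; case: ifP => _; rewrite ?mul1r ?mul0r.
by move=> H; apply/(integrable_mkcond _ mA).
Qed.

Lemma integrable_bounded_on A f (M : R) : measurable A -> (mu A < +oo)%E ->
  measurable_fun setT f -> (forall x, `|f x| <= M) -> mu.-integrable A (EFin \o f).
Proof.
move=> mA Afin mf fM; apply: integrable_in_indic => //.
apply: (@integrable_le_indic _ A M) => //; first exact: (measurable_funM (measurable_indic mA) mf).
by move=> x; rewrite normrM [`|\1_A x|]ger0_norm // mulrC ler_wpM2r.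
Qed.

Lemma EFin_Rintegral A f : measurable A -> mu.-integrable A (EFin \o f) ->
  (\int[mu]_(x in A) (f x)%:E = (\int[mu]_(x in A) f x)%:E)%E.
Proof. by move=> mA intf; rewrite /Rintegral fineK //; exact: (integrable_fin_num mA intf). Qed.

End integration.

(** * Test fields and their divergence *)

Section test_fields.
Context {R : realType} {n : nat}.
Local Notation V := 'rV[R]_n.+1.
Local Notation leb := (@lebesgue_outer R n).
Local Notation VM := (caratheodory_type leb).
Variables (C : set V) (xi : V -> V).
Hypothesis txi : perimeter_test_field C xi.

Lemma test_field_eq0 x : ~ C x -> xi x = 0.
Proof.
move=> nCx; apply/eqP; apply: contrapT => /negP x0; apply: nCx.
have [_ _ KC _] := txi; apply: interior_subset; apply: KC; by apply: subset_closure.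
Qed.

Lemma test_field_coord_le1 x i : `|xi x 0 i| <= 1.
Proof. by have [_ _ _ H] := txi; exact: le_trans (coord_le_enorm _ _) (H x). Qed.

Lemma test_field_continuous i : continuous (fun x => xi x 0 i).
Proof. by have [/(_ i 0%N)[]] := txi. Qed.

Lemma test_field_is_derive i x :
  is_derive x (basis_vec i) (fun y => xi y 0 i) (partial i (fun y => xi y 0 i) x).
Proof. by have [/(_ i 1%N)[_ /(_ i)[/(_ x) ? _]] _ _ _] := txi; split. Qed.

Lemma test_partial_continuous i : continuous (partial i (fun y => xi y 0 i)).
Proof. by have [/(_ i 1%N)[_ /(_ i)[_ []]]] := txi. Qed.

(** The complement of the support is open, so the field is constant 0 near [x]. *)
Lemma test_partial_eq0 i x : ~ field_support xi x -> partial i (fun y => xi y 0 i) x = 0.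
Proof.
move=> nKx; rewrite /partial.
rewrite (@near_eq_derive _ _ _ _ (cst 0)) ?derive_cst //.
have : nbhs x (~` field_support xi).
  by apply: open_nbhs_nbhs; split => //; apply: closed_openC; exact: closed_closure.
apply: (@filterS _ _ (@nbhs_filter V x)) => y Ky; apply/eqP; apply: contrapT => /negP y0; apply: Ky.
by rewrite /field_support; apply: subset_closure => /=; apply: contra_neq y0 => ->; rewrite mxE.
Qed.

Lemma test_partial_bounded : exists2 M, 0 <= M &
  forall i x, `|partial i (fun y => xi y 0 i) x| <= M.
Proof.
have [_ cK _ _] := txi.
have /choice[M HM] : forall i, exists M, forall x, `|partial i (fun y => xi y 0 i) x| <= M.
  move=> i; have cI : compact (partial i (fun y => xi y 0 i) @` field_support xi).
    apply: continuous_compact => //; apply: continuous_subspaceT.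
    exact: test_partial_continuous.
  have [M [_ HM]] := compact_bounded cI.
  exists (`|M| + 1) => x; have [Kx|/test_partial_eq0 ->] := pselect (field_support xi x).
    by apply: HM; [rewrite (le_lt_trans (ler_norm M)) // ltrDl|exists x].
  by rewrite normr0 addr_ge0.
exists (\sum_i `|M i|); first exact: sumr_ge0.
move=> i x; rewrite (le_trans (HM i x)) // (le_trans (ler_norm _)) //.
by rewrite (bigD1 i) //= lerDl sumr_ge0.
Qed.

Lemma divergence_continuous_sum : measurable_fun setT (divergence xi : VM -> R).
Proof.
apply: measurable_sum => i; apply: continuous_measurable_vec.
exact: test_partial_continuous.
Qed.

Lemma divergence_eq0 x : ~ C x -> divergence xi x = 0.
Proof.
move=> nCx; apply: big1 => i _; apply: test_partial_eq0 => Kx; apply: nCx.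
have [_ _ KC _] := txi; apply: interior_subset; exact: KC.
Qed.

Lemma divergence_bounded : exists2 M, 0 <= M & forall x, `|divergence xi x| <= M.
Proof.
have [M M0 HM] := test_partial_bounded.
exists (\sum_(i < n.+1) M); first exact: sumr_ge0.
by move=> x; rewrite (le_trans (ler_norm_sum _ _ _)) // ler_sum.
Qed.

End test_fields.

(** * Passing to the limit in inequalities *)

Section limits.
Context {R : realType}.

Lemma le_continuous_at0 (A c : R) (g : R -> R) : {for 0, continuous g} -> 0 < c ->
  (forall h, 0 < h < c -> A <= g h) -> A <= g 0.
Proof.
move=> cg c0 H; rewrite leNgt; apply/negP => gA.
have /nbhs_ballP[e /= e0 He] : \forall h \near (0 : R), g h < A by apply: (cvgr_lt _ cg).
pose h := Num.min e c / 2.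
have m0 : 0 < Num.min e c by rewrite lt_min e0.
have h0 : 0 < h by rewrite divr_gt0.
have hm : h < Num.min e c by rewrite ltr_pdivrMr // ltr_pMr // ltr1n.
have := He h; rewrite /ball /= sub0r normrN gtr0_norm // => /(_ _).
have := hm; rewrite lt_min => /andP[he hc] /(_ he).
by rewrite ltNge H // h0.
Qed.

Lemma derive_le_quotient (F : R -> R) (d c B : R) : is_derive (0 : R) 1 F d -> 0 < c ->
  (forall h, 0 < h < c -> (F h - F 0) / h <= B) -> d <= B.
Proof.
move=> [dF <-] c0 H; rewrite leNgt; apply/negP => BD.
have cF : (fun h : R => h^-1 *: (F (h *: 1 + 0) - F 0)) @ 0^' --> 'D_1 F 0 by exact: dF.
have : \forall h \near (0 : R)^', B < h^-1 *: (F (h *: 1 + 0) - F 0) by exact: (cvgr_gt _ cF).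
rewrite near_withinE => /nbhs_ballP[e /= e0 He].
pose h := Num.min e c / 2.
have m0 : 0 < Num.min e c by rewrite lt_min e0.
have h0 : 0 < h by rewrite divr_gt0.
have hm : h < Num.min e c by rewrite ltr_pdivrMr // ltr_pMr // ltr1n.
have := hm; rewrite lt_min => /andP[he hc].
have := He h; rewrite /ball /= sub0r normrN gtr0_norm // => /(_ he).
rewrite gt_eqF // => /(_ isT); rewrite addr0 [h *: 1]mulr1 /GRing.scale /= mulrC.
by rewrite ltNge H // h0.
Qed.

(** Bernoulli's inequality; it turns the volume growth (t / s)^(n+1) into the factor n + 1 of the
    upper bound. *)
Lemma one_sub_expr_le (t : R) k : 0 <= t <= 1 -> 1 - t ^+ k <= k%:R * (1 - t).
Proof.
move=> /andP[t0 t1]; elim: k => [|k IH]; first by rewrite expr0 subrr mul0r.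
rewrite exprS -natr1 mulrDl mul1r (_ : 1 - t * t ^+ k = t * (1 - t ^+ k) + (1 - t)); last by ring.
rewrite lerD2r (le_trans _ IH) // ler_piMl // subr_ge0 exprn_ile1 //.
Qed.

Lemma clamp_lipschitz (u w : R) :
  `|Num.max 0 (Num.min 1 u) - Num.max 0 (Num.min 1 w)| <= `|u - w|.
Proof.
wlog uw : u w / u <= w.
  by move=> H; have [/H//|/ltW/H] := leP u w; rewrite distrC (distrC w).
have mono : Num.max 0 (Num.min 1 u) <= Num.max 0 (Num.min 1 w).
  by rewrite le_max2 // le_min2.
rewrite distrC ger0_norm ?subr_ge0 // (distrC u) ger0_norm ?subr_ge0 //.
rewrite lerBlDr ge_max; apply/andP; split.
  by rewrite addr_ge0 ?subr_ge0 // le_max lexx.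
have [w1|w1] := leP 1 w; have [u1|u1] := leP 1 u; last first.
all: rewrite ?(min_l w1) ?(min_r (ltW w1)) ?(min_l u1) ?(min_r (ltW u1)).
- have : u <= Num.max 0 u by rewrite le_max lexx orbT.
  lra.
- by move: (lt_le_trans w1 u1); lra.
- have : u <= Num.max 0 u by rewrite le_max lexx orbT.
  lra.
- have : 1 <= Num.max 0 (1 : R) by rewrite le_max lexx orbT.
  lra.
Qed.

End limits.

(** * Radial cutoffs tested against a field *)

Section ball_perimeter.
Context {R : realType} {n : nat}.
Local Notation V := 'rV[R]_n.+1.
Local Notation leb := (@lebesgue_outer R n).
Local Notation vol := (@lebesgueV R n).
Local Notation VM := (caratheodory_type leb).
Variables (C : set V) (x0 : V) (xi : V -> V).
Hypotheses (mC : lebesgue_measurable C) (cC : segment_closed C) (Cx0 : C x0).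
Hypothesis txi : perimeter_test_field C xi.

(** Equal to 1 on the ball of radius [q], to 0 outside that of radius [r], and affine in the squared
    distance in between. With the squared distance, finite differences along a coordinate are
    polynomial and no square root has to be differentiated. *)
Definition cutoff (q r : R) (x : V) : R :=
  Num.max 0 (Num.min 1 ((r ^+ 2 - dotp (x - x0) (x - x0)) / (r ^+ 2 - q ^+ 2))).

Lemma cutoff_ge0 q r x : 0 <= cutoff q r x.
Proof. by rewrite le_max lexx. Qed.

Lemma cutoff_le1 q r x : cutoff q r x <= 1.
Proof. by rewrite ge_max ler01 ge_min lexx. Qed.

Section radii.
Variables (q r : R).
Hypotheses (q0 : 0 <= q) (qr : q < r).

Let s0 : 0 < r ^+ 2 - q ^+ 2.
Proof. by rewrite subr_gt0 ltr_pXn2r // nnegrE // (le_trans q0) // ltW. Qed.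

Let r0 : 0 <= r. Proof. by rewrite (le_trans q0) // ltW. Qed.

Lemma cutoff_eq1 x : enorm (x - x0) <= q -> cutoff q r x = 1.
Proof.
move=> xq; rewrite /cutoff -enorm_sqr.
have : enorm (x - x0) ^+ 2 <= q ^+ 2 by rewrite ler_pXn2r // ?nnegrE ?enorm_ge0.
move=> H; rewrite min_l; first by rewrite max_r.
by rewrite ler_pdivlMr // mul1r lerD2l lerN2.
Qed.

Lemma cutoff_eq0 x : r <= enorm (x - x0) -> cutoff q r x = 0.
Proof.
move=> xr; rewrite /cutoff -enorm_sqr max_l // ge_min; apply/orP; right.
rewrite pmulr_lle0 ?invr_gt0 // subr_le0.
by rewrite ler_pXn2r // ?nnegrE ?enorm_ge0.
Qed.

Lemma cutoff_lipschitz x y : `|cutoff q r x - cutoff q r y| <=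
  `|dotp (x - x0) (x - x0) - dotp (y - x0) (y - x0)| / (r ^+ 2 - q ^+ 2).
Proof.
rewrite /cutoff; set a := dotp (x - x0) _; set b := dotp (y - x0) _.
have E : `|a - b| / (r ^+ 2 - q ^+ 2) =
    `|(r ^+ 2 - a) / (r ^+ 2 - q ^+ 2) - (r ^+ 2 - b) / (r ^+ 2 - q ^+ 2)|.
  rewrite -mulrBl normrM [X in _ = _ * X]gtr0_norm ?invr_gt0 //; congr (_ / _).
  by rewrite distrC; congr (`|_|); ring.
rewrite E; move: ((r ^+ 2 - a) / _) ((r ^+ 2 - b) / _) => u w.
exact: clamp_lipschitz.
Qed.

Lemma measurable_cutoff : measurable_fun setT (cutoff q r : VM -> R).
Proof.
have mc : measurable_fun [set: R] (fun u : R =>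
    Num.max 0 (Num.min 1 ((r ^+ 2 - u) / (r ^+ 2 - q ^+ 2)))).
  apply: measurable_maxr; first exact: measurable_cst.
  apply: measurable_minr; first exact: measurable_cst.
  apply: measurable_funM; last exact: measurable_cst.
  by apply: measurable_funB; [exact: measurable_cst|exact: measurable_id].
have mx i : measurable_fun setT (fun x : VM => ((x : V) - x0) 0 i).
  under eq_fun do rewrite !mxE.
  by apply: measurable_funB; [exact: measurable_coord|exact: measurable_cst].
have md : measurable_fun setT (fun x : VM => dotp ((x : V) - x0) ((x : V) - x0)).
  by apply: measurable_sum => i; exact: (measurable_funM (mx i) (mx i)).
exact: (measurableT_comp mc md).
Qed.

(** A shift by h < d leaves the cutoff unchanged off the shell widened by [d] on both sides, and the
    field vanishes outside [C]. On the shell the squared distance changes by -2 h (x - x0)_i + h^2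
    along coordinate i. *)
Lemma cutoff_shift_quotient (d h : R) x : 0 < h < d -> d <= q ->
  \sum_i xi x 0 i * (cutoff q r (x - h *: basis_vec i) - cutoff q r x) / h <=
  (2 * (r + d) + n.+1%:R * d) / (r ^+ 2 - q ^+ 2) *
  \1_((C `&` eball x0 (r + d)) `\` (C `&` eball x0 (q - d))) x.
Proof.
move=> /andP[h0 hd] dq.
have d0 : 0 < d by exact: lt_trans hd.
have L0 : 0 <= (2 * (r + d) + n.+1%:R * d) / (r ^+ 2 - q ^+ 2).
  by rewrite divr_ge0 ?(ltW s0) // addr_ge0 ?mulr_ge0 ?addr_ge0 // ltW.
have LI0 : 0 <= (2 * (r + d) + n.+1%:R * d) / (r ^+ 2 - q ^+ 2) *
    \1_((C `&` eball x0 (r + d)) `\` (C `&` eball x0 (q - d))) x.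
  by rewrite mulr_ge0.
have shiftE i : enorm (x - h *: basis_vec i - x0) <= enorm (x - x0) + h /\
    enorm (x - x0) <= enorm (x - h *: basis_vec i - x0) + h.
  have eh : enorm (h *: basis_vec i : V) = h by rewrite enormZ enorm_basis_vec mulr1 gtr0_norm.
  split; first by rewrite addrAC (le_trans (enormD _ _)) // enormN eh.
  rewrite -[X in enorm X <= _](subrK (h *: basis_vec i)) (le_trans (enormD _ _)) // eh.
  by rewrite lerD2r addrAC.
have off : (forall i, cutoff q r (x - h *: basis_vec i) = cutoff q r x) ->
    \sum_i xi x 0 i * (cutoff q r (x - h *: basis_vec i) - cutoff q r x) / h = 0.
  by move=> H; apply: big1 => i _; rewrite H subrr mulr0 mul0r.
have [Cx|nCx] := pselect (C x); last first.
  rewrite big1 // => i _.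
  by rewrite (test_field_eq0 txi nCx) mxE !mul0r.
have [rx|xr] := leP (r + d) (enorm (x - x0)).
  rewrite off // => i; have [_ H] := shiftE i.
  by rewrite !cutoff_eq0 //; lra.
have [xq|qx] := ltP (enorm (x - x0)) (q - d).
  rewrite off // => i; have [H _] := shiftE i.
  by rewrite !cutoff_eq1 //; lra.
rewrite indicE mem_set ?mulr1; last by split => // -[_]; rewrite /eball /= ltNge qx.
have ptw i : xi x 0 i * (cutoff q r (x - h *: basis_vec i) - cutoff q r x) / h <=
    `|xi x 0 i| * (2 * `|(x - x0) 0 i| + d) / (r ^+ 2 - q ^+ 2).
  rewrite (le_trans (ler_norm _)) // !normrM normfV (gtr0_norm h0) -!mulrA.
  rewrite ler_wpM2l // ler_pdivrMr // (le_trans (cutoff_lipschitz _ _)) //.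
  rewrite mulrAC ler_pM2r ?invr_gt0 //.
  have -> : x - h *: basis_vec i - x0 = (x - x0) + (- h) *: basis_vec i.
    by rewrite scaleNr addrAC.
  have dE (y b : V) a : dotp (y + a *: b) (y + a *: b) = dotp y y + 2 * a * dotp b y + a ^+ 2 * dotp b b.
    by rewrite !(dotpDl, dotpDr, dotpZl, dotpZr) (dotpC y b); ring.
  rewrite dE !dotp_basis_vec [basis_vec i 0 i]mxE !eqxx /=.
  have H1 (w : R) : - w <= `|w| by rewrite -normrN ler_norm.
  have := ler_norm ((x - x0) 0 i); have := H1 ((x - x0) 0 i).
  have [u ->] : exists u : R, `|(x - x0) 0 i| = u by eexists.
  move: ((x - x0) 0 i) (dotp _ _) => w z wu uw.
  have p1 : 0 <= h * (u - w) by rewrite mulr_ge0 ?(ltW h0) // subr_ge0.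
  have p2 : 0 <= h * (u + w) by rewrite mulr_ge0 ?(ltW h0) //; lra.
  have p3 : 0 <= h * (d - h) by rewrite mulr_ge0 ?(ltW h0) // subr_ge0 ltW.
  have p4 : 0 <= h * h by rewrite mulr_ge0 // ltW.
  rewrite ler_norml; apply/andP; split; lra.
rewrite (le_trans (ler_sum _ (fun i _ => ptw i))) //.
rewrite -mulr_suml ler_pM2r ?invr_gt0 //.
under eq_bigr do rewrite mulrDr.
rewrite big_split /=; apply: lerD.
  (* Cauchy-Schwarz on the full vectors keeps the main term at 2 (r + d); summing coordinate by
     coordinate costs a factor n + 1 only in the term that vanishes with [d]. *)
  have -> : \sum_i `|xi x 0 i| * (2 * `|(x - x0) 0 i|) = 2 * dotp (absv (xi x)) (absv (x - x0)).
    by rewrite mulr_sumr; apply: eq_bigr => i _; rewrite !mxE mulrCA.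
  rewrite ler_pM2l // (le_trans (dotp_le_enorm _ _)) // !enorm_absv.
  have [_ _ _ /(_ x) x1] := txi.
  by rewrite (le_trans (ler_wpM2r (enorm_ge0 _) x1)) // mul1r ltW.
rewrite -mulr_suml ler_pM2r // (le_trans (ler_sum _ (fun i _ => test_field_coord_le1 txi x i))) //.
by rewrite sumr_const card_ord.
Qed.

Lemma cutoff_le_indic x : cutoff q r x <= \1_(eball x0 r) x.
Proof.
have [xr|rx] := ltP (enorm (x - x0)) r.
  by rewrite indicE mem_set // cutoff_le1.
by rewrite cutoff_eq0.
Qed.

Lemma integrable_cutoff_mul (g : V -> R) (M : R) : measurable_fun setT (g : VM -> R) ->
  (forall x, `|g x| <= M) -> vol.-integrable setT (EFin \o (fun x => cutoff q r x * g x)).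
Proof.
move=> mg gM; have M0 : 0 <= M by exact: le_trans (gM 0).
apply: (@integrable_le_indic _ _ _ vol _ (eball x0 r) M).
- exact: (measurable_funM measurable_cutoff mg).
- exact: measurable_eball.
- exact: vol_eball_lty.
- move=> x; rewrite normrM ger0_norm ?cutoff_ge0 // mulrC.
  by rewrite ler_pM ?cutoff_ge0 // cutoff_le_indic.
Qed.

Let mxi i : measurable_fun setT (fun x : VM => xi x 0 i).
Proof.
have c := test_field_continuous txi (i := i).
apply: (@continuous_measurable_vec _ _ (fun x => xi x 0 i)). exact: c.
Qed.

Let mshift a (g : V -> R) : measurable_fun setT (g : VM -> R) ->
  measurable_fun setT ((fun x => g (a + x)) : VM -> R).
Proof.
move=> mg; have -> : (fun x => g (a + x)) = g \o homoth a 1.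
  by apply/funext => x; rewrite /= /homoth scale1r.
exact: (measurableT_comp mg (@measurable_homoth _ _ a 1 ltr01)).
Qed.

Let mshiftB a (g : V -> R) : measurable_fun setT (g : VM -> R) ->
  measurable_fun setT ((fun x => g (x - a)) : VM -> R).
Proof.
move=> mg; have -> : (fun x => g (x - a)) = (fun x => g (- a + x)).
  by apply/funext => x; rewrite addrC.
exact: mshift.
Qed.

(** Discrete integration by parts: the left side is the derivative at 0 of [F], and in the
    difference quotients of [F] a translation moves the increment from the field to the cutoff,
    which only has to be Lipschitz. *)
Lemma integral_cutoff_divergence_le d : 0 < d -> d <= q ->
  \int[vol]_x (cutoff q r x * divergence xi x) <=
  (2 * (r + d) + n.+1%:R * d) / (r ^+ 2 - q ^+ 2) *
  (ballv C x0 (r + d) - ballv C x0 (q - d)).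
Proof.
move=> d0 dq.
pose F (h : R) := \int[vol]_x (cutoff q r x * \sum_i xi (h *: basis_vec i + x) 0 i).
have [M M0 HM] := test_partial_bounded txi.
have int1 i (a : V) : vol.-integrable setT (EFin \o (fun x => cutoff q r x * xi (a + x) 0 i)).
  apply: (@integrable_cutoff_mul _ 1); first exact: (@mshift a (fun x => xi x 0 i) (mxi i)).
  by move=> x; exact: (test_field_coord_le1 txi).
have dF : is_derive (0 : R) 1 F (\int[vol]_x (cutoff q r x * divergence xi x)).
  have -> : \int[vol]_x (cutoff q r x * divergence xi x) = \int[vol]_x (cutoff q r x *
      \sum_i partial i (fun y => xi y 0 i) ((0 : R) *: basis_vec i + x)).
    apply: eq_Rintegral => x _; congr (_ * _); apply: eq_bigr => i _.
    by rewrite scale0r add0r.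
  apply: (@is_derive_integral _ _ _ vol setT
    (fun h x => cutoff q r x * \sum_i xi (h *: basis_vec i + x) 0 i)
    (fun h x => cutoff q r x * \sum_i partial i (fun y => xi y 0 i) (h *: basis_vec i + x))
    (fun x => cutoff q r x * (n.+1%:R * M)) 0 measurableT).
  - move=> h; apply: (@integrable_cutoff_mul _ n.+1%:R).
      by apply: measurable_sum => i; exact: (@mshift _ (fun x => xi x 0 i) (mxi i)).
    move=> x; rewrite (le_trans (ler_norm_sum _ _ _)) //.
    rewrite (le_trans (ler_sum _ (fun i _ => test_field_coord_le1 txi _ i))) //.
    by rewrite sumr_const card_ord.
  - move=> h x _.
    have dS : is_derive h 1 (\sum_(i < n.+1) (fun h => xi (h *: basis_vec i + x) 0 i))
        (\sum_i partial i (fun y => xi y 0 i) (h *: basis_vec i + x)).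
      apply: is_derive_sum => i.
      apply: (@is_derive_along_line _ _ (fun y => xi y 0 i)).
      exact: (test_field_is_derive txi).
    have := is_deriveZ (cutoff q r x) dS; congr (is_derive _ _ _ _).
    by apply/funext => k /=; rewrite fct_sumE.
  - move=> h x _; rewrite normrM ger0_norm ?cutoff_ge0 // ler_wpM2l ?cutoff_ge0 //.
    rewrite (le_trans (ler_norm_sum _ _ _)) //.
    rewrite (le_trans (ler_sum _ (fun i _ => HM i _))) //.
    by rewrite sumr_const card_ord mulr_natl.
  - by move=> x; rewrite mulr_ge0 ?cutoff_ge0 // mulr_ge0.
  - apply: (@integrable_cutoff_mul (fun=> n.+1%:R * M) (n.+1%:R * M)) => // x.
    by rewrite ger0_norm // mulr_ge0.
apply: (derive_le_quotient dF d0) => h hd.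
have h0 : 0 < h by case/andP: hd.
(* Translate the i-th integral by -k along the i-th axis. *)
have FE k : F k = \sum_i \int[vol]_x (cutoff q r (x - k *: basis_vec i) * xi x 0 i).
  rewrite /F.
  transitivity (\int[vol]_x \sum_i (cutoff q r x * xi (k *: basis_vec i + x) 0 i)).
    by apply: eq_Rintegral => x _; rewrite mulr_sumr.
  rewrite Rintegral_sum //; apply: eq_bigr => i _.
  rewrite /Rintegral; congr fine.
  have := @integral_shift _ _ (- (k *: basis_vec i)) (fun x => (cutoff q r x * xi (k *: basis_vec i + x) 0 i)%:E).
  move=> <-; [|exact: measurable_int (int1 i _)|exact: int1].
  by apply: eq_integral => x _; rewrite [k *: _ + _]addrC subrK.
have int2 i : vol.-integrable setT
    (EFin \o (fun x => cutoff q r (x - h *: basis_vec i) * xi x 0 i)).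
  apply: (@integrable_le_indic _ _ _ vol _ (eball x0 (r + h)) 1).
  - exact: (measurable_funM (mshiftB _ measurable_cutoff) (mxi i)).
  - exact: measurable_eball.
  - exact: vol_eball_lty.
  - move=> x; rewrite normrM ger0_norm ?cutoff_ge0 // mul1r.
    rewrite (le_trans (ler_wpM2l (cutoff_ge0 _ _ _) (test_field_coord_le1 txi x i))) //.
    rewrite mulr1; have [xr|rx] := ltP (enorm (x - x0)) (r + h).
      by rewrite indicE mem_set // cutoff_le1.
    rewrite cutoff_eq0 // -(lerD2r h) (le_trans rx) //.
    rewrite -[X in enorm X <= _](subrK (h *: basis_vec i)) (le_trans (enormD _ _)) //.
    by rewrite enormZ enorm_basis_vec mulr1 (gtr0_norm h0) lerD2r addrAC.
have int3 i : vol.-integrable setT (EFin \o (fun x => cutoff q r (x - 0 *: basis_vec i) * xi x 0 i)).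
  have := int1 i 0; congr (integrable _ _ _); apply/funext => x /=.
  by rewrite scale0r subr0 add0r.
have int4 i : vol.-integrable setT (EFin \o (fun x => cutoff q r (x - h *: basis_vec i) * xi x 0 i -
    cutoff q r (x - 0 *: basis_vec i) * xi x 0 i)).
  exact: (integrableB measurableT (int2 i) (int3 i)).
have int5 i : vol.-integrable setT (EFin \o (fun x =>
    xi x 0 i * (cutoff q r (x - h *: basis_vec i) - cutoff q r x) / h)).
  have -> : (fun x => xi x 0 i * (cutoff q r (x - h *: basis_vec i) - cutoff q r x) / h) =
      (fun x => h^-1 * (cutoff q r (x - h *: basis_vec i) * xi x 0 i -
        cutoff q r (x - 0 *: basis_vec i) * xi x 0 i)).
    by apply/funext => x; rewrite scale0r subr0 -mulrBl mulrC (mulrC (xi x 0 i)).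
  exact: (integrableZl measurableT h^-1 (int4 i)).
have -> : (F h - F 0) / h = \int[vol]_x (\sum_i
    xi x 0 i * (cutoff q r (x - h *: basis_vec i) - cutoff q r x) / h).
  rewrite Rintegral_sum // !FE -sumrB mulr_suml; apply: eq_bigr => i _.
  rewrite -RintegralB // -RintegralZr //.
  by apply: eq_Rintegral => x _; rewrite scale0r subr0 -mulrBl (mulrC (xi x 0 i)).
set S := (C `&` eball x0 (r + d)) `\` (C `&` eball x0 (q - d)).
have mS : lebesgue_measurable S.
  by apply: measurableD; exact: measurable_cap_eball.
have vS : vol S = (ballv C x0 (r + d) - ballv C x0 (q - d))%:E.
  rewrite EFinB -!ballvE measureD; try exact: measurable_cap_eball.
    congr (_ - vol _)%E; apply: setIidr.
    have qd : q - d <= r + d.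
      by rewrite lerBlDr (le_trans (ltW qr)) // -addrA lerDl addr_ge0 // ltW.
    by move=> x [Cx xb]; split => //; exact: le_eball xb.
  exact: vol_ball_lty.
have Sfin : (vol S < +oo)%E by rewrite vS ltry.
have IS : \int[vol]_x \1_S x = fine (vol S) by exact: Rintegral_indic.
have -> : ballv C x0 (r + d) - ballv C x0 (q - d) = \int[vol]_x \1_S x by rewrite IS vS.
have intS : vol.-integrable setT (EFin \o \1_S).
  exact: integrable_indic_fin.
rewrite -RintegralZl //; apply: le_Rintegral => //.
- exact: integrable_sum_EFin.
- exact: (integrableZl measurableT _ intS).
- by move=> x _; exact: cutoff_shift_quotient.
Qed.

End radii.
End ball_perimeter.

(** * Relative perimeter of a ball centred in C *)

Section perimeter_of_balls.
Context {R : realType} {n : nat}.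
Local Notation V := 'rV[R]_n.+1.
Local Notation leb := (@lebesgue_outer R n).
Local Notation vol := (@lebesgueV R n).
Local Notation VM := (caratheodory_type leb).
Variables (C : set V) (x0 : V).
Hypotheses (mC : lebesgue_measurable C) (cC : segment_closed C) (Cx0 : C x0).

Lemma ballv_scale_ge (s r : R) : 0 < s -> s <= r ->
  (s / r) ^+ n.+1 * ballv C x0 r <= ballv C x0 s.
Proof.
move=> s0 sr; have r0 : 0 < r by exact: lt_le_trans sr.
rewrite -ler_pdivlMl ?exprn_gt0 ?divr_gt0 // -exprVn invf_div.
exact: ballv_scale.
Qed.

Lemma integrable_divergence (xi : V -> V) (r : R) : perimeter_test_field C xi ->
  vol.-integrable setT (EFin \o (fun x => \1_(C `&` eball x0 r) x * divergence xi x)).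
Proof.
move=> txi; have [M M0 HM] := divergence_bounded txi.
have mE : lebesgue_measurable (C `&` eball x0 r) by exact: measurable_cap_eball.
apply: (@integrable_le_indic _ _ _ vol _ (C `&` eball x0 r) M).
- apply: measurable_funM; last exact: (divergence_continuous_sum txi).
  exact: measurable_indic.
- exact: mE.
- exact: vol_ball_lty.
- by move=> x; rewrite normrM ger0_norm // mulrC ler_wpM2r.
Qed.

(** The first term bounds the cutoff integral, with the volume of the widened shell estimated by
    scaling; the second is the cost of replacing the indicator of the ball by the cutoff. *)
Lemma divergence_ball_le_radii (xi : V -> V) (M q r d : R) : perimeter_test_field C xi ->
  (forall x, `|divergence xi x| <= M) -> 0 < d -> d < q -> q < r ->
  \int[vol]_(x in C `&` eball x0 r) divergence xi x <=
  (2 * (r + d) + n.+1%:R * d) / (r ^+ 2 - q ^+ 2) *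
    (((r + d) / r) ^+ n.+1 - ((q - d) / r) ^+ n.+1) * ballv C x0 r +
  M * (1 - (q / r) ^+ n.+1) * ballv C x0 r.
Proof.
move=> txi HM d0 dq qr.
have q0 : 0 < q by exact: lt_trans dq.
have r0 : 0 < r by exact: lt_trans qr.
have M0 : 0 <= M by exact: le_trans (HM 0).
have b0 := ballv_ge0 C x0 r.
have mE s : lebesgue_measurable (C `&` eball x0 s) by exact: measurable_cap_eball.
rewrite Rintegral_in_indic; last exact: mE.
have intE := integrable_divergence r txi.
have intc : vol.-integrable setT (EFin \o (fun x => cutoff x0 q r x * divergence xi x)).
  apply: (integrable_cutoff_mul x0 (ltW q0) qr _ HM).
  exact: (divergence_continuous_sum txi).
set S := (C `&` eball x0 r) `\` (C `&` eball x0 q).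
have mS : lebesgue_measurable S by apply: measurableD; exact: mE.
have vS : vol S = (ballv C x0 r - ballv C x0 q)%:E.
  rewrite EFinB -!ballvE measureD; try exact: mE.
    congr (_ - vol _)%E; apply: setIidr.
    by move=> x [Cx xb]; split => //; apply: le_eball xb; exact: ltW.
  exact: vol_ball_lty.
have Sfin : (vol S < +oo)%E by rewrite vS ltry.
have IS : \int[vol]_x \1_S x = fine (vol S) by exact: Rintegral_indic.
have intS : vol.-integrable setT (EFin \o \1_S) by exact: integrable_indic_fin.
have intMS : vol.-integrable setT (EFin \o (fun x => M * \1_S x)).
  exact: (integrableZl measurableT _ intS).
(* Indicator and cutoff differ by at most 1, and only on the shell between [q] and [r]. The bound
   [M] depends on the field, but the term disappears as [q] tends to [r]. *)
have H1 : \int[vol]_x (\1_(C `&` eball x0 r) x * divergence xi x) -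
    \int[vol]_x (cutoff x0 q r x * divergence xi x) <= M * (ballv C x0 r - ballv C x0 q).
  have -> : M * (ballv C x0 r - ballv C x0 q) = \int[vol]_x (M * \1_S x).
    by rewrite RintegralZl // IS vS.
  rewrite -RintegralB //; apply: le_Rintegral => //.
    exact: (integrableB measurableT intE intc).
  move=> x _; rewrite -mulrBl.
  have [Cx|nCx] := pselect (C x); last first.
    by rewrite (divergence_eq0 txi nCx) mulr0 mulr_ge0.
  have [xr|rx] := ltP (enorm (x - x0)) r; last first.
    rewrite (cutoff_eq0 (ltW q0) qr rx) subr0 indicE memNset ?mul0r ?mulr_ge0 //.
    by move=> [_]; rewrite /eball /= ltNge rx.
  rewrite indicE mem_set; last by split.
  have [xq|qx] := ltP (enorm (x - x0)) q.
    by rewrite (cutoff_eq1 (ltW q0) qr (ltW xq)) subrr mul0r mulr_ge0.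
  rewrite indicE mem_set; last by split; [split|move=> [_]; rewrite /eball /= ltNge qx].
  rewrite mulr1 (le_trans (ler_norm _)) // normrM.
  rewrite -[leRHS]mul1r ler_pM // ger0_norm ?subr_ge0 ?cutoff_le1 //.
  by rewrite lerBlDr lerDl cutoff_ge0.
have H2 : \int[vol]_x (cutoff x0 q r x * divergence xi x) <=
    (2 * (r + d) + n.+1%:R * d) / (r ^+ 2 - q ^+ 2) *
    (ballv C x0 (r + d) - ballv C x0 (q - d)).
  by apply: integral_cutoff_divergence_le => //; exact: ltW.
have rd : r <= r + d by rewrite lerDl ltW.
have qd0 : 0 < q - d by rewrite subr_gt0.
have qdr : q - d <= r by rewrite lerBlDr (le_trans (ltW qr)).
have B1 := ballv_scale cC Cx0 r0 rd.
have B2 := ballv_scale_ge qd0 qdr.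
have B3 := ballv_scale_ge q0 (ltW qr).
have s0 : 0 < r ^+ 2 - q ^+ 2 by rewrite subr_gt0 ltr_pXn2r // nnegrE ltW.
have L0 : 0 <= (2 * (r + d) + n.+1%:R * d) / (r ^+ 2 - q ^+ 2).
  by rewrite divr_ge0 ?(ltW s0) // addr_ge0 ?mulr_ge0 ?addr_ge0 // ltW.
move: H1 H2 B1 B2 B3; set A := (X in X - _ <= _); set I := (X in A - X <= _).
move: (ballv C x0 (r + d)) (ballv C x0 (q - d)) (ballv C x0 q) => b1 b2 b3.
move: (_ / _) L0 ((r + d) / r) ((q - d) / r) (q / r) => L L0 X Y Z H1 H2 B1 B2 B3.
have H3 : L * (b1 - b2) <= L * (X ^+ n.+1 * ballv C x0 r - Y ^+ n.+1 * ballv C x0 r).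
  by rewrite ler_wpM2l // lerB.
have H4 : M * (ballv C x0 r - b3) <= M * (ballv C x0 r - Z ^+ n.+1 * ballv C x0 r).
  by rewrite ler_wpM2l // lerB.
move: (X ^+ _) (Y ^+ _) (Z ^+ _) H3 H4 => X' Y' Z' H3 H4.
have -> : L * (X' - Y') * ballv C x0 r + M * (1 - Z') * ballv C x0 r =
    L * (X' * ballv C x0 r - Y' * ballv C x0 r) + M * (ballv C x0 r - Z' * ballv C x0 r) by ring.
have := lerD H1 H2; rewrite subrK => /le_trans; apply.
by rewrite addrC; exact: lerD.
Qed.

(** Two limits in this order: [d] to 0 for fixed [q], then [q] to [r]. After the first, the shell
    volume and r^2 - q^2 both vanish to first order in r - q, and their ratio gives (n + 1) / r. *)
Lemma divergence_ball_le (xi : V -> V) (r : R) : perimeter_test_field C xi -> 0 < r ->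
  \int[vol]_(x in C `&` eball x0 r) divergence xi x <= n.+1%:R * ballv C x0 r / r.
Proof.
move=> txi r0; have [M M0 HM] := divergence_bounded txi.
have b0 := ballv_ge0 C x0 r.
set A := \int[vol]_(x in _) _; set b := ballv C x0 r in b0 *.
have step1 (q : R) : 0 < q -> q < r ->
    A <= 2 * r / (r ^+ 2 - q ^+ 2) * (1 - (q / r) ^+ n.+1) * b + M * (1 - (q / r) ^+ n.+1) * b.
  move=> q0 qr; pose g (d : R) := (2 * (r + d) + n.+1%:R * d) / (r ^+ 2 - q ^+ 2) *
    (((r + d) / r) ^+ n.+1 - ((q - d) / r) ^+ n.+1) * b + M * (1 - (q / r) ^+ n.+1) * b.
  have -> : 2 * r / (r ^+ 2 - q ^+ 2) * (1 - (q / r) ^+ n.+1) * b +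
      M * (1 - (q / r) ^+ n.+1) * b = g 0.
    by rewrite /g !addr0 subr0 mulr0 addr0 divff ?gt_eqF // expr1n.
  apply: (@le_continuous_at0 _ A q g _ q0).
    have cX (f : R -> R) (l : R) k : f x @[x --> (0 : R)] --> l -> (f x) ^+ k @[x --> (0 : R)] --> l ^+ k.
      move=> fl; apply: (@continuous_cvg _ _ _ _ _ f (fun y : R => y ^+ k) l _ fl).
      exact: exprn_continuous.
    have cid : x @[x --> (0 : R)] --> (0 : R) by exact: cvg_id.
    rewrite /g; apply: cvgD; last exact: cvg_cst.
    apply: cvgM; last exact: cvg_cst.
    apply: cvgM.
      apply: cvgM; last exact: cvg_cst.
      apply: cvgD; apply: cvgM; try exact: cvg_cst; try exact: cid.
      by apply: cvgD; [exact: cvg_cst|exact: cid].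
    apply: cvgB; apply: cX; apply: cvgM; try exact: cvg_cst.
      by apply: cvgD; [exact: cvg_cst|exact: cid].
    by apply: cvgB; [exact: cvg_cst|exact: cid].
  by move=> d /andP[d0 dq]; exact: divergence_ball_le_radii.
(* With q = r (1 - t), r^2 - q^2 = r^2 t (2 - t), and Bernoulli bounds the shell by (n + 1) t; the
   factor t cancels. *)
have step2 (t : R) : 0 < t < 1 -> A <= 2 / (r * (2 - t)) * n.+1%:R * b + M * (n.+1%:R * t) * b.
  move=> /andP[t0 t1].
  have q0 : 0 < r * (1 - t) by rewrite mulr_gt0 // subr_gt0.
  have qr : r * (1 - t) < r by rewrite gtr_pMr // gtrBl.
  apply: (le_trans (step1 _ q0 qr)).
  have -> : r * (1 - t) / r = 1 - t by rewrite mulrAC divff ?gt_eqF // mul1r.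
  have t01 : 0 <= 1 - t <= 1 by rewrite subr_ge0 ltW //= gerBl ltW.
  have := one_sub_expr_le n.+1 t01; rewrite opprB addrCA subrr addr0 => H.
  have H0 : 0 <= 2 * r / (r ^+ 2 - (r * (1 - t)) ^+ 2).
    rewrite divr_ge0 ?mulr_ge0 ?(ltW r0) // subr_ge0.
    by rewrite ler_pXn2r ?nnegrE ?ltW.
  apply: lerD; rewrite ler_wpM2r //; last by rewrite ler_wpM2l.
  apply: (le_trans (ler_wpM2l H0 H)).
  rewrite le_eqVlt; apply/orP; left; apply/eqP.
  have r1 : r != 0 by rewrite gt_eqF.
  have t2 : t != 0 by rewrite gt_eqF.
  have t3 : 2 - t != 0 by rewrite gt_eqF // subr_gt0 (lt_trans t1) // ltr1n.
  have -> : r ^+ 2 - (r * (1 - t)) ^+ 2 = r ^+ 2 * t * (2 - t) by ring.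
  by move: (n.+1%:R : R) => N; field; rewrite r1 t2 t3.
pose g (t : R) := 2 / (r * (2 - t)) * n.+1%:R * b + M * (n.+1%:R * t) * b.
have -> : n.+1%:R * b / r = g 0.
  have r1 : r != 0 by rewrite gt_eqF.
  by rewrite /g; move: (n.+1%:R : R) => N; field; rewrite r1.
apply: (@le_continuous_at0 _ A 1 g _ ltr01 step2).
have cid : x @[x --> (0 : R)] --> (0 : R) by exact: cvg_id.
rewrite /g; apply: cvgD.
  apply: cvgM; last exact: cvg_cst.
  apply: cvgM; last exact: cvg_cst.
  apply: cvgM; first exact: cvg_cst.
  apply: cvgV; first by rewrite subr0 mulf_neq0 // gt_eqF.
  apply: cvgM; first exact: cvg_cst.
  by apply: cvgB; [exact: cvg_cst|exact: cid].
apply: cvgM; last exact: cvg_cst.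
apply: cvgM; first exact: cvg_cst.
by apply: cvgM; [exact: cvg_cst|exact: cid].
Qed.

Lemma perimeter_ball_le (r : R) : 0 < r ->
  (relative_perimeter C (C `&` eball x0 r) <= (n.+1%:R * ballv C x0 r / r)%:E)%E.
Proof.
move=> r0; apply: ge_ereal_sup => _ [xi txi <-].
have mE : lebesgue_measurable (C `&` eball x0 r) by exact: measurable_cap_eball.
have intE := integrable_divergence r txi.
have E1 : (fun x => (\1_(C `&` eball x0 r) x * divergence xi x)%:E) =
    (EFin \o divergence xi) \_ (C `&` eball x0 r).
  apply/funext => x; rewrite patchE indicE; case: ifP => _; first by rewrite mul1r.
  by rewrite mul0r.
have -> : (\int[vol]_(x in C `&` eball x0 r) (divergence xi x)%:E =
    (\int[vol]_(x in C `&` eball x0 r) divergence xi x)%:E)%E.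
  rewrite EFin_Rintegral //; apply/(integrable_mkcond _ mE); rewrite -E1; exact: intE.
by rewrite lee_fin; exact: divergence_ball_le.
Qed.

End perimeter_of_balls.

(** * Continuity of ball volumes and the upper bound for the profile *)

Section profile_bounds.
Context {R : realType} {n : nat}.
Local Notation V := 'rV[R]_n.+1.
Local Notation vol := (@lebesgueV R n).
Variable C : set V.
Hypotheses (mC : lebesgue_measurable C) (cC : segment_closed C).

(** The scaling inequality squeezes the volume at [s] between multiples of the volume at [t] whose
    factors tend to 1. *)
Lemma ballv_continuous x (t : R) : C x -> 0 < t -> {for t, continuous (ballv C x)}.
Proof.
move=> Cx t0.
have b0 := ballv_ge0 C x t.
have H (s : R) : 0 < s -> `|ballv C x s - ballv C x t| <= `|(s / t) ^+ n.+1 - 1| * ballv C x t.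
  move=> s0; have [st|/ltW ts] := leP s t.
    have B1 := ballv_scale_ge cC Cx s0 st.
    have B2 : ballv C x s <= ballv C x t.
      by apply: le_ballv => y [Cy ys]; split => //; exact: le_eball ys.
    have B3 : (s / t) ^+ n.+1 <= 1.
      by rewrite exprn_ile1 ?divr_ge0 ?(ltW t0) ?(ltW s0) // ler_pdivrMr // mul1r.
    rewrite distrC ger0_norm ?subr_ge0 // distrC ger0_norm ?subr_ge0 //.
    by rewrite mulrBl mul1r lerB.
  have B1 := ballv_scale cC Cx t0 ts.
  have B2 : ballv C x t <= ballv C x s.
    by apply: le_ballv => y [Cy ys]; split => //; exact: le_eball ys.
  have B3 : 1 <= (s / t) ^+ n.+1.
    by rewrite exprn_ege1 // ler_pdivlMr // mul1r.
  rewrite ger0_norm ?subr_ge0 // ger0_norm ?subr_ge0 //.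
  by rewrite mulrBl mul1r lerB.
have c1 : `|(s / t) ^+ n.+1 - 1| * ballv C x t @[s --> t] --> 0.
  have -> : (0 : R) = `|(t / t) ^+ n.+1 - 1| * ballv C x t.
    by rewrite divff ?gt_eqF // expr1n subrr normr0 mul0r.
  apply: cvgM; last exact: cvg_cst.
  apply: cvg_norm; apply: cvgB; last exact: cvg_cst.
  apply: (@continuous_cvg _ _ _ _ _ (fun s : R => s / t) (fun y : R => y ^+ n.+1) (t / t)).
    exact: exprn_continuous.
  by apply: cvgM; [exact: cvg_id|exact: cvg_cst].
apply/cvgrPdist_le => e e0; near=> s.
rewrite distrC (le_trans (H s _)) //.
  by near: s; exact: lt_nbhsr.
near: s; move/cvgr0_norm_le: c1 => /(_ _ e0); apply: filterS => s.
by apply: le_trans; exact: ler_norm.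
Unshelve. all: by end_near. Qed.

Lemma exists_ball_volume x (r s v : R) : C x -> 0 < r -> r <= s ->
  ballv C x r <= v <= ballv C x s -> exists2 t, r <= t & ballv C x t = v.
Proof.
move=> Cx r0 rs /andP[rv vs].
have cf : {within `[r, s], continuous (ballv C x)}.
  apply: continuous_in_subspaceT => t; rewrite inE /= in_itv /= => /andP[rt _].
  by apply: ballv_continuous => //; exact: lt_le_trans rt.
have [|t /[!in_itv] /= /andP[rt _] tv] := @IVT _ _ _ _ v rs cf.
  by rewrite ge_min rv /= le_max vs orbT.
by exists t.
Qed.

Hypotheses (ubC : ~ bounded_set C) (C0 : C !=set0).
Hypothesis (ug : uniform_geometry C).
Variable v : R.
Hypothesis v0 : 0 < v.

(** The hypothesis speaks of closed balls; doubling the radius passes to open ones. *)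
Lemma uniform_ballv : exists c r0 : R, [/\ 0 < c, 0 < r0 & forall y, C y -> c <= ballv C y r0].
Proof.
have [_ [r r0 Hr]] := ug; have [x Cx] := C0.
set e := ereal_inf _ in Hr.
have He y : C y -> (e <= (ballv C y (2 * r))%:E)%E.
  move=> Cy; rewrite -ballvE; apply: (@le_trans _ _ (vol (C `&` eclosed_ball y r))).
    by apply: ereal_inf_lbound; exists y.
  apply: le_vol => z [Cz yz]; split => //; rewrite /eball /= (le_lt_trans yz) //.
  by rewrite ltr_pMl // ltr1n.
have efin : e \is a fin_num.
  by rewrite ge0_fin_numE ?(ltW Hr) // (le_lt_trans (He x Cx)) // ltry.
exists (fine e), (2 * r); split; [|by rewrite mulr_gt0|].
  by rewrite -lte_fin fineK.
by move=> y Cy; rewrite -lee_fin fineK // He.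
Qed.

Lemma profile_le_of_not_volume_ge (r : R) : 0 < r ->
  ~ (v%:E <= min_ball_volume C r)%E ->
  (isoperimetric_profile C v <= (n.+1%:R * v / r)%:E)%E.
Proof.
move=> r0 /negP; rewrite -ltNge => /ereal_inf_lt[_ [x Cx <-]].
rewrite ballvE lte_fin => xv.
have [c [r1 [c0 r10 Hc]]] := uniform_ballv.
have [s s0 vs] := ballv_unbounded mC cC ubC v Cx c0 r10 Hc.
have rs : r <= s.
  rewrite leNgt; apply/negP => sr; move: xv; rewrite ltNge => /negP; apply.
  apply: (le_trans vs); apply: le_ballv => y [Cy ys]; split => //.
  by apply: le_eball ys; exact: ltW.
have [|t rt tv] := @exists_ball_volume x r s v Cx r0 rs; first by rewrite (ltW xv).
have t0 : 0 < t by exact: lt_le_trans rt.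
apply: (@le_trans _ _ (relative_perimeter C (C `&` eball x t))).
  apply: ereal_inf_lbound; exists (C `&` eball x t) => //; split.
  - exact: measurable_cap_eball.
  - exact: subIsetl.
  - by rewrite ballvE tv.
apply: (le_trans (perimeter_ball_le mC cC Cx t0)).
by rewrite tv lee_fin ler_wpM2l ?mulr_ge0 ?(ltW v0) // lef_pV2.
Qed.

Lemma profile_upper_bound :
  (isoperimetric_profile C v <= (n.+1%:R : R)%:E * (v%:E / reciprocal_ball_volume C v))%E.
Proof.
have key (r : R) : 0 < r -> (r%:E < reciprocal_ball_volume C v)%E ->
    (isoperimetric_profile C v <= (n.+1%:R * v / r)%:E)%E.
  move=> r0 rphi; apply: profile_le_of_not_volume_ge => // vr.
  move: rphi; rewrite ltNge => /negP; apply; apply: ereal_inf_lbound.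
  by exists r.
have phi0 : (0 <= reciprocal_ball_volume C v)%E.
  by apply: le_ereal_inf_tmp => _ [r [r0 _] <-]; rewrite lee_fin ltW.
have Nv0 : 0 < n.+1%:R * v by rewrite mulr_gt0.
have divK (a b : R) : 0 < a -> a / (a / b) = b.
  by move=> a0; rewrite invf_div mulrCA divff ?mulr1 // gt_eqF.
(* If phi is infinite the right side is 0, and radii as large as desired make the profile at most
   any e > 0. If phi is 0 the right side is infinite. *)
move: key phi0; case: (reciprocal_ball_volume C v) => [p| |//] key; last first.
  move=> _; rewrite invey mule0 mule0; apply/lee_addgt0Pr => e e0; rewrite add0e.
  have := key (n.+1%:R * v / e); rewrite ltry divr_gt0 // => /(_ isT isT).
  by rewrite divK.
rewrite lee_fin le_eqVlt => /orP[/eqP <-|p0].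
  by rewrite inve0 gt0_muley ?lte_fin // gt0_muley ?lte_fin // leey.
rewrite inver gt_eqF // -!EFinM; apply/lee_addgt0Pr => e e0.
(* The radius below phi is chosen so that its bound is exactly (n + 1) v / phi + e. *)
have D0 : 0 < n.+1%:R * (v / p) + e by rewrite addr_gt0 // mulr_gt0 // divr_gt0.
have := key (n.+1%:R * v / (n.+1%:R * (v / p) + e)); rewrite divr_gt0 // lte_fin => /(_ isT).
rewrite divK // EFinD; apply.
rewrite ltr_pdivrMr //.
have -> : p * (n.+1%:R * (v / p) + e) = n.+1%:R * v + p * e.
  have p1 : p != 0 by rewrite gt_eqF.
  by move: (n.+1%:R : R) => N; field.
by rewrite ltrDl mulr_gt0.
Qed.

End profile_bounds.

(** * Reduction of the lower bound to a fixed set and a fixed radius *)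

Section profile_lower_wrapper.
Context {R : realType} {n : nat}.
Local Notation V := 'rV[R]_n.+1.
Local Notation vol := (@lebesgueV R n).
Variables (C : set V) (v k : R).
Hypotheses (C0 : C !=set0) (v0 : 0 < v) (k0 : 0 < k).

Lemma relative_perimeter_ge0 (E : set V) : (0 <= relative_perimeter C E)%E.
Proof.
have t0 : perimeter_test_field C (fun=> 0).
  have E0 : field_support (fun=> 0 : V) = set0.
    rewrite /field_support (_ : [set x | _] = set0) ?closure0 //.
    by apply/seteqP; split => // x /=; rewrite eqxx.
  split; rewrite ?E0.
  - move=> i m.
    have -> : (fun x : V => (0 : V) 0 i) = cst 0 by apply/funext => x; rewrite mxE.
    elim: m => [|m IH] /=; split => //; try exact: cst_continuous.
    move=> j; split; first by move=> x; exact: derivable_cst.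
    have -> : partial j (cst 0 : V -> R) = cst 0; last exact: IH.
    by apply/funext => x; rewrite /partial derive_cst.
  - exact: compact0.
  - exact: sub0set.
  - by move=> x; rewrite enorm0.
have := @ereal_sup_ubound _ [set (\int[vol]_(x in E) (divergence xi x)%:E)%E | xi in perimeter_test_field C].
apply; exists (fun=> 0) => //.
rewrite (eq_integral (cst 0%E)) ?integral0 // => x _; congr EFin.
apply: big1 => i _; rewrite /partial.
have -> : (fun y : V => (0 : V) 0 i) = cst 0 by apply/funext => y; rewrite mxE.
by rewrite derive_cst.
Qed.

(** If the perimeter [q] of some [E] were below k v / phi, an admissible radius close enough to phi
    would already satisfy r q < k v, against the bound at that radius. *)
Lemma profile_lower_bound :
  (forall E (r : R), lebesgue_measurable E -> E `<=` C -> vol E = v%:E -> 0 < r ->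
    (forall x, C x -> v <= ballv C x r) ->
    ((k * (v / r))%:E <= relative_perimeter C E)%E) ->
  (k%:E * (v%:E / reciprocal_ball_volume C v) <= isoperimetric_profile C v)%E.
Proof.
move=> core; apply: le_ereal_inf_tmp => _ [E [mE EC vE] <-].
have core' (r : R) : 0 < r -> (v%:E <= min_ball_volume C r)%E ->
    ((k * (v / r))%:E <= relative_perimeter C E)%E.
  move=> r0 vr; apply: core => // x Cx; rewrite -lee_fin -ballvE.
  by apply: (le_trans vr); apply: ereal_inf_lbound; exists x.
have P0 := relative_perimeter_ge0 E.
have [x Cx] := C0.
set beta := fine (vol (eball (0 : V) 1)).
have betaE : vol (eball (0 : V) 1) = beta%:E.
  by rewrite fineK // ge0_fin_numE ?vol_ge0 // vol_eball_lty.
have beta0 : 0 <= beta by exact/fine_ge0/vol_ge0.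
(* Admissible radii stay away from 0: for r < 1, v <= r^(n+1) beta <= r (beta + 1). The added 1
   makes the denominator positive whatever [beta] is. Hence phi > 0. *)
pose r1 := Num.min 1 (v / (beta + 1)).
have r10 : 0 < r1 by rewrite lt_min ltr01 divr_gt0 // ltr_wpDl.
have r1le (r : R) : 0 < r -> (v%:E <= min_ball_volume C r)%E -> r1 <= r.
  move=> r0 vr; rewrite ge_min; have [//|r1'/=] := leP 1 r.
  have : (v%:E <= vol (eball x r))%E.
    apply: (le_trans vr); apply: (@le_trans _ _ (vol (C `&` eball x r))).
      by apply: ereal_inf_lbound; exists x.
    by apply: le_vol; exact: subIsetr.
  rewrite vol_eball // betaE -EFinM lee_fin => H.
  rewrite ler_pdivrMr ?ltr_wpDl // (le_trans H) //.
  rewrite exprS -mulrA ler_pM2l // (@le_trans _ _ beta) ?lerDl //.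
  by rewrite ler_piMl // exprn_ile1 // ltW.
have phi1 : (r1%:E <= reciprocal_ball_volume C v)%E.
  by apply: le_ereal_inf_tmp => _ [r [r0 vr] <-]; rewrite lee_fin r1le.
rewrite leNgt; apply/negP.
case phiE : (reciprocal_ball_volume C v) phi1 => [p| |//]; last first.
  by rewrite invey mule0 mule0 ltNge P0.
rewrite lee_fin => r1p; have p0 : 0 < p by exact: lt_le_trans r1p.
rewrite inver gt_eqF // -!EFinM.
move: P0 core'; case: (relative_perimeter C E) => [q| |//] P0 core' ; last by rewrite ltNge leey.
rewrite lte_fin => qp.
(* The case q = 0 is separate because k v / q would be 0 by convention; any admissible radius then
   works. *)
have [r [[r0 vr] rp]] : exists r : R, (0 < r /\ (v%:E <= min_ball_volume C r)%E) /\ r * q < k * v.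
  have q0 : 0 <= q by rewrite -lee_fin.
  have : (reciprocal_ball_volume C v < ((k * v) / q)%:E)%E \/ q = 0.
    move: q0; rewrite le_eqVlt => /orP[/eqP <-|q0]; [by right|left].
    by rewrite phiE lte_fin ltr_pdivlMr // mulrC -ltr_pdivlMr // -mulrA.
  case=> [/ereal_inf_lt[_ [r rS <-]]|->].
    rewrite lte_fin => rq; exists r; split => //.
    have q1 : 0 < q.
      rewrite lt_neqAle q0 andbT; apply/eqP => qE; move: rq; rewrite -qE invr0 mulr0 ltNge.
      by case: rS => /ltW ->.
    by rewrite -ltr_pdivlMr.
  have : (reciprocal_ball_volume C v < +oo)%E by rewrite phiE ltry.
  by move=> /ereal_inf_lt[_ [r rS <-]] _; exists r; split => //; rewrite mulr0 mulr_gt0.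
have := core' r r0 vr; rewrite lee_fin mulrA ler_pdivrMr // => H.
by move: (lt_le_trans rp H); rewrite mulrC ltxx.
Qed.

End profile_lower_wrapper.

(** * Measurability of vector-valued maps *)

Section coordinatewise_measurable.
Context {R : realType} {n : nat} {d} {T : measurableType d}.
Local Notation V := 'rV[R]_n.+1.
Implicit Types (f g : T -> V).

(* Row vectors carry only the Caratheodory sigma-algebra here, which is not
   generated by the coordinates; measurability of vector-valued maps is therefore
   required coordinate by coordinate. *)
Definition vmeas f := forall i, measurable_fun setT (fun t => f t 0 i).

Lemma vmeasD f g : vmeas f -> vmeas g -> vmeas (fun t => f t + g t).
Proof. by move=> mf mg i; under eq_fun do rewrite mxE; exact: measurable_funD (mf i) (mg i). Qed.

Lemma vmeasB f g : vmeas f -> vmeas g -> vmeas (fun t => f t - g t).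
Proof. by move=> mf mg i; under eq_fun do rewrite !mxE; exact: measurable_funB (mf i) (mg i). Qed.

Lemma vmeasZ (a : R) f : vmeas f -> vmeas (fun t => a *: f t).
Proof.
move=> mf i; under eq_fun do rewrite !mxE.
exact: measurable_funM (measurable_cst a) (mf i).
Qed.

Lemma vmeas_cst (a : V) : vmeas (fun=> a).
Proof. by move=> i; exact: measurable_cst. Qed.

Lemma vmeas_dotp f g : vmeas f -> vmeas g -> measurable_fun setT (fun t => dotp (f t) (g t)).
Proof. by move=> mf mg; apply: measurable_sum => i; exact: measurable_funM (mf i) (mg i). Qed.

Lemma measurable_enorm_lt f (r : R) : vmeas f -> measurable [set t | enorm (f t) < r].
Proof.
move=> mf; have [r0|r0] := leP r 0.
  rewrite (_ : [set t | _] = set0) //; apply/seteqP; split => // t /=.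
  by rewrite ltNge (le_trans r0) // enorm_ge0.
have -> : [set t | enorm (f t) < r] = (fun t => r ^+ 2 - dotp (f t) (f t)) @^-1` `]0, +oo[%classic.
  apply/seteqP; split => t; rewrite /= in_itv /= andbT subr_gt0 -enorm_sqr.
    by rewrite ltr_pXn2r // nnegrE ?enorm_ge0 // ltW.
  by rewrite ltr_pXn2r // nnegrE ?enorm_ge0 // ltW.
have m := measurable_funB (measurable_cst (r ^+ 2)) (vmeas_dotp mf mf).
by rewrite -[X in measurable X]setTI; exact: m.
Qed.

End coordinatewise_measurable.

(** * The mollifier *)

Section mollifier.
Context {R : realType} {n : nat}.
Local Notation V := 'rV[R]_n.+1.
Local Notation leb := (@lebesgue_outer R n).
Local Notation vol := (@lebesgueV R n).
Local Notation VM := (caratheodory_type leb).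
Implicit Types (x y z w : V).

Lemma vmeas_id : vmeas (fun x : VM => x : V).
Proof. exact: measurable_coord. Qed.

Lemma vmeas_comp d (T : measurableType d) (f : T -> VM) : measurable_fun setT f ->
  vmeas (fun t => f t : V).
Proof. by move=> mf i; exact: measurableT_comp (measurable_coord i) mf. Qed.

(** Left unnormalised: its integral [mass eps] is carried through the estimates and cancels at the
    end. *)
Definition moll (eps : R) (z : V) : R := flat 0 (eps ^+ 2 - dotp z z).

Lemma bump_moll eps : bump (eps ^+ 2) (moll eps).
Proof. exact: bump_flat. Qed.

Lemma moll_ge0 eps z : 0 <= moll eps z.
Proof. exact: flat_ge0. Qed.

Lemma moll_sym eps x y : moll eps (x - y) = moll eps (y - x).
Proof. by rewrite /moll -!enorm_sqr enormB. Qed.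

Lemma moll_eq0 eps z : 0 <= eps -> eps <= enorm z -> moll eps z = 0.
Proof.
move=> e0 ez; apply: (bump_eq0 (bump_moll eps)).
by rewrite -enorm_sqr ler_pXn2r // nnegrE enorm_ge0.
Qed.

Lemma moll_le1 eps z : moll eps z <= 1.
Proof. by have := flat_le_fact 0 (eps ^+ 2 - dotp z z); rewrite fact0. Qed.

Lemma measurable_moll d (T : measurableType d) eps (f : T -> V) : vmeas f ->
  measurable_fun setT (fun t => moll eps (f t)).
Proof. by move=> mf; exact: (measurable_bump (bump_moll eps) mf). Qed.

Definition mass eps : R := \int[vol]_z moll eps z.

Lemma integrable_moll eps w : 0 < eps ->
  vol.-integrable setT (EFin \o (fun z => moll eps (z - w))).
Proof.
move=> e0; apply: (@integrable_le_indic _ _ _ vol _ (eball w eps) 1).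
- by apply: measurable_moll; apply: vmeasB; [exact: vmeas_id|exact: vmeas_cst].
- exact: measurable_eball.
- exact: vol_eball_lty.
- move=> z; rewrite mul1r ger0_norm ?moll_ge0 //.
  have [zw|wz] := ltP (enorm (z - w)) eps.
    by rewrite indicE mem_set // moll_le1.
  by rewrite moll_eq0 // ltW.
Qed.

Lemma integral_moll eps w : 0 < eps -> (\int[vol]_x (moll eps (x - w))%:E = (mass eps)%:E)%E.
Proof.
move=> e0; have i0 := integrable_moll 0 e0.
have E0 : (\int[vol]_x (moll eps x)%:E = \int[vol]_x (moll eps (x - 0))%:E)%E.
  by apply: eq_integral => x _; rewrite subr0.
have fin0 := integrable_fin_num measurableT i0.
have -> : (mass eps)%:E = (\int[vol]_x (moll eps (x - 0))%:E)%E.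
  by rewrite /mass /Rintegral E0 (fineK fin0).
have mf : measurable_fun setT (fun x : VM => (moll eps ((x : V) - 0))%:E).
  by case/integrableP: i0.
apply: etrans; last exact: (integral_shift (- w) mf i0).
by apply: eq_integral => x _; rewrite subr0.
Qed.

Lemma mass_gt0 eps : 0 < eps -> (0 < vol (eball (0 : V) 1))%E -> 0 < mass eps.
Proof.
move=> e0 v1; rewrite -lte_fin -(integral_moll 0 e0).
have h0 : 0 < eps / 2 by rewrite divr_gt0.
(* Lower bound of the mollifier on the ball of half radius, where eps^2 - |x|^2 >= eps^2 / 2. *)
pose c := expR (- (eps ^+ 2 / 2)^-1).
have mB : lebesgue_measurable (eball (0 : V) (eps / 2)) by exact: measurable_eball.
apply: (@lt_le_trans _ _ (\int[vol]_x (c%:E * (\1_(eball (0 : V) (eps / 2)) x)%:E))%E).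
  have m1 : measurable_fun setT (EFin \o (\1_(eball (0 : V) (eps / 2)) : VM -> R)).
    by apply/measurable_EFinP; exact: measurable_indic.
  rewrite (ge0_integralZl vol measurableT m1); last 2 first.
    by move=> x _; rewrite lee_fin.
    by rewrite lee_fin expR_ge0.
  have vpos : (0 < vol (eball (0 : V) (eps / 2)))%E.
    by rewrite vol_eball // mule_gt0 // lte_fin exprn_gt0.
  by rewrite integral_indic // setIT; apply: mule_gt0; rewrite ?lte_fin ?expR_gt0.
have /integrableP[mm _] := integrable_moll 0 e0.
apply: ge0_le_integral.
- exact: measurableT.
- by move=> x _; rewrite mule_ge0 // lee_fin ?expR_ge0.
- apply: measurable_funeM; apply/measurable_EFinP; exact: measurable_indic.
- exact: mm.
- move=> x _; rewrite -EFinM lee_fin.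
  have [xe|ex] := ltP (enorm x) (eps / 2); last first.
    rewrite indicE memNset ?mulr0 ?moll_ge0 //.
    by rewrite /eball /= subr0; apply/negP; rewrite -leNgt.
  rewrite indicE mem_set ?mulr1; last by rewrite /eball /= subr0.
  rewrite subr0 /moll /flat -enorm_sqr.
  have xe2 : enorm x ^+ 2 <= eps ^+ 2 / 4.
    have -> : eps ^+ 2 / 4 = (eps / 2) ^+ 2 by field.
    by rewrite ler_pXn2r ?nnegrE ?enorm_ge0 ?ltW.
  have e2 : 0 < eps ^+ 2 by rewrite exprn_gt0.
  have d1 : eps ^+ 2 / 2 <= eps ^+ 2 - enorm x ^+ 2 by lra.
  have d0 : 0 < eps ^+ 2 / 2 by rewrite divr_gt0.
  have d2 : 0 < eps ^+ 2 - enorm x ^+ 2 by exact: lt_le_trans d1.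
  by rewrite d2 expr0 mul1r ler_expR lerN2 lef_pV2.
Qed.

End mollifier.

(** * The kernel estimate behind the bound on the momentum *)

Section convolution_bound.
Context {R : realType} {n : nat}.
Local Notation V := 'rV[R]_n.+1.
Local Notation leb := (@lebesgue_outer R n).
Local Notation vol := (@lebesgueV R n).
Local Notation VM := (caratheodory_type leb).
Implicit Types (x y z w : V).
Variables (C D : set V) (L b0 eps : R).
Hypotheses (mC : lebesgue_measurable C) (cC : segment_closed C).
Hypotheses (mD : lebesgue_measurable D) (DC : D `<=` C).
Hypotheses (L0 : 0 < L) (b00 : 0 < b0) (Hb : forall x, C x -> b0 <= ballv C x L).
Hypothesis eps0 : 0 < eps.

(** The inverse of the ball volume, written as a real power so that [measurable_powR] applies. *)
Definition wt (x : V) : R := (ballv C x L) `^ (-1).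

(** The volumes are those of the sections of one measurable set of pairs. *)
Lemma measurable_ballv : measurable_fun setT (fun x : VM => ballv C x L).
Proof.
pose S : set (VM * VM) := [set p | C p.2] `&` [set p | enorm ((p.2 : V) - (p.1 : V)) < L].
have mS : measurable S.
  apply: measurableI.
    have := @measurable_snd _ _ VM VM; move=> /(_ measurableT _ mC).
    by rewrite setTI.
  apply: measurable_enorm_lt; apply: vmeasB; apply: vmeas_comp.
    exact: measurable_snd.
  exact: measurable_fst.
have -> : (fun x : VM => ballv C x L) = fine \o (fun x : VM => vol (xsection S x)).
  apply/funext => x /=; rewrite /ballv; congr (fine (vol _)).
  by apply/seteqP; split => y; rewrite /xsection /= inE.
exact: (measurableT_comp (fine_measurable measurableT) (measurable_fun_xsection vol mS)).
Qed.

Lemma measurable_wt : measurable_fun setT (wt : VM -> R).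
Proof. exact: measurableT_comp (measurable_powR (-1)) measurable_ballv. Qed.

Lemma wtE x : wt x = (ballv C x L)^-1.
Proof. by rewrite /wt powR_inv1 // ballv_ge0. Qed.

Lemma wt_ge0 x : 0 <= wt x.
Proof. exact: powR_ge0. Qed.

Lemma wt_le x : C x -> wt x <= b0^-1.
Proof. by move=> Cx; rewrite wtE lef_pV2 ?posrE ?Hb // (lt_le_trans b00) ?Hb. Qed.

Lemma wt_ballv x : C x -> wt x * ballv C x L = 1.
Proof. by move=> Cx; rewrite wtE mulVf // gt_eqF // (lt_le_trans b00) ?Hb. Qed.

(** The ball of radius L at [z] lies in the ball of radius 2 L at [x], whose volume is at most
    2^(n+1) times that of radius L. *)
Lemma wt_doubling x z : C x -> C z -> enorm (z - x) <= L -> wt x <= 2 ^+ n.+1 * wt z.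
Proof.
move=> Cx Cz xz; have bx := lt_le_trans b00 (Hb Cx); have bz := lt_le_trans b00 (Hb Cz).
rewrite !wtE -lef_pV2 ?posrE ?mulr_gt0 ?invr_gt0 ?exprn_gt0 //.
rewrite invfM !invrK.
have H1 : ballv C z L <= ballv C x (2 * L).
  apply: le_ballv => y [Cy zy]; split => //; apply: eball_subset zy.
  by rewrite mulrDl mul1r lerD2r.
have L2 : L <= 2 * L by rewrite ler_pMl // ler1n.
have H2 := ballv_scale cC Cx L0 L2.
rewrite -ler_pdivlMl ?invr_gt0 ?exprn_gt0 // invrK (le_trans H1) // (le_trans H2) //.
by rewrite -mulrA divff ?mulr1 // gt_eqF.
Qed.

(* After substituting the point [z] of the segment [x, y] at the parameter [t] for
   its closer endpoint, the momentum density at [w] is dominated by this kernel in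
   the remaining endpoint and [z]; the doubling property of the balls replaces the
   weight at the remaining endpoint by the weight at [z]. *)
Definition kern (w : V) (p : VM * VM) : R :=
  \1_C p.1 * \1_[set p : VM * VM | enorm ((p.2 : V) - (p.1 : V)) < L] p *
  (2 ^+ n.+1 * wt p.2 * \1_D p.2 * moll eps ((p.2 : V) - w)).

Lemma kern_ge0 w p : 0 <= kern w p.
Proof. by rewrite !mulr_ge0 ?exprn_ge0 ?wt_ge0 ?moll_ge0. Qed.

Lemma measurable_kern w : measurable_fun setT (kern w).
Proof.
have m1 := @measurable_fst _ _ VM VM; have m2 := @measurable_snd _ _ VM VM.
have mN : measurable [set p : VM * VM | enorm ((p.2 : V) - (p.1 : V)) < L].
  by apply: measurable_enorm_lt; apply: vmeasB; apply: vmeas_comp.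
have i1 : measurable_fun setT (fun p : VM * VM => \1_C p.1 : R).
  exact: measurableT_comp (measurable_indic (mC : measurable (C : set VM))) m1.
have i2 : measurable_fun setT (fun p : VM * VM => \1_D p.2 : R).
  exact: measurableT_comp (measurable_indic (mD : measurable (D : set VM))) m2.
have i3 : measurable_fun setT (fun p : VM * VM => wt p.2).
  exact: measurableT_comp measurable_wt m2.
have i4 : measurable_fun setT (fun p : VM * VM => moll eps ((p.2 : V) - w)).
  by apply: measurable_moll; apply: vmeasB; [exact: vmeas_comp|exact: vmeas_cst].
suff : measurable_fun setT (fun p => kern w p) by [].
rewrite /kern; apply: measurable_funM.
  apply: measurable_funM; first exact: i1.
  exact: (measurable_indic mN).
apply: measurable_funM; last exact: i4.
apply: measurable_funM; last exact: i2.
apply: measurable_funM; last exact: i3.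
exact: measurable_cst.
Qed.

Local Open Scope ereal_scope.

(** By Tonelli, integrate in the endpoint first: this produces the volume of the ball at [z], which
    the weight at [z] cancels, leaving the integral of the mollifier. *)
Lemma integral_kern_le w :
  \int[vol]_x \int[vol]_z (kern w (x, z))%:E <= (2 ^+ n.+1 * @mass R n eps)%:E.
Proof.
have mk : measurable_fun setT (EFin \o kern w) by apply/measurable_EFinP; exact: measurable_kern.
have k0 p : 0 <= (EFin \o kern w) p by rewrite lee_fin kern_ge0.
rewrite (@fubini_tonelli _ _ _ _ _ vol vol (EFin \o kern w) mk k0) /=.
rewrite EFinM -(integral_moll w eps0).
have mm : measurable_fun setT (fun x : VM => (moll eps ((x : V) - w))%:E).
  by case/integrableP: (integrable_moll w eps0).
rewrite -(ge0_integralZl vol measurableT mm); last 2 first.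
- by move=> x _; rewrite lee_fin moll_ge0.
- by rewrite lee_fin exprn_ge0.
apply: ge0_le_integral.
- exact: measurableT.
- by move=> z _; apply: integral_ge0 => x _; rewrite lee_fin kern_ge0.
- exact: (measurable_fun_fubini_tonelli_G (EFin \o kern w) mk k0).
- exact: measurable_funeM.
- move=> z _.
  have [Dz|nDz] := pselect (D z); last first.
    rewrite (eq_integral (cst 0)) ?integral0 ?mule_ge0 ?lee_fin ?exprn_ge0 ?moll_ge0 //.
    by move=> x _; rewrite /kern /= [\1_D z]indicE memNset // mulr0 mul0r mulr0.
  have mB : lebesgue_measurable (C `&` eball z L) by exact: measurable_cap_eball.
  rewrite (eq_integral (fun x : VM => (2 ^+ n.+1 * wt z * moll eps (z - w))%:E *
      (\1_(C `&` eball z L) x)%:E)); last first.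
    move=> x _; rewrite -EFinM; congr EFin; rewrite /kern /= [\1_D z]indicE mem_set //.
    rewrite mulr1 mulrC; congr (_ * _)%R; rewrite !indicE -natrM mulnb.
    congr (_ %:R); congr nat_of_bool; apply/andP/idP => [[/set_mem Cx /set_mem xz]|].
      by apply/mem_set; split => //; rewrite /eball /= enormB.
    by move=> /set_mem[Cx xz]; split; apply/mem_set => //=; rewrite enormB.
  have m1 : measurable_fun setT (EFin \o (\1_(C `&` eball z L) : VM -> R)).
    by apply/measurable_EFinP; exact: measurable_indic.
  rewrite (ge0_integralZl vol measurableT m1); last 2 first.
    by move=> x _; rewrite lee_fin.
    by rewrite lee_fin !mulr_ge0 ?exprn_ge0 ?wt_ge0 ?moll_ge0.
  have -> : \int[vol]_x ((EFin \o (\1_(C `&` eball z L) : VM -> R)) x) = (ballv C z L)%:E.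
    by rewrite integral_indic // setIT; exact: ballvE.
  rewrite -!EFinM lee_fin mulrAC -!mulrA (mulrA (wt z)) wt_ballv ?mul1r //.
  exact: DC.
Qed.

(** For fixed [x], the substitution z = (1 - t) x + t y has Jacobian factor t^-(n+1), at most
    2^(n+1) since t >= 1/2; the other 2^(n+1) sits in [kern]. *)
Lemma convolution_le_half (f : VM * VM -> R) (t : R) w :
  measurable_fun setT f -> (forall p, (0 <= f p)%R) -> (1 / 2 <= t <= 1)%R ->
  (forall x y, (f (x, y) <= kern w (x, (1 - t) *: (x : V) + t *: (y : V)))%R) ->
  \int[vol]_x \int[vol]_y (f (x, y))%:E <= (4 ^+ n.+1 * @mass R n eps)%:E.
Proof.
move=> mf f0 /andP[t1 t2] fk.
have t0 : (0 < t)%R by rewrite (lt_le_trans _ t1) // divr_gt0.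
have mk : measurable_fun setT (EFin \o kern w) by apply/measurable_EFinP; exact: measurable_kern.
have k0 p : 0 <= (EFin \o kern w) p by rewrite lee_fin kern_ge0.
have mEf : measurable_fun setT (EFin \o f) by exact/measurable_EFinP.
have Ef0 p : 0 <= (EFin \o f) p by rewrite lee_fin.
have mkx (x : VM) : measurable_fun setT (fun z : VM => (kern w (x, z))%:E).
  exact: (measurableT_comp mk (pair1_measurable x)).
have mfx (x : VM) : measurable_fun setT (fun z : VM => (f (x, z))%:E).
  exact: (measurableT_comp mEf (pair1_measurable x)).
have inner (x : VM) : \int[vol]_y (f (x, y))%:E <= (t ^- n.+1)%:E * \int[vol]_z (kern w (x, z))%:E.
  rewrite -(@ge0_integral_homoth _ _ ((1 - t) *: (x : V)) t (fun z : VM => (kern w (x, z))%:E) t0 (mkx x)); last first.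
    by move=> z; rewrite lee_fin kern_ge0.
  apply: ge0_le_integral.
  - exact: measurableT.
  - by move=> y _; rewrite lee_fin.
  - exact: mfx.
  - exact: (measurableT_comp (mkx x) (measurable_homoth _ t0)).
  - by move=> y _; rewrite lee_fin; exact: fk.
apply: (@le_trans _ _ (\int[vol]_x ((t ^- n.+1)%:E * \int[vol]_z (kern w (x, z))%:E))).
  apply: ge0_le_integral.
  - exact: measurableT.
  - by move=> x _; apply: integral_ge0 => y _; rewrite lee_fin.
  - exact: (measurable_fun_fubini_tonelli_F (EFin \o f) mEf Ef0).
  - apply: measurable_funeM.
    exact: (measurable_fun_fubini_tonelli_F (EFin \o kern w) mk k0).
  - by move=> x _; exact: inner.
have tn0 : (0 <= t ^- n.+1)%R by rewrite invr_ge0 exprn_ge0 // ltW.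
rewrite (ge0_integralZl vol measurableT (measurable_fun_fubini_tonelli_F (EFin \o kern w) mk k0)); last 2 first.
- by move=> x _; apply: integral_ge0 => y _; rewrite lee_fin kern_ge0.
- by rewrite lee_fin.
apply: (le_trans (lee_wpmul2l _ (integral_kern_le w))); first by rewrite lee_fin.
have m0 : (0 <= @mass R n eps)%R by apply: Rintegral_ge0 => z _; exact: moll_ge0.
rewrite -EFinM lee_fin mulrA ler_wpM2r //.
have -> : (4 : R)%R = (2 * 2)%R by ring.
rewrite exprMn ler_wpM2r ?exprn_ge0 // -exprVn ler_pXn2r ?nnegrE ?invr_ge0 ?(ltW t0) //.
by rewrite invf_ple ?posrE // -div1r.
Qed.

End convolution_bound.

(** * The flow of the transported mass and its admissibility as a test field *)

Section flow_field.
Context {R : realType} {n : nat}.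
Local Notation V := 'rV[R]_n.+1.
Local Notation leb := (@lebesgue_outer R n).
Local Notation vol := (@lebesgueV R n).
Local Notation VM := (caratheodory_type leb).
Local Notation T := (VM * VM)%type.
Local Notation vol2 := (vol \x vol)%E.
Implicit Types (x y z w : V).
Variables (C D E A : set V) (L b0 eps v : R).
Hypotheses (mC : lebesgue_measurable C) (cC : segment_closed C).
Hypotheses (mD : lebesgue_measurable D) (cD : segment_closed D) (DC : D `<=` C).
Hypotheses (L0 : 0 < L) (b00 : 0 < b0) (Hb : forall x, C x -> b0 <= ballv C x L).
Hypothesis eps0 : 0 < eps.
Hypotheses (mE : lebesgue_measurable E) (vE : vol E = v%:E).
Hypotheses (mA : lebesgue_measurable A) (AD : A `<=` D).
Hypothesis Dfin : (vol D < +oo)%E.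

Definition near_pairs : set T := [set p | enorm ((p.2 : V) - (p.1 : V)) < L].

(** Density of the transport plan from [A] to the points of [D] outside [E]. The normalisation
    refers to the ball in [C], so a source sends out at most its unit mass. *)
Definition weight (p : T) : R :=
  wt C L p.1 * \1_A p.1 * \1_(D `\` E) p.2 * \1_near_pairs p.

Definition path (t : R) (p : T) : V := (p.1 : V) + t *: ((p.2 : V) - (p.1 : V)).

Lemma weight_ge0 p : 0 <= weight p.
Proof. by rewrite !mulr_ge0 // wt_ge0. Qed.

Lemma weight_eq0 p : ~ (A p.1 /\ (D `\` E) p.2 /\ near_pairs p) -> weight p = 0.
Proof.
move=> H; rewrite /weight !indicE.
have [Ax|nAx] := pselect (A p.1); last by rewrite (memNset nAx) mulr0 !mul0r.
have [Ay|nAy] := pselect ((D `\` E) p.2); last by rewrite (memNset nAy) mulr0 !mul0r.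
have [Nxy|nN] := pselect (near_pairs p); last by rewrite (memNset nN) mulr0.
by exfalso; exact: H.
Qed.

Lemma vmeas_fst : vmeas (fun p : T => p.1 : V).
Proof. exact: vmeas_comp measurable_fst. Qed.

Lemma vmeas_snd : vmeas (fun p : T => p.2 : V).
Proof. exact: vmeas_comp measurable_snd. Qed.

Lemma vmeas_path t : vmeas (path t).
Proof.
apply: vmeasD; first exact: vmeas_fst.
by apply: vmeasZ; apply: vmeasB; [exact: vmeas_snd|exact: vmeas_fst].
Qed.

Lemma measurable_near_pairs : measurable near_pairs.
Proof. by apply: measurable_enorm_lt; apply: vmeasB; [exact: vmeas_snd|exact: vmeas_fst]. Qed.

Lemma measurable_weight : measurable_fun setT weight.
Proof.
have m1 := @measurable_fst _ _ VM VM; have m2 := @measurable_snd _ _ VM VM.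
have mB : lebesgue_measurable (D `\` E) by exact: (measurableD mD mE).
suff : measurable_fun setT (fun p : T => weight p) by [].
rewrite /weight; apply: measurable_funM; last exact: (measurable_indic measurable_near_pairs).
apply: measurable_funM; last first.
  exact: (measurableT_comp (measurable_indic (mB : measurable ((D `\` E) : set VM))) m2).
apply: measurable_funM; last first.
  exact: (measurableT_comp (measurable_indic (mA : measurable (A : set VM))) m1).
exact: (measurableT_comp (measurable_wt L mC) m1).
Qed.

Lemma weight_le p : weight p <= b0^-1 * \1_(A `*` (D `\` E)) p.
Proof.
have [[Ax [By Nxy]]|H] := pselect (A p.1 /\ (D `\` E) p.2 /\ near_pairs p); last first.
  by rewrite weight_eq0 // mulr_ge0 // invr_ge0 ltW.
rewrite /weight !indicE !mem_set //= !mulr1.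
exact: (wt_le b00 Hb (DC (AD Ax))).
Qed.

Let mAB : measurable (A `*` (D `\` E) : set T).
Proof.
have mB : lebesgue_measurable (D `\` E) by exact: (measurableD mD mE).
exact: (measurableX (mA : measurable (A : set VM)) (mB : measurable ((D `\` E) : set VM))).
Qed.

Let ABfin : (vol2 (A `*` (D `\` E)) < +oo)%E.
Proof.
have mB : lebesgue_measurable (D `\` E) by exact: (measurableD mD mE).
have -> : (vol2 (A `*` (D `\` E)) = vol A * vol (D `\` E))%E.
  exact: (product_measure1E vol vol (mA : measurable (A : set VM)) (mB : measurable ((D `\` E) : set VM))).
apply: lte_mul_pinfty; first exact: vol_ge0.
  rewrite ge0_fin_numE ?vol_ge0 //; apply: le_lt_trans Dfin; exact: le_vol.
by apply: le_lt_trans Dfin; apply: le_vol; exact: subDsetl.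
Qed.

Lemma integrable_weight_mul (h : T -> R) (M : R) : measurable_fun setT h ->
  (forall p, near_pairs p -> `|h p| <= M) ->
  vol2.-integrable setT (EFin \o (fun p => weight p * h p)).
Proof.
move=> mh hM.
apply: (@integrable_le_indic _ _ _ vol2 _ (A `*` (D `\` E)) (b0^-1 * `|M|)).
- exact: (measurable_funM measurable_weight mh).
- exact: mAB.
- exact: ABfin.
- move=> p; have [Np|nN] := pselect (near_pairs p); last first.
    by rewrite weight_eq0 => [|[_ []]//]; rewrite mul0r normr0 !mulr_ge0 // invr_ge0 ltW.
  rewrite normrM (ger0_norm (weight_ge0 p)) [leRHS]mulrAC.
  apply: ler_pM; [exact: weight_ge0|exact: normr_ge0|exact: weight_le|].
  by apply: (le_trans (hM p Np)); exact: ler_norm.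
Qed.

Lemma integrable_weight : vol2.-integrable setT (EFin \o weight).
Proof.
have -> : weight = (fun p => weight p * 1) by apply/funext => p; rewrite mulr1.
apply: (@integrable_weight_mul _ 1); first exact: measurable_cst.
by move=> p _; rewrite normr1.
Qed.

Lemma pathE t x y : path t (x, y) = (1 - t) *: x + t *: y.
Proof. by rewrite /path /= scalerBr scalerBl scale1r addrA addrAC. Qed.

Lemma weightE x y : A x -> (D `\` E) y -> near_pairs (x, y) ->
  weight (x, y) = wt C L x.
Proof. by move=> Ax By Nxy; rewrite /weight !indicE !mem_set //= !mulr1. Qed.

Lemma kernE w x z : C x -> D z -> enorm (z - x) < L ->
  kern C D L eps w (x, z) = 2 ^+ n.+1 * wt C L z * moll eps (z - w).
Proof. by move=> Cx Dz zx; rewrite /kern !indicE !mem_set //= !mulr1 mul1r. Qed.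

(** The intermediate point lies in [D] by convexity and within L of [x], so doubling replaces the
    weight at [x] by the weight at that point. *)
Lemma weight_kern_fst t w x y : 0 <= t <= 1 ->
  weight (x, y) * moll eps (path t (x, y) - w) <= kern C D L eps w (x, (1 - t) *: x + t *: y).
Proof.
move=> t01; have [[Ax [By Nxy]]|H] := pselect (A x /\ (D `\` E) y /\ near_pairs (x, y)); last first.
  by rewrite weight_eq0 // mul0r kern_ge0.
have xyL : enorm (y - x) < L by exact: Nxy.
rewrite -pathE; set z := path t (x, y).
have Dz : D z by apply: cD => //; [exact: AD|case: By].
have zx : enorm (z - x) < L.
  case/andP: t01 => t0 t1; rewrite /z /path /= addrC addKr enormZ ger0_norm //.
  by rewrite (le_lt_trans _ xyL) // ler_piMl // enorm_ge0.
rewrite (weightE Ax By Nxy) (kernE _ (DC (AD Ax)) Dz zx) ler_wpM2r ?moll_ge0 //.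
by apply: (wt_doubling cC L0 b00 Hb) => //; [exact/DC/AD|exact: DC|exact: ltW].
Qed.

(** The remaining endpoint is now [y], but the weight still belongs to [x]: doubling compares [x]
    with the intermediate point, while the kernel requires that point to be within L of [y]. *)
Lemma weight_kern_snd t w x y : 0 <= t <= 1 ->
  weight (x, y) * moll eps (path t (x, y) - w) <= kern C D L eps w (y, (1 - t) *: x + t *: y).
Proof.
move=> t01; have [[Ax [By Nxy]]|H] := pselect (A x /\ (D `\` E) y /\ near_pairs (x, y)); last first.
  by rewrite weight_eq0 // mul0r kern_ge0.
have xyL : enorm (y - x) < L by exact: Nxy.
rewrite -pathE; set z := path t (x, y).
have Dy : D y by case: By.
have Dz : D z by apply: cD => //; exact: AD.
have zx : enorm (z - x) < L.
  case/andP: t01 => t0 t1; rewrite /z /path /= addrC addKr enormZ ger0_norm //.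
  by rewrite (le_lt_trans _ xyL) // ler_piMl // enorm_ge0.
have zy : enorm (z - y) < L.
  case/andP: t01 => t0 t1.
  have -> : z - y = (1 - t) *: (x - y).
    by rewrite /z pathE scalerBr -addrA; congr (_ + _); rewrite scalerBl scale1r opprB.
  rewrite enormZ ger0_norm ?subr_ge0 // enormB (le_lt_trans _ xyL) //.
  by rewrite ler_piMl ?enorm_ge0 // gerBl.
rewrite (weightE Ax By Nxy) (kernE _ (DC Dy) Dz zy) ler_wpM2r ?moll_ge0 //.
by apply: (wt_doubling cC L0 b00 Hb) => //; [exact/DC/AD|exact: DC|exact: ltW].
Qed.

Lemma integrable_weight_moll t w :
  vol2.-integrable setT (EFin \o (fun p => weight p * moll eps (path t p - w))).
Proof.
apply: (@integrable_weight_mul _ 1).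
  by apply: measurable_moll; apply: vmeasB; [exact: vmeas_path|exact: vmeas_cst].
by move=> p _; rewrite ger0_norm ?moll_ge0 ?moll_le1.
Qed.

Lemma pint_weight_moll_le t w : 0 <= t <= 1 ->
  pint vol2 weight (path t) (moll eps) w <= 4 ^+ n.+1 * @mass R n eps.
Proof.
move=> t01; rewrite /pint.
pose f (p : T) := weight p * moll eps (path t p - w).
have intf : vol2.-integrable setT (EFin \o f) := integrable_weight_moll t w.
have mf : measurable_fun setT f by apply/measurable_EFinP; case/integrableP: intf.
have f0 p : 0 <= f p by rewrite mulr_ge0 ?weight_ge0 ?moll_ge0.
have mEf : measurable_fun setT (EFin \o f) by exact/measurable_EFinP.
have Ef0 p : (0 <= (EFin \o f) p)%E by rewrite lee_fin.
rewrite -lee_fin -(EFin_Rintegral measurableT intf).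
(* For t >= 1/2 the point is closer to [y], which is integrated first; otherwise the endpoints are
   swapped and [t] becomes 1 - t. *)
have [t2|t2] := leP (1 / 2) t.
  rewrite (@fubini_tonelli1 _ _ _ _ _ vol vol (EFin \o f) mEf Ef0).
  apply: (@convolution_le_half _ _ C D L b0 eps mC mD DC b00 Hb eps0 f t w mf f0).
    by rewrite t2; case/andP: t01.
  by move=> x y; exact: weight_kern_fst.
rewrite (@fubini_tonelli2 _ _ _ _ _ vol vol (EFin \o f) mEf Ef0).
have msw : measurable_fun setT (f \o (fun p : T => (p.2, p.1))).
  exact: (measurableT_comp mf (@measurable_swap _ _ VM VM)).
apply: (@convolution_le_half _ _ C D L b0 eps mC mD DC b00 Hb eps0 (f \o (fun p : T => (p.2, p.1))) (1 - t) w msw).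
- by move=> p; exact: f0.
- by case/andP: t01 => t0 t1; apply/andP; split; lra.
- move=> y x /=; rewrite opprB addrCA subrr addr0 addrC; exact: weight_kern_snd.
Qed.

Hypothesis mass0 : 0 < @mass R n eps.

Definition flow_scale : R := (L * (4 ^+ n.+1 * @mass R n eps))^-1.

Let scale0 : 0 < flow_scale.
Proof. by rewrite invr_gt0 !mulr_gt0 // exprn_gt0. Qed.

Definition flow_weight (i : 'I_n.+1) (p : T) : R :=
  weight p * (flow_scale * ((p.2 : V) - (p.1 : V)) 0 i).

Lemma integrable_flow_weight i : vol2.-integrable setT (EFin \o flow_weight i).
Proof.
apply: (@integrable_weight_mul _ (flow_scale * L)).
  apply: (measurable_funM (measurable_cst flow_scale)).
  exact: (vmeasB vmeas_snd vmeas_fst i).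
move=> p Np; rewrite normrM (gtr0_norm scale0) ler_pM2l //.
by rewrite (le_trans (coord_le_enorm _ i)) // ltW.
Qed.

(* The mollified momentum of the mass [weight (x, y)] that moves from [x] to [y]
   along the segment at unit time, rescaled to have length at most 1. *)
Definition flow (t : R) (w : V) : V :=
  \row_i pint vol2 (flow_weight i) (path t) (moll eps) w.

(** Pairing the field with its own value [X] at [w] gives |X|^2 as one integral, where
    Cauchy-Schwarz bounds X.(y - x) by |X| L; divide by |X|. Bounding the coordinates separately
    would lose a dimensional factor. *)
Lemma enorm_flow_le1 t w : 0 <= t <= 1 -> enorm (flow t w) <= 1.
Proof.
move=> t01; set X := flow t w.
have [X0|X0] := eqVneq (enorm X) 0; first by rewrite X0.
have Xp : 0 < enorm X by rewrite lt_neqAle eq_sym X0 enorm_ge0.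
have iw := integrable_weight_moll t w.
have ifl i : vol2.-integrable setT
    (EFin \o (fun p => X 0 i * (flow_weight i p * moll eps (path t p - w)))).
  exact: (integrableZl measurableT (X 0 i)
    (integrable_bump_mul (vmeas_path t) w (integrable_flow_weight i) (bump_moll eps))).
have XE : enorm X ^+ 2 = \int[vol2]_p (\sum_i X 0 i * (flow_weight i p * moll eps (path t p - w))).
  rewrite (Rintegral_sum ifl) enorm_sqr; apply: eq_bigr => i _.
  rewrite RintegralZl //; first by rewrite {2}/X mxE.
  exact: (integrable_bump_mul (vmeas_path t) w (integrable_flow_weight i) (bump_moll eps)).
have bound : enorm X ^+ 2 <= (flow_scale * enorm X * L) * (4 ^+ n.+1 * @mass R n eps).
  rewrite XE; apply: (@le_trans _ _ (\int[vol2]_p ((flow_scale * enorm X * L) *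
      (weight p * moll eps (path t p - w))))).
    apply: le_Rintegral; first exact: measurableT.
    - exact: (integrable_sum_EFin ifl).
    - exact: (integrableZl measurableT _ iw).
    move=> p _.
    have -> : \sum_i X 0 i * (flow_weight i p * moll eps (path t p - w)) =
        dotp X ((p.2 : V) - (p.1 : V)) * (flow_scale * (weight p * moll eps (path t p - w))).
      by rewrite mulr_suml; apply: eq_bigr => i _; rewrite /flow_weight; ring.
    have [Np|nN] := pselect (near_pairs p); last first.
      by rewrite weight_eq0 => [|[_ []]//]; rewrite mul0r !mulr0.
    have -> : flow_scale * enorm X * L * (weight p * moll eps (path t p - w)) =
        (enorm X * L) * (flow_scale * (weight p * moll eps (path t p - w))) by ring.
    rewrite ler_wpM2r //.
      by apply: mulr_ge0; [exact: ltW|apply: mulr_ge0; [exact: weight_ge0|exact: moll_ge0]].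
    by rewrite (le_trans (dotp_le_enorm _ _)) // ler_wpM2l ?enorm_ge0 // ltW.
  rewrite RintegralZl // ler_wpM2l //; last exact: pint_weight_moll_le.
  by rewrite !mulr_ge0 ?enorm_ge0 ?(ltW scale0) ?(ltW L0).
have bE : (flow_scale * enorm X * L) * (4 ^+ n.+1 * @mass R n eps) = enorm X.
  have z0 : L * (4 ^+ n.+1 * @mass R n eps) != 0 by rewrite -invr_eq0 gt_eqF.
  have -> : flow_scale * enorm X * L * (4 ^+ n.+1 * @mass R n eps) =
      enorm X * (flow_scale * (L * (4 ^+ n.+1 * @mass R n eps))) by ring.
  by rewrite /flow_scale mulVf // mulr1.
move: bound; rewrite bE expr2 => H.
by rewrite -(ler_pM2l Xp) mulr1.
Qed.

Lemma flow_smooth t : smooth_field (flow t).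
Proof.
move=> i k; have -> : (fun x => flow t x 0 i) =
    pint vol2 (flow_weight i) (path t) (moll eps) by apply/funext => x; rewrite mxE.
exact: (pint_Ck (integrable_flow_weight i) (vmeas_path t) k (bump_moll eps)).
Qed.

(** Paths stay in the convex set [D], and the mollifier reaches less than [eps] beyond it. *)
Lemma flow_neq0 t w : 0 <= t <= 1 -> flow t w != 0 -> exists2 z, D z & enorm (z - w) < eps.
Proof.
move=> t01; apply: contra_neqP => H; apply/rowP => i; rewrite !mxE /pint.
transitivity (\int[vol2]_(p in setT) (0 : R)); last by rewrite Rintegral_cst // mul0r.
apply: eq_Rintegral => p _; rewrite /flow_weight.
have [[Ax [[Dy _] _]]|nW] := pselect (A p.1 /\ (D `\` E) p.2 /\ near_pairs p); last first.
  by rewrite weight_eq0 // !mul0r.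
rewrite moll_eq0 ?mulr0 ?(ltW eps0) // leNgt; apply/negP => zw; apply: H.
by exists (path t p) => //; apply: cD => //; exact: AD.
Qed.

Variables (a0 : V) (M eps1 : R).
Hypotheses (Dbd : D `<=` eball a0 M) (eps1_gt : eps < eps1).
Hypothesis (Dnbh : forall z, D z -> eball z eps1 `<=` C).

Lemma flow_support t : 0 <= t <= 1 ->
  compact (field_support (flow t)) /\ field_support (flow t) `<=` C°.
Proof.
(* One [r] pays for the closure in the support, the other for a neighbourhood inside [C]: eps + 2 r
   = eps1. *)
move=> t01; pose r := (eps1 - eps) / 2.
have r0 : 0 < r by rewrite divr_gt0 // subr_gt0.
have near_D w : field_support (flow t) w -> exists2 z, D z & enorm (z - w) < eps + r.
  move=> Kw; have : nbhs w (eball w r) by apply/nbhs_eballP; exists r.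
  move=> /Kw[u [/= fu uw]]; have [z Dz zu] := flow_neq0 t01 fu.
  by exists z => //; rewrite (le_lt_trans (enorm_triangle u _ _)) // ltrD.
split.
  apply: bounded_closed_compact; last exact: closed_closure.
  exists (enorm a0 + M + eps + r); split; first exact: num_real.
  move=> K /ltW HK w /near_D[z Dz zw].
  have wK : enorm w <= K.
    apply: (le_trans _ HK).
    have -> : w = a0 + (z - a0) - (z - w) by rewrite [a0 + _]addrC subrK subKr.
    rewrite (le_trans (enormD _ _)) // enormN -(addrA (enorm a0 + M)) lerD ?(ltW zw) //.
    by rewrite (le_trans (enormD _ _)) // lerD // ltW // Dbd.
  suff H1 : mx_norm w <= K by exact: H1.
  rewrite mx_normrE; apply: bigmax_le; first exact: le_trans (enorm_ge0 _) wK.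
  by move=> [i j] _ /=; rewrite (ord1 i) (le_trans (coord_le_enorm _ _)).
move=> w /near_D[z Dz zw]; apply/nbhs_eballP; exists r => // u uw; apply: (Dnbh Dz).
rewrite /eball /= (le_lt_trans (enorm_triangle w _ _)) //.
have : enorm (w - z) < eps + r by rewrite enormB.
have : enorm (u - w) < r by exact: uw.
rewrite /r; lra.
Qed.

Lemma flow_test_field t : 0 <= t <= 1 -> perimeter_test_field C (flow t).
Proof.
move=> t01; have [K1 K2] := flow_support t01.
by split => //; [exact: flow_smooth|move=> x; exact: enorm_flow_le1].
Qed.

(* The null summand matches the constructor [bump_lin]. *)
Definition radial_slope (z : V) : R :=
  (-2) * flat 2 (eps ^+ 2 - dotp z z) + 0 * flat 2 (eps ^+ 2 - dotp z z).

Lemma bump_radial_slope : bump (eps ^+ 2) radial_slope.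
Proof. by apply: bump_lin; exact: bump_flat. Qed.

Lemma is_derive_moll z u : is_derive z u (moll eps) (dotp z u * radial_slope z).
Proof.
have df : is_derive z u (fun y : V => eps ^+ 2 - dotp y y) (- (2 * dotp z u)).
  have := is_deriveB (is_derive_cst (eps ^+ 2) z u) (is_derive_dotpp z u).
  by rewrite sub0r.
apply: (is_derive_eq (is_derive_comp_real df (is_derive_flat 0 _))).
by rewrite /radial_slope; ring.
Qed.

(** The mollified density at time [t] of the moving mass. *)
Definition transported (t : R) (w : V) : R := pint vol2 weight (path t) (moll eps) w.

Definition transported_rate (t : R) (w : V) : R := \int[vol2]_p
  (weight p * (dotp (path t p - w) ((p.2 : V) - (p.1 : V)) * radial_slope (path t p - w))).

Let rate_bound : exists2 K, 0 <= K & forall t w p, near_pairs p ->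
  `|dotp (path t p - w) ((p.2 : V) - (p.1 : V)) * radial_slope (path t p - w)| <= K.
Proof.
have [K HK] := bump_bounded bump_radial_slope.
have K0 : 0 <= K by exact: le_trans (HK 0).
(* The slope of the mollifier vanishes at distance [eps], so only |path t p - w| < eps counts. *)
exists (eps * L * K); first by rewrite !mulr_ge0 ?(ltW eps0) ?(ltW L0).
move=> t w p Np; rewrite normrM.
have [ez|ze] := leP eps (enorm (path t p - w)).
  rewrite (bump_eq0 bump_radial_slope) ?normr0 ?mulr0 ?mulr_ge0 ?(ltW eps0) ?(ltW L0) //.
  by rewrite -enorm_sqr ler_pXn2r // nnegrE ?enorm_ge0 // ltW.
apply: ler_pM => //; apply: (le_trans (normr_dotp _ _)).
by apply: ler_pM; rewrite ?enorm_ge0 //; [exact: ltW|exact: ltW].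
Qed.

Let integrable_rate t w : vol2.-integrable setT (EFin \o (fun p =>
  weight p * (dotp (path t p - w) ((p.2 : V) - (p.1 : V)) * radial_slope (path t p - w)))).
Proof.
have [K K0 HK] := rate_bound; apply: (@integrable_weight_mul _ K); last by move=> p; exact: HK.
have mp : vmeas (fun p : T => path t p - w) := vmeasB (vmeas_path t) (vmeas_cst w).
apply: measurable_funM; last exact: (measurable_bump bump_radial_slope mp).
exact: (vmeas_dotp mp (vmeasB vmeas_snd vmeas_fst)).
Qed.

Lemma is_derive_transported (t : R) w :
  is_derive t 1 (fun s => transported s w) (transported_rate t w).
Proof.
have [K K0 HK] := rate_bound.
apply: (@is_derive_integral _ _ _ vol2 setT (fun s p => weight p * moll eps (path s p - w))
  (fun s p => weight p * (dotp (path s p - w) ((p.2 : V) - (p.1 : V)) * radial_slope (path s p - w)))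
  (fun p => K * weight p)).
- exact: measurableT.
- by move=> s; exact: integrable_weight_moll.
- move=> s p _.
  have E1 (k : R) : k *: ((p.2 : V) - (p.1 : V)) + ((p.1 : V) - w) = path k p - w.
    by rewrite /path addrCA addrA.
  have := is_derive_moll (path s p - w) ((p.2 : V) - (p.1 : V)); rewrite -{1}E1.
  move=> /is_derive_along_line /(is_deriveZ (weight p)).
  congr (is_derive _ _ _ _).
  by apply/funext => k /=; rewrite E1.
- move=> s p _; rewrite normrM (ger0_norm (weight_ge0 p)) mulrC.
  have [Np|nN] := pselect (near_pairs p); last first.
    by rewrite weight_eq0 => [|[_ []]//]; rewrite !mulr0.
  by rewrite ler_wpM2r ?weight_ge0 // HK.
- by move=> p; rewrite mulr_ge0 ?weight_ge0.
- exact: (integrableZl measurableT K integrable_weight).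
Qed.

(** The continuity equation: time acts on the argument of the mollifier through the velocity y - x,
    space through -w, so both derivatives are the same integral up to sign and scale. *)
Lemma divergence_flow t w : divergence (flow t) w = - (flow_scale * transported_rate t w).
Proof.
rewrite /divergence /transported_rate.
pose S i (p : T) := flow_weight i p * ((path t p - w) 0 i * radial_slope (path t p - w)).
have iS i : vol2.-integrable setT (EFin \o S i).
  exact: (integrable_bump_mul (vmeas_path t) w (integrable_flow_weight i)
    (bump_coord i bump_radial_slope)).
have pE i : partial i (fun y => flow t y 0 i) w = - \int[vol2]_p S i p.
  rewrite /partial; have -> : (fun y => flow t y 0 i) =
    pint vol2 (flow_weight i) (path t) (moll eps) by apply/funext => x; rewrite mxE.
  have dq z : is_derive z (basis_vec i) (moll eps) (z 0 i * radial_slope z).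
    by have := is_derive_moll z (basis_vec i); rewrite dotpC dotp_basis_vec.
  have [_ ->] := is_derive_pint (integrable_flow_weight i) (vmeas_path t) (bump_moll eps)
    (bump_coord i bump_radial_slope) dq w.
  by [].
under eq_bigr do rewrite pE.
rewrite sumrN -Rintegral_sum // -RintegralZl //; congr (- _).
apply: eq_Rintegral => p _.
rewrite /S /dotp mulr_suml mulr_sumr mulr_sumr; apply: eq_bigr => i _.
by rewrite /flow_weight; ring.
Qed.

Definition total (t : R) : R := \int[vol]_(w in E) transported t w.

Lemma is_derive_total (t : R) :
  is_derive t 1 total (\int[vol]_(w in E) transported_rate t w).
Proof.
have [K K0 HK] := rate_bound.
have Efin : (vol E < +oo)%E by rewrite vE ltry.
apply: (@is_derive_integral _ _ _ vol E transported transported_rate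
  (fun=> K * \int[vol2]_p weight p)).
- exact: mE.
- move=> s; have [B HB] := pint_bounded integrable_weight (vmeas_path s) (bump_moll eps).
  apply: (integrable_bounded_on mE Efin _ HB); apply: continuous_measurable_vec.
  exact: (pint_continuous integrable_weight (vmeas_path s) (bump_moll eps)).
- by move=> s w _; exact: is_derive_transported.
- move=> s w _; apply: (le_trans (le_normr_Rintegral measurableT (integrable_rate s w))).
  rewrite -(RintegralZl _ measurableT integrable_weight).
  apply: le_Rintegral.
  + exact: measurableT.
  + by apply: integrable_norm; exact: integrable_rate.
  + exact: (integrableZl measurableT K integrable_weight).
  move=> p _; rewrite normrM (ger0_norm (weight_ge0 p)) mulrC.
  have [Np|nN] := pselect (near_pairs p); last first.
    by rewrite weight_eq0 => [|[_ []]//]; rewrite !mulr0.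
  by rewrite ler_wpM2r ?weight_ge0 // HK.
- move=> w; apply: mulr_ge0 => //; apply: Rintegral_ge0 => p _; exact: weight_ge0.
- apply: (integrable_bounded_on mE Efin (M := `|K * \int[vol2]_p weight p|)) => //.
Qed.

(* The derivative of [total] is minus the flux of the flow field, so the mean
   value theorem produces one admissible field with the required flux. *)
Lemma total_drop_le_perimeter :
  ((flow_scale * (total 0 - total 1))%:E <= relative_perimeter C E)%E.
Proof.
have cT : {within `[0, 1], continuous total}.
  by apply: derivable_within_continuous => t _; have [] := is_derive_total t.
have [c c01 cE] := MVT (@ltr01 R) (fun t _ => is_derive_total t) cT.
have c01' : 0 <= c <= 1 by move: c01; rewrite in_itv /= => /andP[/ltW -> /ltW ->].
have tf := flow_test_field c01'.
have [K K0 HK] := divergence_bounded tf.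
have Efin : (vol E < +oo)%E by rewrite vE ltry.
have intd : vol.-integrable E (EFin \o divergence (flow c)).
  exact: (integrable_bounded_on mE Efin (divergence_continuous_sum tf) HK).
have -> : flow_scale * (total 0 - total 1) = \int[vol]_(w in E) divergence (flow c) w.
  have rE : \int[vol]_(w in E) transported_rate c w =
      - flow_scale^-1 * \int[vol]_(w in E) divergence (flow c) w.
    rewrite -RintegralZl //; apply: eq_Rintegral => w _.
    by rewrite divergence_flow mulrN mulNr opprK mulrA mulVf ?mul1r // gt_eqF.
  have -> : total 0 - total 1 = flow_scale^-1 * \int[vol]_(w in E) divergence (flow c) w.
    by rewrite -opprB cE subr0 mulr1 rE mulNr opprK.
  by rewrite mulrA divff ?mul1r // gt_eqF.
rewrite -EFin_Rintegral //; apply: ereal_sup_ubound; exists (flow c) => //.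
Qed.

End flow_field.

(** * Nonnegative integrals with respect to volume *)

Section volume_integrals.
Context {R : realType} {n : nat}.
Local Notation V := 'rV[R]_n.+1.
Local Notation leb := (@lebesgue_outer R n).
Local Notation vol := (@lebesgueV R n).
Local Notation VM := (caratheodory_type leb).
Implicit Types (A B : set V) (f g : VM -> R).

Lemma volU A B : (vol (A `|` B) <= vol A + vol B)%E.
Proof. exact: (outer_measureU2 (lebesgue_outer : {outer_measure set V -> \bar R})). Qed.

Lemma measurable_indic_vec A : lebesgue_measurable A ->
  measurable_fun setT (\1_A : VM -> R).
Proof. by move=> mA; exact: (measurable_indic (mA : measurable (A : set VM))). Qed.

Lemma ge0_integralZl_vec f (k : R) : measurable_fun setT f -> (forall x, 0 <= f x) -> 0 <= k ->
  (\int[vol]_x (k * f x)%:E = k%:E * \int[vol]_x (f x)%:E)%E.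
Proof.
move=> mf f0 k0; have mEf : measurable_fun setT (EFin \o f) by exact/measurable_EFinP.
transitivity (\int[vol]_x (k%:E * (EFin \o f) x))%E.
  by apply: eq_integral => x _; rewrite EFinM.
rewrite (ge0_integralZl vol measurableT mEf); last 2 first.
- by move=> x _; rewrite lee_fin.
- by rewrite lee_fin.
by [].
Qed.

Lemma integral_indic_vol B : lebesgue_measurable B ->
  (\int[vol]_x (\1_B x)%:E = vol B)%E.
Proof. by move=> mB'; rewrite integral_indic // setIT. Qed.

Lemma ge0_integralZl_indic_vol B (k : R) : lebesgue_measurable B -> 0 <= k ->
  (\int[vol]_x (k * \1_B x)%:E = k%:E * vol B)%E.
Proof.
move=> mB k0; rewrite -(integral_indic_vol mB).
exact: (ge0_integralZl_vec (measurable_indic_vec mB)).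
Qed.

Lemma le_integral_vol f g : measurable_fun setT f -> measurable_fun setT g ->
  (forall x, 0 <= f x) -> (forall x, f x <= g x) ->
  (\int[vol]_x (f x)%:E <= \int[vol]_x (g x)%:E)%E.
Proof.
move=> mf mg f0 fg; apply: ge0_le_integral.
- exact: measurableT.
- by move=> x _; rewrite lee_fin.
- exact/measurable_EFinP.
- exact/measurable_EFinP.
- by move=> x _; rewrite lee_fin.
Qed.

End volume_integrals.

(** * Mollified densities and their leak between two sets *)

Section smear.
Context {R : realType} {n : nat}.
Local Notation V := 'rV[R]_n.+1.
Local Notation leb := (@lebesgue_outer R n).
Local Notation vol := (@lebesgueV R n).
Local Notation VM := (caratheodory_type leb).
Local Notation T := (VM * VM)%type.
Variable eps : R.
Hypothesis eps0 : 0 < eps.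
Local Notation mass := (@mass R n eps).
Implicit Types (A B : set V) (f g : VM -> R).

Definition smear f (w : V) : \bar R := (\int[vol]_x (f x * moll eps ((x : V) - w))%:E)%E.

Let smear2 f (p : T) : R := f p.2 * moll eps ((p.2 : V) - (p.1 : V)).

Let measurable_smear2 f : measurable_fun setT f -> measurable_fun setT (EFin \o smear2 f).
Proof.
move=> mf; apply/measurable_EFinP.
have m1 := @measurable_fst _ _ VM VM; have m2 := @measurable_snd _ _ VM VM.
apply: (measurable_funM (measurableT_comp mf m2)).
exact: (measurable_moll eps (vmeasB (vmeas_comp m2) (vmeas_comp m1))).
Qed.

Let smear2_ge0 f : (forall x, 0 <= f x) -> forall p, (0 <= (EFin \o smear2 f) p)%E.
Proof. by move=> f0 p; rewrite lee_fin mulr_ge0 // moll_ge0. Qed.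

Let measurable_smear1 f w : measurable_fun setT f ->
  measurable_fun setT (fun x : VM => f x * moll eps ((x : V) - w)).
Proof.
move=> mf; apply: (measurable_funM mf).
exact: (measurable_moll eps (vmeasB vmeas_id (vmeas_cst w))).
Qed.

Lemma measurable_smear f : measurable_fun setT f -> (forall x, 0 <= f x) ->
  measurable_fun setT (smear f : VM -> \bar R).
Proof.
move=> mf f0.
exact: (measurable_fun_fubini_tonelli_F (EFin \o smear2 f) (measurable_smear2 mf) (smear2_ge0 f0)).
Qed.

Lemma smear_ge0 f w : (forall x, 0 <= f x) -> (0 <= smear f w)%E.
Proof. by move=> f0; apply: integral_ge0 => x _; rewrite lee_fin mulr_ge0 // moll_ge0. Qed.

Lemma le_smear f g w : measurable_fun setT f -> measurable_fun setT g ->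
  (forall x, 0 <= f x) -> (forall x, f x <= g x) -> (smear f w <= smear g w)%E.
Proof.
move=> mf mg f0 fg; apply: le_integral_vol.
- exact: measurable_smear1.
- exact: measurable_smear1.
- by move=> x; rewrite mulr_ge0 // moll_ge0.
- by move=> x; rewrite ler_wpM2r // moll_ge0.
Qed.

Lemma smearZ f (k : R) w : measurable_fun setT f -> (forall x, 0 <= f x) -> 0 <= k ->
  smear (fun x => k * f x) w = (k%:E * smear f w)%E.
Proof.
move=> mf f0 k0.
have g0 x : 0 <= f x * moll eps ((x : V) - w) by rewrite mulr_ge0 // moll_ge0.
rewrite -(ge0_integralZl_vec (measurable_smear1 w mf) g0 k0).
by apply: eq_integral => x _; rewrite mulrA.
Qed.

Lemma smearD f g w : measurable_fun setT f -> measurable_fun setT g ->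
  (forall x, 0 <= f x) -> (forall x, 0 <= g x) ->
  smear (fun x => f x + g x) w = (smear f w + smear g w)%E.
Proof.
move=> mf mg f0 g0; rewrite /smear -ge0_integralD.
- by apply: eq_integral => x _; rewrite mulrDl EFinD.
- exact: measurableT.
- by move=> x _; rewrite lee_fin mulr_ge0 // moll_ge0.
- by apply/measurable_EFinP; exact: measurable_smear1.
- by move=> x _; rewrite lee_fin mulr_ge0 // moll_ge0.
- by apply/measurable_EFinP; exact: measurable_smear1.
Qed.

(** Tonelli: every point contributes the full integral of the mollifier. *)
Lemma integral_smear f : measurable_fun setT f -> (forall x, 0 <= f x) ->
  (\int[vol]_w smear f w = mass%:E * \int[vol]_x (f x)%:E)%E.
Proof.
move=> mf f0.
have m0 : 0 <= mass.
  rewrite -lee_fin -(integral_moll 0 eps0); apply: integral_ge0 => x _.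
  by rewrite lee_fin moll_ge0.
rewrite -(ge0_integralZl_vec mf f0 m0).
rewrite [LHS](@fubini_tonelli _ _ _ _ _ vol vol (EFin \o smear2 f) (measurable_smear2 mf) (smear2_ge0 f0)).
apply: eq_integral => x _.
transitivity (\int[vol]_w (f x * moll eps ((w : V) - x))%:E)%E.
  by apply: eq_integral => w _; rewrite /= /smear2 /= moll_sym.
have mx : measurable_fun setT (fun w : VM => moll eps ((w : V) - x)).
  exact: (measurable_moll eps (vmeasB vmeas_id (vmeas_cst x))).
rewrite (ge0_integralZl_vec mx (fun=> moll_ge0 _ _) (f0 x)).
by rewrite integral_moll // -EFinM mulrC.
Qed.

(** The amount of the mollified indicator of [B] that falls into [A]. *)
Definition leak A B : \bar R := (\int[vol]_(w in A) smear (\1_B) w)%E.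

Lemma leakE A B :
  leak A B = (\int[vol]_w \int[vol]_x (\1_A w * (\1_B x * moll eps ((x : V) - (w : V))))%:E)%E.
Proof.
rewrite /leak integral_mkcond; apply: eq_integral => w _; rewrite patchE.
case: ifPn => [wA|/negP wA].
  have Aw : (\1_A : VM -> R) w = 1 by rewrite indicE mem_set //; exact: (set_mem wA).
  by apply: eq_integral => x _; rewrite Aw mul1r.
have Aw : (\1_A : VM -> R) w = 0.
  by rewrite indicE memNset // => Aw; apply: wA; exact: (mem_set Aw).
by rewrite integral0_eq // => x _; rewrite Aw mul0r.
Qed.

(** The mollifier is even; exchange the order of integration. *)
Lemma leak_sym A B : lebesgue_measurable A -> lebesgue_measurable B -> leak A B = leak B A.
Proof.
move=> mA mB; rewrite !leakE.
pose h (p : T) := (\1_A : VM -> R) p.1 * smear2 (\1_B) p.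
have m1 := @measurable_fst _ _ VM VM.
have mh : measurable_fun setT (EFin \o h).
  apply/measurable_EFinP; apply: (measurable_funM (measurableT_comp (measurable_indic_vec mA) m1)).
  by apply/measurable_EFinP; exact: (measurable_smear2 (measurable_indic_vec mB)).
have h0 p : (0 <= (EFin \o h) p)%E.
  by rewrite lee_fin mulr_ge0 // /smear2 mulr_ge0 // moll_ge0.
rewrite [LHS](@fubini_tonelli _ _ _ _ _ vol vol (EFin \o h) mh h0).
apply: eq_integral => x _; apply: eq_integral => w _.
by rewrite /= /h /smear2 /= moll_sym mulrCA.
Qed.

Let measurable_smear_indic A B : lebesgue_measurable B ->
  measurable_fun (A : set VM) (smear \1_B : VM -> \bar R).
Proof.
move=> mB; apply: measurable_funTS.
exact: (measurable_smear (measurable_indic_vec mB) (fun=> ler0n _ _)).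
Qed.

Lemma leakS A1 A2 B1 B2 : lebesgue_measurable A1 -> lebesgue_measurable A2 ->
  lebesgue_measurable B1 -> lebesgue_measurable B2 ->
  A1 `<=` A2 -> B1 `<=` B2 -> (leak A1 B1 <= leak A2 B2)%E.
Proof.
move=> mA1 mA2 mB1 mB2 sA sB.
have i0 B (x : VM) : 0 <= (\1_B x : R) by [].
apply: (@le_trans _ _ (leak A2 B1)).
  apply: ge0_subset_integral.
  - exact: mA1.
  - exact: mA2.
  - exact: measurable_smear_indic.
  - by move=> w _; exact: smear_ge0.
  - exact: sA.
apply: ge0_le_integral.
- exact: mA2.
- by move=> w _; exact: smear_ge0.
- exact: measurable_smear_indic.
- exact: measurable_smear_indic.
- move=> w _; apply: le_smear.
  + exact: measurable_indic_vec.
  + exact: measurable_indic_vec.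
  + exact: i0.
  + move=> x; rewrite !indicE ler_nat.
    by case: (boolP (x \in B1)) => // /set_mem /sB Bx; rewrite mem_set.
Qed.

Lemma leak_le A B : lebesgue_measurable A -> lebesgue_measurable B ->
  (leak A B <= mass%:E * vol B)%E.
Proof.
move=> mA mB; apply: (@le_trans _ _ (leak setT B)).
  exact: (leakS mA measurableT mB mB).
rewrite -(integral_indic_vol mB) /leak.
by rewrite (integral_smear (measurable_indic_vec mB)).
Qed.

Lemma leakUr A B1 B2 : lebesgue_measurable A -> lebesgue_measurable B1 -> lebesgue_measurable B2 ->
  (leak A (B1 `|` B2) <= leak A B1 + leak A B2)%E.
Proof.
move=> mA mB1 mB2.
have i0 B (x : VM) : 0 <= (\1_B x : R) by [].
have mS B : lebesgue_measurable B -> measurable_fun (A : set VM) (smear \1_B : VM -> \bar R).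
  exact: measurable_smear_indic.
have mU : lebesgue_measurable (B1 `|` B2) by exact: (measurableU _ _ mB1 mB2).
rewrite /leak -ge0_integralD.
- apply: ge0_le_integral.
  + exact: mA.
  + by move=> w _; exact: smear_ge0.
  + exact: mS.
  + exact: (emeasurable_funD (mS _ mB1) (mS _ mB2)).
  move=> w _; rewrite -smearD.
  + apply: le_smear.
    * exact: measurable_indic_vec.
    * by apply: measurable_funD; exact: measurable_indic_vec.
    * exact: i0.
    * move=> x; rewrite !indicE -natrD ler_nat.
      case: (boolP (x \in B1 `|` B2)) => // /set_mem[Bx|Bx].
        by rewrite (mem_set Bx).
      by rewrite (mem_set Bx) addn1.
  + exact: measurable_indic_vec.
  + exact: measurable_indic_vec.
  + exact: i0.
  + exact: i0.
- exact: mA.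
- by move=> w _; exact: smear_ge0.
- exact: mS.
- by move=> w _; exact: smear_ge0.
- exact: mS.
Qed.

Lemma leakUl A1 A2 B : lebesgue_measurable A1 -> lebesgue_measurable A2 -> lebesgue_measurable B ->
  (leak (A1 `|` A2) B <= leak A1 B + leak A2 B)%E.
Proof.
move=> mA1 mA2 mB; have mU : lebesgue_measurable (A1 `|` A2) by exact: (measurableU _ _ mA1 mA2).
by rewrite leak_sym // (leak_sym mA1) // (leak_sym mA2) //; exact: leakUr.
Qed.

Lemma leak_eq0 A B : (forall x w, B x -> A w -> eps <= enorm (x - w)) -> leak A B = 0%E.
Proof.
move=> far; apply: integral0_eq => w Aw; apply: integral0_eq => x _.
have [Bx|nBx] := pselect (B x); last by rewrite indicE memNset // mul0r.
by rewrite moll_eq0 ?mulr0 ?(ltW eps0) //; exact: far.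
Qed.

End smear.

(** * Marginals of the transport plan and the mass in E at the two ends *)

Section transport_drop.
Context {R : realType} {n : nat}.
Local Notation V := 'rV[R]_n.+1.
Local Notation leb := (@lebesgue_outer R n).
Local Notation vol := (@lebesgueV R n).
Local Notation VM := (caratheodory_type leb).
Local Notation T := (VM * VM)%type.
Local Notation vol2 := (vol \x vol)%E.
Implicit Types (x y z w : V).
Variables (C D E A : set V) (L b0 eps v : R).
Hypotheses (mC : lebesgue_measurable C).
Hypotheses (mD : lebesgue_measurable D) (DC : D `<=` C).
Hypotheses (b00 : 0 < b0) (Hb : forall x, C x -> b0 <= ballv C x L).
Hypothesis eps0 : 0 < eps.
Hypotheses (mE : lebesgue_measurable E) (vE : vol E = v%:E).
Hypotheses (mA : lebesgue_measurable A) (AD : A `<=` D) (AE : A `<=` E).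
Hypothesis Dfin : (vol D < +oo)%E.
Local Notation weight := (weight C D E A L).
Local Notation transported := (transported C D E A L eps).
Local Notation total := (total C D E A L eps).
Local Notation mass := (@mass R n eps).

Let mB : lebesgue_measurable (D `\` E). Proof. exact: (measurableD mD mE). Qed.

Let mweight : measurable_fun setT weight.
Proof. exact: measurable_weight. Qed.

Let intw : vol2.-integrable setT (EFin \o weight).
Proof. exact: (integrable_weight mC mD DC b00 Hb mE mA AD Dfin). Qed.

Let intwm t w : vol2.-integrable setT (EFin \o (fun p => weight p * moll eps (path t p - w))).
Proof. exact: (integrable_weight_moll _ mC mD DC b00 Hb mE mA AD Dfin). Qed.

Let measurable_fst_weight (x : VM) : measurable_fun setT (fun y : VM => weight (x, y)).
Proof. exact: (measurableT_comp mweight (pair1_measurable x)). Qed.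

Let measurable_snd_weight (y : VM) : measurable_fun setT (fun x : VM => weight (x, y)).
Proof. exact: (measurableT_comp mweight (pair2_measurable y)). Qed.

Let w0 p : 0 <= weight p. Proof. exact: weight_ge0. Qed.

(** A source spreads over at most its ball in [C], whose volume the weight cancels. *)
Lemma integral_weight_snd_le x : (\int[vol]_y (weight (x, y))%:E <= (\1_A x)%:E)%E.
Proof.
have [Ax|nAx] := pselect (A x); last first.
  rewrite (eq_integral (cst 0%E)) ?integral0 // => y _; congr EFin.
  by apply: weight_eq0 => -[].
have Cx : C x by exact/DC/AD.
have mCB : lebesgue_measurable (C `&` eball x L) by exact: measurable_cap_eball.
apply: (@le_trans _ _ (\int[vol]_y (wt C L x * \1_(C `&` eball x L) y)%:E)%E).
  apply: le_integral_vol.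
  - exact: measurable_fst_weight.
  - exact: (measurable_funM (measurable_cst (wt C L x)) (measurable_indic (mCB : measurable ((C `&` eball x L) : set VM)))).
  - by move=> y; exact: w0.
  - move=> y; have [[_ [/= By Nxy]]|H] := pselect (A x /\ (D `\` E) y /\ near_pairs L (x, y)); last first.
      by rewrite weight_eq0 // mulr_ge0 // wt_ge0.
    rewrite (weightE _ Ax By Nxy) indicE mem_set ?mulr1 //.
    by split; [case: By => Dy _; exact: DC|exact: Nxy].
rewrite (ge0_integralZl_indic_vol mCB (wt_ge0 _ _ _)) ballvE -EFinM lee_fin.
by rewrite (wt_ballv b00 Hb Cx) indicE mem_set.
Qed.

(** Targets lie outside [E], and each receives at most 1 / b0 from every point of [A], whose volume
    is at most v. *)
Lemma integral_weight_fst_le y : (\int[vol]_x (weight (x, y))%:E <= (v / b0 * \1_(~` E) y)%:E)%E.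
Proof.
have v0 : 0 <= v by rewrite -lee_fin -vE vol_ge0.
have [By|nBy] := pselect ((D `\` E) y); last first.
  rewrite (eq_integral (cst 0%E)) ?integral0 ?lee_fin ?mulr_ge0 ?invr_ge0 ?(ltW b00) // => x _; congr EFin.
  by apply: weight_eq0 => -[_ []].
apply: (@le_trans _ _ (\int[vol]_x (b0^-1 * \1_A x)%:E)%E).
  apply: le_integral_vol.
  - exact: measurable_snd_weight.
  - exact: (measurable_funM (measurable_cst b0^-1) (measurable_indic (mA : measurable (A : set VM)))).
  - by move=> x; exact: w0.
  - move=> x; apply: (le_trans (weight_le _ DC b00 Hb AD _)).
    rewrite ler_wpM2l ?invr_ge0 ?(ltW b00) // !indicE.
    rewrite ler_nat; case: (boolP ((x, y) \in _)) => // /set_mem[/= Ax _].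
    by rewrite mem_set.
rewrite (ge0_integralZl_indic_vol mA) ?invr_ge0 ?(ltW b00) //.
rewrite indicE mem_set ?mulr1; last by case: By.
rewrite mulrC EFinM; apply: lee_pmul; rewrite ?lee_fin ?invr_ge0 ?(ltW b00) ?vol_ge0 //.
by rewrite -vE; exact: le_vol.
Qed.

(** Of the ball of a source, at most [delta] is missing from [D] and at most v is occupied by [E];
    the weight is at most 1 / b0, so at least the stated fraction of its mass leaves. *)
Lemma integral_weight_ge (delta : R) : 0 <= delta ->
  (forall x, A x -> ballv C x L - delta <= ballv D x L) ->
  ((1 - (delta + v) / b0)%:E * vol A <= (\int[vol2]_p weight p)%:E)%E.
Proof.
move=> d0 Hd; have v0 : 0 <= v by rewrite -lee_fin -vE vol_ge0.
have mEw : measurable_fun setT (EFin \o weight) by exact/measurable_EFinP.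
have Ew0 p : (0 <= (EFin \o weight) p)%E by rewrite lee_fin.
rewrite -(EFin_Rintegral measurableT intw).
rewrite (@fubini_tonelli1 _ _ _ _ _ vol vol (EFin \o weight) mEw Ew0) /fubini_F /=.
set k := 1 - (delta + v) / b0.
have [k0|k0] := ltP k 0.
  apply: (@le_trans _ _ 0%E).
    by rewrite mule_le0_ge0 ?vol_ge0 // lee_fin ltW.
  by apply: integral_ge0 => x _; apply: integral_ge0 => y _; rewrite lee_fin.
rewrite -(ge0_integralZl_indic_vol mA k0).
apply: ge0_le_integral.
- exact: measurableT.
- by move=> x _; rewrite lee_fin mulr_ge0.
- apply/measurable_EFinP.
  exact: (measurable_funM (measurable_cst k) (measurable_indic (mA : measurable (A : set VM)))).
- exact: (measurable_fun_fubini_tonelli_F (EFin \o weight) mEw Ew0).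
move=> x _; have [Ax|nAx] := pselect (A x); last first.
  rewrite indicE memNset // mulr0; apply: integral_ge0 => y _; rewrite lee_fin //.
rewrite indicE mem_set // mulr1.
have Cx : C x by exact/DC/AD.
have mS : lebesgue_measurable ((D `\` E) `&` eball x L) by exact: measurable_cap_eball.
have -> : (\int[vol]_y (weight (x, y))%:E = (wt C L x * ballv (D `\` E) x L)%:E)%E.
  rewrite EFinM -ballvE -(ge0_integralZl_indic_vol mS (wt_ge0 _ _ _)).
  apply: eq_integral => y _; congr EFin; rewrite indicE.
  have [[By Nxy]|H] := pselect ((D `\` E) y /\ eball x L y).
    by rewrite (weightE _ Ax By Nxy) mem_set ?mulr1.
  rewrite memNset // mulr0; apply: weight_eq0 => -[_ [By Nxy]]; apply: H.
  by split.
rewrite lee_fin.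
have H1 : ballv D x L <= ballv (D `\` E) x L + v.
  rewrite -lee_fin EFinD -!ballvE -vE.
  have mDB : lebesgue_measurable (D `&` eball x L) by exact: measurable_cap_eball.
  apply: (@le_trans _ _ (vol (((D `\` E) `&` eball x L) `|` E))).
    apply: le_vol => y [Dy By]; have [Ey|nEy] := pselect (E y); [by right|left].
    by split.
  exact: volU.
have H2 := Hd x Ax.
have wb := wt_ballv b00 Hb Cx.
have wb0 := wt_le b00 Hb Cx.
have w00 := wt_ge0 C L x.
apply: (@le_trans _ _ (wt C L x * (ballv C x L - delta - v))).
  rewrite -addrA -opprD mulrBr wb lerD2l lerN2 mulrC ler_wpM2l // addr_ge0 //.
by rewrite ler_wpM2l // lerBlDr (le_trans H2).
Qed.

Let Efin : (vol E < +oo)%E. Proof. by rewrite vE ltry. Qed.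

Let mCE : lebesgue_measurable (~` E). Proof. exact: (measurableC mE). Qed.

Let indic0 (B : set V) (x : VM) : 0 <= (\1_B x : R). Proof. by []. Qed.

Let mEw : measurable_fun setT (EFin \o weight). Proof. exact/measurable_EFinP. Qed.

Let Ew0 p : (0 <= (EFin \o weight) p)%E. Proof. by rewrite lee_fin. Qed.

(** The two marginals of the plan; they describe the mass at times 0 and 1. *)
Let fst_mass (x : VM) : R := fine (\int[vol]_y (weight (x, y))%:E)%E.
Let snd_mass (y : VM) : R := fine (\int[vol]_x (weight (x, y))%:E)%E.

Let fst_massE x : (fst_mass x)%:E = (\int[vol]_y (weight (x, y))%:E)%E.
Proof.
rewrite fineK // ge0_fin_numE; last by apply: integral_ge0 => y _; rewrite lee_fin.
exact: (le_lt_trans (integral_weight_snd_le x) (ltry _)).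
Qed.

Let snd_massE y : (snd_mass y)%:E = (\int[vol]_x (weight (x, y))%:E)%E.
Proof.
rewrite fineK // ge0_fin_numE; last by apply: integral_ge0 => x _; rewrite lee_fin.
exact: (le_lt_trans (integral_weight_fst_le y) (ltry _)).
Qed.

Let fst_mass_ge0 x : 0 <= fst_mass x.
Proof. by rewrite fine_ge0 //; apply: integral_ge0 => y _; rewrite lee_fin. Qed.

Let snd_mass_ge0 y : 0 <= snd_mass y.
Proof. by rewrite fine_ge0 //; apply: integral_ge0 => y' _; rewrite lee_fin. Qed.

Let measurable_fst_mass : measurable_fun setT fst_mass.
Proof.
apply/measurable_EFinP.
have -> : EFin \o fst_mass = fubini_F vol (EFin \o weight).
  by apply/funext => x; rewrite /= fst_massE.
exact: (measurable_fun_fubini_tonelli_F (EFin \o weight) mEw Ew0).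
Qed.

Let measurable_snd_mass : measurable_fun setT snd_mass.
Proof.
apply/measurable_EFinP.
have -> : EFin \o snd_mass = fubini_G vol (EFin \o weight).
  by apply/funext => y; rewrite /= snd_massE.
exact: (measurable_fun_fubini_tonelli_G (EFin \o weight) mEw Ew0).
Qed.

Let transportedE t w :
  (transported t w)%:E = (\int[vol2]_p (weight p * moll eps (path t p - w))%:E)%E.
Proof. by rewrite (EFin_Rintegral measurableT (intwm t w)). Qed.

Let measurable_integrand t w :
  measurable_fun setT (EFin \o (fun p => weight p * moll eps (path t p - w))).
Proof. by case/integrableP: (intwm t w). Qed.

Let integrand_ge0 (t : R) w (p : T) :
  (0 <= (EFin \o (fun p => (weight p * moll eps (path t p - w))%R)) p)%E.
Proof. by rewrite lee_fin mulr_ge0 // moll_ge0. Qed.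

Let transported0E w : (transported 0 w)%:E = smear eps fst_mass w.
Proof.
rewrite transportedE.
rewrite (@fubini_tonelli1 _ _ _ _ _ vol vol _ (measurable_integrand 0 w) (integrand_ge0 0 w)).
apply: eq_integral => x _; rewrite /fubini_F /=.
rewrite mulrC EFinM fst_massE -(ge0_integralZl_vec (measurable_fst_weight x) (fun=> w0 _) (moll_ge0 _ _)).
by apply: eq_integral => y _; rewrite mulrC /path scale0r addr0.
Qed.

Let transported1E w : (transported 1 w)%:E = smear eps snd_mass w.
Proof.
rewrite transportedE.
rewrite (@fubini_tonelli2 _ _ _ _ _ vol vol _ (measurable_integrand 1 w) (integrand_ge0 1 w)).
apply: eq_integral => y _; rewrite /fubini_G /=.
rewrite mulrC EFinM snd_massE -(ge0_integralZl_vec (measurable_snd_weight y) (fun=> w0 _) (moll_ge0 _ _)).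
by apply: eq_integral => x _; rewrite mulrC /path scale1r /= [X in moll _ (X - _)]addrC subrK.
Qed.

Let EFin_total t : (total t)%:E = (\int[vol]_(w in E) (transported t w)%:E)%E.
Proof.
have [B HB] := pint_bounded intw (vmeas_path t) (bump_moll eps).
have intT : vol.-integrable (E : set VM) (EFin \o transported t).
  apply: (integrable_bounded_on mE Efin _ HB); apply: continuous_measurable_vec.
  exact: (pint_continuous intw (vmeas_path t) (bump_moll eps)).
exact: (esym (EFin_Rintegral (mE : measurable (E : set VM)) intT)).
Qed.

(** At time 0 the density is at most the indicator of [A], a part of [E], so what mollification
    places outside [E] is at most the leak of [E]. *)
Lemma total0_ge :
  ((mass * \int[vol2]_p weight p)%:E <= (total 0)%:E + leak eps (~` E) E)%E.
Proof.
have mS := measurable_smear eps measurable_fst_mass fst_mass_ge0.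
rewrite EFinM -(EFin_Rintegral measurableT intw).
rewrite (@fubini_tonelli1 _ _ _ _ _ vol vol (EFin \o weight) mEw Ew0) /fubini_F /=.
have -> : (\int[vol]_x \int[vol]_y (weight (x, y))%:E = \int[vol]_x (fst_mass x)%:E)%E.
  by apply: eq_integral => x _; rewrite fst_massE.
rewrite -(integral_smear eps0 measurable_fst_mass fst_mass_ge0) EFin_total.
have -> : (\int[vol]_w smear eps fst_mass w = \int[vol]_(w in E) smear eps fst_mass w +
    \int[vol]_(w in ~` E) smear eps fst_mass w)%E.
  rewrite -ge0_integral_setU.
  - by rewrite setUv.
  - exact: mE.
  - exact: mCE.
  - exact: measurable_funTS.
  - by move=> w _; exact: (smear_ge0 _ _ fst_mass_ge0).
  - by apply/disj_setPS => w [].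
apply: leeD; first by under eq_integral do rewrite -transported0E.
apply: (@le_trans _ _ (leak eps (~` E) A)); last exact: leakS.
apply: ge0_le_integral.
- exact: mCE.
- by move=> w _; exact: (smear_ge0 _ _ fst_mass_ge0).
- exact: measurable_funTS.
- exact: (measurable_funTS (measurable_smear eps (measurable_indic_vec mA) (indic0 A))).
move=> w _; apply: le_smear.
- exact: measurable_fst_mass.
- exact: measurable_indic_vec.
- exact: fst_mass_ge0.
- by move=> x; rewrite -lee_fin fst_massE integral_weight_snd_le.
Qed.

(** At time 1 all mass sits outside [E] with density at most v / b0, so only leaked mass is found in
    [E]; symmetry gives the same leak as at time 0. *)
Lemma total1_le : ((total 1)%:E <= (v / b0)%:E * leak eps (~` E) E)%E.
Proof.
have v0 : 0 <= v by rewrite -lee_fin -vE vol_ge0.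
have vb0 : 0 <= v / b0 by rewrite divr_ge0 // ltW.
have mI := measurable_indic_vec mCE.
have mI' : measurable_fun setT (fun y : VM => v / b0 * \1_(~` E) y).
  exact: (measurable_funM (measurable_cst _) mI).
rewrite EFin_total (leak_sym eps mCE mE).
have mS := measurable_smear eps mI (indic0 _).
rewrite -ge0_integralZl.
- apply: ge0_le_integral.
  + exact: mE.
  + by move=> w _; rewrite transported1E; exact: smear_ge0.
  + under eq_fun do rewrite transported1E.
    exact: (measurable_funTS (measurable_smear eps measurable_snd_mass snd_mass_ge0)).
  + by under eq_fun do rewrite -(smearZ _ _ mI (indic0 _) vb0); exact: (measurable_funTS (measurable_smear eps mI' (fun y => mulr_ge0 vb0 (indic0 _ y)))).
  move=> w _; rewrite transported1E -(smearZ _ _ mI (indic0 _) vb0).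
  apply: le_smear.
  + exact: measurable_snd_mass.
  + exact: mI'.
  + exact: snd_mass_ge0.
  + by move=> y; rewrite -lee_fin snd_massE integral_weight_fst_le.
- exact: mE.
- exact: (measurable_funTS mS).
- by move=> w _; exact: (smear_ge0 _ _ (indic0 _)).
- by rewrite lee_fin.
Qed.

End transport_drop.

(** * Contractions of a convex set *)

Section convex_core.
Context {R : realType} {n : nat}.
Local Notation V := 'rV[R]_n.+1.
Local Notation vol := (@lebesgueV R n).
Implicit Types (a x y z w : V) (B : set V) (l rho : R).

(** The contraction of [B] towards [a] by the ratio [l]; see [coreP]. *)
Definition core a l B : set V := homoth (a - l *: a) l @` B.

Lemma coreP a l B z : core a l B z <-> exists2 x, B x & z = a + l *: (x - a).
Proof.
by split=> [[x Bx <-]|[x Bx ->]]; exists x; rewrite ?homoth_center.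
Qed.

Lemma measurable_core a l B : 0 < l -> lebesgue_measurable B -> lebesgue_measurable (core a l B).
Proof.
move=> l0 mB; rewrite /core image_homoth ?gt_eqF //.
by apply: measurable_preimage_homoth; rewrite ?invr_gt0.
Qed.

Lemma vol_core a l B : 0 < l -> vol (core a l B) = ((l ^+ n.+1)%:E * vol B)%E.
Proof. exact: vol_homoth. Qed.

Lemma segment_closed_core a l B : segment_closed B -> segment_closed (core a l B).
Proof.
move=> cB z w t /coreP[x Bx ->] /coreP[y By ->] t01; apply/coreP.
exists (x + t *: (y - x)); first exact: cB.
apply/rowP => i; rewrite !mxE; ring.
Qed.

Lemma core_sub a l B : segment_closed B -> B a -> 0 <= l <= 1 -> core a l B `<=` B.
Proof. by move=> cB Ba l01 _ /coreP[x Bx ->]; exact: cB. Qed.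

Lemma eball_core a l rho B z : segment_closed B -> eball a rho `<=` B -> 0 <= l < 1 ->
  core a l B z -> eball z ((1 - l) * rho) `<=` B.
Proof.
move=> cB aB /andP[l0 l1] /coreP[x Bx ->] y yz.
have k0 : 0 < 1 - l by rewrite subr_gt0.
(* Solves y = (1 - l) p + l x; the radius (1 - l) rho is what keeps [p] in the ball around [a]. *)
pose p := a + (1 - l)^-1 *: (y - (a + l *: (x - a))).
have Bp : B p.
  apply: aB; rewrite /eball /p /= addrAC subrr add0r enormZ ger0_norm ?invr_ge0 ?(ltW k0) //.
  by rewrite mulrC ltr_pdivrMr // mulrC.
have -> : y = p + l *: (x - p).
  apply/rowP => i; rewrite !mxE; field; exact: lt0r_neq0.
by apply: cB => //; rewrite l0 ltW.
Qed.

Lemma vol_setD_core a l B (c : R) : segment_closed B -> lebesgue_measurable B -> B a ->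
  vol B = c%:E -> 0 < l <= 1 -> vol (B `\` core a l B) = ((1 - l ^+ n.+1) * c)%:E.
Proof.
move=> cB mB Ba vB /andP[l0 l1].
have mK := measurable_core a l0 mB.
rewrite (measureD (mB : measurable (B : set (caratheodory_type (@lebesgue_outer R n)))) mK); last first.
  by have := ltry c; rewrite -vB.
have -> : B `&` core a l B = core a l B.
  by apply/setIidr; apply: core_sub => //; rewrite ltW.
have := vol_core a B l0; rewrite vB => vK.
by rewrite mulrBl mul1r EFinB EFinM -vK -vB.
Qed.

Lemma one_sub_exp_le l k : 0 <= l <= 1 -> 1 - l ^+ k <= k%:R * (1 - l).
Proof.
move=> /andP[l0 l1]; elim: k => [|k IH]; first by rewrite expr0 subrr mul0r.
have -> : 1 - l ^+ k.+1 = (1 - l) + l * (1 - l ^+ k) by rewrite exprS; ring.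
rewrite -natr1 mulrDl mul1r addrC lerD2r (le_trans _ IH) // ler_piMl //.
by rewrite subr_ge0 exprn_ile1.
Qed.

Lemma exists_ratio (eta : R) k : 0 < eta -> exists2 l, 0 < l < 1 & 1 - l ^+ k <= eta.
Proof.
move=> eta0; have k0 : 0 < k%:R + 1 :> R by rewrite ltr_wpDl.
(* The bound 1/2 keeps the ratio 1 - s positive; the other bound makes Bernoulli's estimate at most
   [eta]. *)
pose s := Num.min 2^-1 (eta / (k%:R + 1)).
have s0 : 0 < s by rewrite lt_min invr_gt0 ltr0n divr_gt0.
have s1 : s < 1 by rewrite gt_min invf_lt1 ?ltr1n.
exists (1 - s); first by rewrite subr_gt0 s1 ltrBlDr ltrDl.
apply: (le_trans (one_sub_exp_le _ _)).
  by rewrite subr_ge0 ltW //= lerBlDr lerDl ltW.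
rewrite opprB addrC subrK.
apply: (@le_trans _ _ ((k%:R + 1) * s)); first by rewrite ler_wpM2r ?lerDl // ltW.
by rewrite mulrC -ler_pdivlMr // ge_min lexx orbT.
Qed.

End convex_core.

(** * The leak of a set of finite volume vanishes with the mollification radius *)

Section small_leak.
Context {R : realType} {n : nat}.
Local Notation V := 'rV[R]_n.+1.
Local Notation leb := (@lebesgue_outer R n).
Local Notation vol := (@lebesgueV R n).
Local Notation VM := (caratheodory_type leb).
Local Notation mass := (@mass R n).
Implicit Types (a x y z w : V) (B E F : set V) (l rho eta : R).

Lemma mass_ge0 eps : 0 <= mass eps.
Proof. by apply: Rintegral_ge0 => z _; exact: moll_ge0. Qed.

(** Measured relative to [mass eps], as for a normalised mollifier; it plays the role of the L1
    convergence of mollified indicators. *)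
Definition vanishing_leak B := forall eta, 0 < eta -> exists2 e0, 0 < e0 &
  forall eps, 0 < eps -> eps < e0 -> (leak eps (~` B) B <= (mass eps * eta)%:E)%E.

(** A contraction of [B] stays farther than [eps] from the complement and leaks nothing; the
    remaining layer leaks at most its small volume. *)
Lemma vanishing_leak_convex B a rho : segment_closed B -> lebesgue_measurable B ->
  0 < rho -> eball a rho `<=` B -> (vol B < +oo)%E -> vanishing_leak B.
Proof.
move=> cB mB rho0 aB Bfin eta eta0.
have vB : vol B = (fine (vol B))%:E by rewrite fineK // ge0_fin_numE // vol_ge0.
set c := fine (vol B) in vB.
have c0 : 0 <= c by rewrite fine_ge0 // vol_ge0.
have Ba : B a by apply: aB; rewrite /eball /= subrr enorm0.
have [l /andP[l0 l1] Hl] := @exists_ratio R (eta / (c + 1)) n.+1 (divr_gt0 eta0 (ltr_wpDl c0 ltr01)).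
exists ((1 - l) * rho); first by rewrite mulr_gt0 // subr_gt0.
move=> eps eps0 epsl.
have mK := measurable_core a l0 mB.
have mBc : lebesgue_measurable (~` B) by exact: (measurableC mB).
have mD : lebesgue_measurable (B `\` core a l B) by exact: (measurableD mB mK).
have sub : B `<=` (B `\` core a l B) `|` core a l B.
  by move=> x Bx; have [Kx|nKx] := pselect (core a l B x); [right|left].
apply: (@le_trans _ _ (leak eps (~` B) ((B `\` core a l B) `|` core a l B))).
  by apply: leakS => //; exact: (measurableU _ _ mD mK).
apply: (le_trans (leakUr eps mBc mD mK)).
have -> : leak eps (~` B) (core a l B) = 0%E.
  apply: leak_eq0 => // x w Kx nBw; rewrite leNgt; apply/negP => xw; apply: nBw.
  apply: (eball_core cB aB _ Kx); first by rewrite ltW.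
  by rewrite /eball /= enormB (lt_trans xw).
rewrite adde0; apply: (le_trans (leak_le eps0 mBc mD)).
have l01 : 0 < l <= 1 by rewrite l0 ltW.
have -> : vol (B `\` core a l B) = ((1 - l ^+ n.+1) * c)%:E by exact: vol_setD_core.
rewrite -EFinM lee_fin; apply: ler_wpM2l; first exact: mass_ge0.
apply: (@le_trans _ _ (eta / (c + 1) * c)); first by rewrite ler_wpM2r.
rewrite mulrAC ler_pdivrMr ?ltr_wpDl // ler_wpM2l ?lerDl //; exact: ltW.
Qed.

Lemma exists_le_all k (d : 'I_k -> R) : (forall i, 0 < d i) ->
  exists2 rho, 0 < rho & forall i, rho <= d i.
Proof.
move=> d0; exists (\big[Num.min/1]_i d i); last by move=> i; exact: bigmin_le.
by apply/bigmin_gtP.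
Qed.

Lemma segment_closed_box (c : V * V) : segment_closed (box c).
Proof.
move=> x y t cx cy /andP[t0 t1] i; rewrite !mxE.
have /andP[x1 x2] := cx i; have /andP[y1 y2] := cy i.
set p := c.1 0 i in x1 y1 *; set q := c.2 0 i in x2 y2 *.
set u := x 0 i in x1 x2 *; set v := y 0 i in y1 y2 *.
have t1' : 0 <= 1 - t by rewrite subr_ge0.
have [uv|/ltW vu] := leP u v.
  have := mulr_ge0 t0 (etrans (subr_ge0 _ _) uv).
  have := mulr_ge0 t1' (etrans (subr_ge0 _ _) uv).
  by move=> h1 h2; apply/andP; split; lra.
have := mulr_ge0 t0 (etrans (subr_ge0 _ _) vu).
have := mulr_ge0 t1' (etrans (subr_ge0 _ _) vu).
by move=> h1 h2; apply/andP; split; lra.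
Qed.

Lemma vanishing_leak0 : vanishing_leak set0.
Proof.
move=> eta eta0; exists 1 => // eps eps0 _.
have -> : leak eps (~` set0) (set0 : set V) = 0%E by apply: leak_eq0 => // x w [].
by rewrite lee_fin; apply: mulr_ge0; [exact: mass_ge0|exact: ltW].
Qed.

Lemma vanishing_leak_box (c : V * V) : vanishing_leak (box c).
Proof.
have [H|/existsNP[i Hi]] := pselect (forall i, c.1 0 i < c.2 0 i); last first.
  have -> : box c = set0.
    by rewrite -subset0 => x /(_ i)/andP[/lt_le_trans h /h].
  exact: vanishing_leak0.
have [rho rho0 Hrho] := @exists_le_all _ (fun i => (c.2 0 i - c.1 0 i) / 2)
  (fun i => divr_gt0 (etrans (subr_gt0 _ _) (H i)) (ltr0n _ 2)).
apply: (@vanishing_leak_convex _ (2^-1 *: (c.1 + c.2)) rho) => //.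
- exact: segment_closed_box.
- exact: measurable_box.
- move=> x cx i; have := le_lt_trans (coord_le_enorm _ i) cx; rewrite !mxE.
  have := Hrho i; set p := c.1 0 i; set q := c.2 0 i; set u := x 0 i.
  rewrite ltr_norml => h /andP[h1 h2]; apply/andP; split; lra.
- exact: (le_lt_trans (vol_box_le c) (ltry _)).
Qed.

(** What leaks out of the union leaks out of each part, since the complement of the union lies in
    both complements. *)
Lemma vanishing_leakU E F : lebesgue_measurable E -> lebesgue_measurable F ->
  vanishing_leak E -> vanishing_leak F -> vanishing_leak (E `|` F).
Proof.
move=> mE mF vE vF eta eta0; have h0 : 0 < eta / 2 by rewrite divr_gt0.
have [e1 e10 H1] := vE _ h0; have [e2 e20 H2] := vF _ h0.
exists (Num.min e1 e2); first by rewrite lt_min e10.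
move=> eps eps0; rewrite lt_min => /andP[ee1 ee2].
have mU : lebesgue_measurable (E `|` F) by exact: (measurableU _ _ mE mF).
have mUc : lebesgue_measurable (~` (E `|` F)) by exact: (measurableC mU).
apply: (le_trans (leakUr eps mUc mE mF)).
rewrite [eta]splitr mulrDr EFinD; apply: leeD.
- apply: le_trans (H1 _ eps0 ee1); apply: leakS => //; first exact: (measurableC mE).
  by apply: subsetC; exact: subsetUl.
- apply: le_trans (H2 _ eps0 ee2); apply: leakS => //; first exact: (measurableC mF).
  by apply: subsetC; exact: subsetUr.
Qed.

Lemma measurable_bigsetU_box (c : nat -> V * V) N :
  lebesgue_measurable (\big[setU/set0]_(k < N) box (c k)).
Proof. by apply: bigsetU_measurable => k _; exact: measurable_box. Qed.

Lemma vanishing_leak_boxes (c : nat -> V * V) N :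
  vanishing_leak (\big[setU/set0]_(k < N) box (c k)).
Proof.
elim: N => [|N IH]; first by rewrite big_ord0; exact: vanishing_leak0.
rewrite big_ord_recr /=.
exact: (vanishing_leakU (measurable_bigsetU_box c N) (measurable_box _) IH (vanishing_leak_box _)).
Qed.

Lemma vol_setD_le E F (delta : R) : lebesgue_measurable E -> lebesgue_measurable F ->
  F `<=` E -> (vol E < +oo)%E -> (vol E <= vol F + delta%:E)%E ->
  (vol (E `\` F) <= delta%:E)%E.
Proof.
move=> mE mF FE Efin EFd.
have Ffin : vol F \is a fin_num.
  by rewrite ge0_fin_numE ?vol_ge0 // (le_lt_trans _ Efin) // le_vol.
have -> : vol (E `\` F) = (vol E - vol F)%E.
  have := measureD (mE : measurable (E : set VM)) mF Efin.
  by have -> : E `&` F = F by apply/setIidr.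
by rewrite (leeBlDr _ _ Ffin) addeC.
Qed.

(** An almost optimal cover of [E] exceeds it by at most [delta], and by continuity from below
    finitely many of its boxes fill the cover up to [delta]. *)
Lemma box_approximation E (v delta : R) : lebesgue_measurable E -> vol E = v%:E -> 0 < delta ->
  exists c : nat -> V * V, exists N, let F := \big[setU/set0]_(k < N) box (c k) in
    (vol (E `\` F) <= delta%:E)%E /\ (vol (F `\` E) <= delta%:E)%E.
Proof.
move=> mE vE delta0.
have vfin : leb E \is a fin_num by rewrite (vE : leb E = v%:E).
have [_ [c Ec <-] cv] := lb_ereal_inf_adherent delta0 vfin.
pose U := \bigcup_k box (c k).
have mU : lebesgue_measurable U by apply: bigcupT_measurable => k; exact: measurable_box.
have Uv : (vol U <= v%:E + delta%:E)%E.
  apply: (@le_trans _ _ (\sum_(k <oo) (box_volume (c k))%:E)%E).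
    by apply: ereal_inf_lbound; exists c.
  by have := ltW cv; rewrite -vE.
have Ufin : (vol U < +oo)%E by exact: (le_lt_trans Uv (ltry _)).
pose F N := \big[setU/set0]_(k < N) box (c k).
have mF N : lebesgue_measurable (F N) by exact: measurable_bigsetU_box.
have FU N : F N `<=` U by rewrite /F -(bigcup_mkord N (fun k => box (c k))); exact: bigcup_subset.
have cvF : (vol \o F @ \oo --> vol U)%E.
  have UE : U = \bigcup_N F N.
    apply/seteqP; split=> [x [k _ xk]|x [N _ xN]]; last exact: (FU N).
    by exists k.+1 => //; rewrite /F big_ord_recr /=; right.
  rewrite UE; apply: nondecreasing_cvg_mu => //; first by rewrite -UE.
  apply/nondecreasing_seqP => k; rewrite /F big_ord_recr /=; apply/subsetPset.
  exact: subsetUl.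
have [N HN] : exists N, (vol U - delta%:E < vol (F N))%E.
  have ltU : (vol U - delta%:E < vol U)%E.
    by rewrite lteBlDr // lteDl ?lte_fin // ge0_fin_numE ?vol_ge0.
  have [N _ HN] := cvF _ (open_ereal_gt' ltU).
  by exists N; exact: (HN N (leqnn N)).
exists c, N => /=; split.
- apply: (@le_trans _ _ (vol (U `\` F N))); first by apply: le_vol; exact: setSD.
  by apply: vol_setD_le => //; rewrite -leeBlDr //; exact: ltW.
- apply: (@le_trans _ _ (vol (U `\` E))); first by apply: le_vol; apply: setSD; exact: FU.
  by apply: vol_setD_le => //; rewrite vE.
Qed.

(** With [F] a finite union of boxes, three leaks of a third each: that of E minus F, that between
    [F] and F minus E (bounded by the small volume after exchanging the sets), and that of [F]. *)
Lemma vanishing_leak_finite E v : lebesgue_measurable E -> vol E = v%:E -> vanishing_leak E.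
Proof.
move=> mE vE eta eta0; have h0 : 0 < eta / 3 by rewrite divr_gt0.
have [c [N /= [EF FE]]] := box_approximation mE vE h0.
set F := \big[setU/set0]_(k < N) box (c k) in EF FE.
have [e0 e00 He] := vanishing_leak_boxes c N h0; exists e0 => // eps eps0 ee0.
have mF : lebesgue_measurable F by exact: measurable_bigsetU_box.
have mEc : lebesgue_measurable (~` E) by exact: (measurableC mE).
have mFc : lebesgue_measurable (~` F) by exact: (measurableC mF).
have mEF : lebesgue_measurable (E `\` F) by exact: (measurableD mE mF).
have mFE : lebesgue_measurable (F `\` E) by exact: (measurableD mF mE).
have mb (S : set V) : lebesgue_measurable S -> (vol S <= (eta / 3)%:E)%E ->
    forall S', lebesgue_measurable S' -> (leak eps S' S <= (mass eps * (eta / 3))%:E)%E.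
  move=> mS Sle S' mS'; apply: (le_trans (leak_le eps0 mS' mS)).
  by rewrite EFinM; apply: lee_wpmul2l => //; rewrite lee_fin mass_ge0.
have subE : E `<=` (E `\` F) `|` F.
  by move=> x Ex; have [Fx|nFx] := pselect (F x); [right|left].
have subEc : ~` E `<=` (F `\` E) `|` ~` F.
  by move=> x Ex; have [Fx|nFx] := pselect (F x); [left|right].
apply: (@le_trans _ _ (leak eps (~` E) ((E `\` F) `|` F))).
  exact: (leakS _ mEc mEc mE (measurableU _ _ mEF mF)).
apply: (le_trans (leakUr eps mEc mEF mF)).
have -> : mass eps * eta = mass eps * (eta / 3) + (mass eps * (eta / 3) + mass eps * (eta / 3)) by field.
rewrite !EFinD; apply: leeD; first exact: mb.
apply: (@le_trans _ _ (leak eps ((F `\` E) `|` ~` F) F)).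
  exact: (leakS _ mEc (measurableU _ _ mFE mFc) mF mF).
apply: (le_trans (leakUl eps mFE mFc mF)).
apply: leeD; last exact: He.
by rewrite (leak_sym eps mFE mF); exact: mb.
Qed.

End small_leak.

(** * The perimeter bound at a fixed radius *)

Section perimeter_lower_bound.
Context {R : realType} {n : nat}.
Local Notation V := 'rV[R]_n.+1.
Local Notation leb := (@lebesgue_outer R n).
Local Notation vol := (@lebesgueV R n).
Implicit Types (x y z : V) (E : set V).

Lemma vol_setD_eball E a (delta : R) : lebesgue_measurable E -> (vol E < +oo)%E -> 0 < delta ->
  exists2 M, 0 < M & (vol (E `\` eball a M) <= delta%:E)%E.
Proof.
move=> mE Efin delta0.
pose F (k : nat) := E `&` eball a k%:R.
have mF k : lebesgue_measurable (F k) by exact: measurable_cap_eball.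
have FE : E = \bigcup_k F k by rewrite -setI_bigcupr eball_bigcup setIT.
have cvF : (vol \o F @ \oo --> vol E)%E.
  rewrite FE; apply: nondecreasing_cvg_mu => //; first by rewrite -FE.
  apply/nondecreasing_seqP => k; apply/subsetPset; apply: setIS; apply: le_eball.
  by rewrite ler_nat.
have ltE : (vol E - delta%:E < vol E)%E.
  by rewrite lteBlDr // lteDl ?lte_fin // ge0_fin_numE ?vol_ge0.
have [N _ HN] := cvF _ (open_ereal_gt' ltE).
exists N.+1%:R; first by rewrite ltr0n.
have -> : E `\` eball a N.+1%:R = E `\` F N.+1 by rewrite /F setDIr setDv set0U.
apply: vol_setD_le => //; first exact: subIsetl.
by rewrite -leeBlDr // ltW // (HN N.+1 (leqnSn N)).
Qed.

Variables (C E : set V) (a : V) (rho v r : R).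
Hypotheses (n0 : (1 <= n)%N) (mC : lebesgue_measurable C) (cC : segment_closed C).
Hypotheses (ubC : ~ bounded_set C) (rho0 : 0 < rho) (aC : eball a rho `<=` C).
Hypotheses (mE : lebesgue_measurable E) (EC : E `<=` C) (vE : vol E = v%:E).
Hypotheses (v0 : 0 < v) (r0 : 0 < r) (Hv : forall x, C x -> v <= ballv C x r).

Let L := 3 * r.
Let b0 := v + v.
(** Two losses of [delta] leave A with at least 7/8 v, and a third reduces the transported fraction
    from 1/2 to 15/32. *)
Let delta := v / 16.

Let L0 : 0 < L. Proof. by rewrite mulr_gt0. Qed.
Let b00 : 0 < b0. Proof. by rewrite addr_gt0. Qed.
Let delta0 : 0 < delta. Proof. by rewrite divr_gt0. Qed.
Let Ca : C a. Proof. by apply: aC; rewrite /eball /= subrr enorm0. Qed.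
Let Hb x : C x -> b0 <= ballv C x L. Proof. exact: (double_ballv mC cC ubC (ltW r0) Hv). Qed.

(* The transport is carried out in [D], a contraction of a bounded part of [C], so
   that the mollified flow field has its support in the interior of [C]. *)
Let truncation : exists D A eps1 M, [/\ lebesgue_measurable D, segment_closed D, D `<=` C,
  (vol D < +oo)%E & D `<=` eball a M] /\
  [/\ 0 < eps1, (forall z, D z -> eball z eps1 `<=` C), lebesgue_measurable A, A `<=` E `&` D &
    ((7 / 8 * v)%:E <= vol A)%E /\ forall x, A x -> ballv C x L - delta <= ballv D x L].
Proof.
have Efin : (vol E < +oo)%E by rewrite vE ltry.
have [M M0 HM] := vol_setD_eball a mE Efin delta0.
have ML : 0 < M + L by rewrite addr_gt0.
(* The margin L makes [K] contain the ball of radius L in [C] around every source in the ball of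
   radius M. *)
pose K := C `&` eball a (M + L).
have mK : lebesgue_measurable K by exact: measurable_cap_eball.
have cK : segment_closed K.
  move=> x y t [Cx ax] [Cy ay] t01; split; first exact: cC.
  have /andP[t0 t1] := t01; rewrite /eball /= in ax ay *.
  have -> : x + t *: (y - x) - a = (1 - t) *: (x - a) + t *: (y - a).
    by apply/rowP => i; rewrite !mxE; ring.
  apply: (le_lt_trans (enormD _ _)); rewrite !enormZ !ger0_norm ?subr_ge0 //.
  set p := enorm (x - a) in ax *; set q := enorm (y - a) in ay *.
  have [->|t00] := eqVneq t 0; first by rewrite subr0 mul1r mul0r addr0.
  have tp : 0 < t by rewrite lt_neqAle eq_sym t00.
  have h1 : (1 - t) * p <= (1 - t) * (M + L) by rewrite ler_wpM2l ?subr_ge0 // ltW.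
  have h2 : t * q < t * (M + L) by rewrite ltr_pM2l.
  by apply: (lt_le_trans (ler_ltD h1 h2)); rewrite -mulrDl subrK mul1r.
have Ka : K a by split => //; rewrite /eball /= subrr enorm0.
pose rho' := Num.min rho (M + L).
have rho'0 : 0 < rho' by rewrite lt_min rho0.
have aK : eball a rho' `<=` K.
  move=> x ax; split; last by apply: le_eball ax; rewrite ge_min lexx orbT.
  by apply: aC; apply: le_eball ax; rewrite ge_min lexx.
have vK : vol K = (ballv C a (M + L))%:E by exact: ballvE.
set c := ballv C a (M + L) in vK.
have c0 : 0 <= c by exact: ballv_ge0.
have [l /andP[l0 l1] Hl] := @exists_ratio R (delta / (c + 1)) n.+1 (divr_gt0 delta0 (ltr_wpDl c0 ltr01)).
pose D := core a l K; pose A := (E `&` D) `&` eball a M.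
have mD : lebesgue_measurable D by exact: measurable_core.
have DK : D `<=` K by apply: core_sub => //; rewrite !ltW.
have l01 : 0 < l <= 1 by rewrite l0 ltW.
have KD : (vol (K `\` D) <= delta%:E)%E.
  rewrite (vol_setD_core cK mK Ka vK l01) lee_fin.
  apply: (@le_trans _ _ (delta / (c + 1) * c)); first by rewrite ler_wpM2r.
  by rewrite mulrAC ler_pdivrMr ?ltr_wpDl // ler_wpM2l ?lerDl // ltW.
have mED : lebesgue_measurable (E `&` D) by exact: (measurableI _ _ mE mD).
exists D, A, ((1 - l) * rho'), (M + L); split; split.
- exact: mD.
- exact: segment_closed_core.
- by move=> x /DK[].
- by apply: le_lt_trans (vol_ball_lty C a (M + L)); exact: le_vol.
- by move=> x /DK[].
- by rewrite mulr_gt0 // subr_gt0.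
- move=> z Dz x xz; suff [] : K x by [].
  by apply: (eball_core cK aK _ Dz) => //; rewrite ltW.
- exact: measurable_cap_eball.
- exact: subIsetl.
split.
(* The part of [E] outside [A] is either far from [a] or in [K] minus [D]; each costs at most
   [delta]. *)
- have EA : E `<=` (A `|` (E `\` eball a M)) `|` (K `\` D).
    move=> x Ex; have [Bx|nBx] := pselect (eball a M x); last by left; right.
    have [Dx|nDx] := pselect (D x); first by left; left.
    right; split => //; split; first exact: EC.
    by apply: le_eball Bx; rewrite lerDl ltW.
  have := le_trans (le_vol EA) (volU _ _).
  move=> /le_trans /(_ (leeD (volU _ _) KD)) /le_trans /(_ (leeD (leeD (lexx _) HM) (lexx _))).
  have -> : vol A = (ballv (E `&` D) a M)%:E by exact: ballvE.
  rewrite vE -!EFinD !lee_fin /delta; lra.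
- move=> x [_ ax]; rewrite lerBlDr -lee_fin EFinD -!ballvE.
  apply: (@le_trans _ _ (vol ((D `&` eball x L) `|` (K `\` D)))).
    apply: le_vol => y [Cy xy]; have [Dy|nDy] := pselect (D y); [by left|right].
    split=> //; split=> //; apply: (eball_subset _ xy).
    by rewrite lerD2r ltW.
  by apply: (le_trans (volU _ _)); apply: leeD.
Qed.

Lemma perimeter_lower_bound :
  ((3^-1 * 8 ^- n.+1 * (v / r))%:E <= relative_perimeter C E)%E.
Proof.
have [D [A [eps1 [M [[mD cD DC Dfin Dbd] [eps10 Dnbh mA AED [vA HA]]]]]]] := truncation.
have AD : A `<=` D by move=> x /AED[].
have AE : A `<=` E by move=> x /AED[].
have v120 : 0 < v / 12 by rewrite divr_gt0.
have [e0 e00 He] := vanishing_leak_finite mE vE v120.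
pose eps := Num.min e0 eps1 / 2.
have m0 : 0 < Num.min e0 eps1 by rewrite lt_min e00.
have eps0 : 0 < eps by rewrite divr_gt0.
have eps_lt : eps < Num.min e0 eps1 by rewrite ltr_pdivrMr // mulr_natr mulr2n ltrDl.
have /andP[epse0 epse1] : (eps < e0) && (eps < eps1) by rewrite -lt_min.
(* The positive volume of the unit ball is read off from the hypothesis on balls of radius [r]. *)
have ball1 : (0 < vol (eball (0 : V) 1))%E.
  have : (0 < vol (eball a r))%E.
    apply: (@lt_le_trans _ _ v%:E); first by rewrite lte_fin.
    apply: (@le_trans _ _ (vol (C `&` eball a r))); last by apply: le_vol; exact: subIsetr.
    by rewrite ballvE lee_fin; exact: Hv.
  by rewrite vol_eball // pmule_rgt0 // lte_fin exprn_gt0.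
have mass0 := mass_gt0 eps0 ball1.
apply: le_trans (total_drop_le_perimeter mC cC mD cD DC L0 b00 Hb eps0 mE vE mA AD Dfin mass0 Dbd
  epse1 Dnbh).
have T0 := total0_ge mC mD DC b00 Hb eps0 mE vE mA AD AE Dfin.
have T1 := total1_le eps mC mD DC b00 Hb mE vE mA AD AE Dfin.
have Wm := integral_weight_ge mC mD DC b00 Hb mE vE mA AD Dfin (ltW delta0) HA.
have J := He _ eps0 epse0.
set W := (\int[_]_p _ p)%R in T0 Wm.
set t0 := total _ _ _ _ _ _ 0 in T0 *; set t1 := total _ _ _ _ _ _ 1 in T1 *.
set m := mass eps in mass0 J T0 *.
have {}T0 : m * W - m * (v / 12) <= t0.
  rewrite lerBlDr -lee_fin EFinD; apply: (le_trans T0); exact: leeD.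
have {}T1 : t1 <= v / b0 * (m * (v / 12)).
  rewrite -lee_fin; apply: (le_trans T1); rewrite (EFinM (v / b0)); apply: lee_wpmul2l => //.
  by rewrite lee_fin divr_ge0 ?ltW.
have vb : v / b0 = 1 / 2 by rewrite /b0; field; rewrite gt_eqF.
have db : 1 - (delta + v) / b0 = 15 / 32.
  by rewrite /b0 /delta; field; rewrite gt_eqF.
have {}Wm : 15 / 32 * (7 / 8 * v) <= W.
  rewrite -lee_fin; apply: le_trans Wm; rewrite db (EFinM (15 / 32)); exact: lee_wpmul2l.
(* 15/32 of 7/8 v is 105/256 v; the leak v / 12 at time 0 and half of it at time 1 take 1/8 v,
   leaving 73/256 v, more than v / 4. *)
have drop : m * (v / 4) <= t0 - t1.
  have h1 : m * (15 / 32 * (7 / 8 * v)) <= m * W by rewrite ler_wpM2l // ltW.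
  have mv : 0 <= m * v by rewrite mulr_ge0 // ltW.
  move: T1; rewrite vb => T1; lra.
rewrite lee_fin /flow_scale.
set q : R := 4 ^+ n.+1; have q0 : 0 < q by rewrite exprn_gt0.
(* Since 8^(n+1) = 4^(n+1) 2^(n+1), this is 4 <= 2^(n+1). *)
have q8 : 4 * q <= 8 ^+ n.+1.
  have -> : 8 = 4 * 2 :> R by ring.
  rewrite exprMn mulrC ler_wpM2l ?(ltW q0) //.
  have -> : 4 = 2 ^+ 2 :> R by ring.
  by apply: ler_weXn2l => //; rewrite ler1n.
apply: (@le_trans _ _ ((L * (q * m))^-1 * (m * (v / 4)))); last first.
  by rewrite ler_wpM2l // invr_ge0 !mulr_ge0 // ltW.
have -> : (L * (q * m))^-1 * (m * (v / 4)) = 3^-1 * (4 * q)^-1 * (v / r).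
  by rewrite /L; field; rewrite !gt_eqF.
rewrite ler_wpM2r ?divr_ge0 ?(ltW v0) ?(ltW r0) // ler_wpM2l ?invr_ge0 //.
by rewrite lef_pV2 // posrE ?exprn_gt0 // mulr_gt0.
Qed.

End perimeter_lower_bound.

Theorem corollary7p7 (R : realType) (n : nat) (hn : (1 <= n)%N)
    (C : set 'rV[R]_n.+1)
    (hC : convex_body C) (hU : uniform_geometry C) (v : R) (hv : 0 < v) :
  ((n.+1%:R : R)%:E * (v%:E / reciprocal_ball_volume C v)
     >= isoperimetric_profile C v)%E /\
  (isoperimetric_profile C v
     >= (3^-1 * 8 ^- n.+1 : R)%:E * (v%:E / reciprocal_ball_volume C v))%E.
Proof.
have [clC cvC [a /nbhs_eballP[rho rho0 aC]]] := hC.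
have mC : lebesgue_measurable C by exact: measurable_closed.
have cC := convex_segment_closed cvC.
have C0 : C !=set0 by exists a; apply: aC; rewrite /eball /= subrr enorm0.
have ubC := hU.1.
split; first exact: profile_upper_bound.
have k0 : 0 < 3^-1 * 8 ^- n.+1 :> R by rewrite mulr_gt0 ?invr_gt0 ?exprn_gt0.
apply: (profile_lower_bound C0 hv k0) => E r mE EC vE r0 Hv.
exact: (perimeter_lower_bound hn mC cC ubC rho0 aC mE EC vE).
Qed.
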